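(* Let $p(x)=a_dx^d+\cdots+a_1x$ be a real polynomial of degree $d\ge2$ with $p(0)=0$, $p'(0)=\lambda>1$, whose Fatou component $\mathcal{F}_\infty$ containing $\infty$ contains an angular region $W_\beta=\{z\ne0:|\arg z|<\beta\}$ for some $\beta>0$, and let $\mathcal{J}_p$ denote its Julia set. Let $\Phi$ be the entire solution of $\Phi(\lambda z)=p(\Phi(z))$, $\Phi(0)=0$, $\Phi'(0)=1$, let $\rho=\log_\lambda d$, and let $F$ be the $1$-periodic holomorphic function on $\{|\Im w|<\beta/\log\lambda\}$ such that for all $\varepsilon>0$, $M>0$, $\Phi(z)=a_d^{-1/(d-1)}\exp\left(z^\rho F(\log_\lambda z)+o(|z|^{-M})\right)$ uniformly as $|z|\to\infty$ in $|\arg z|\le\beta-\varepsilon$. Assume that there is an angle $\gamma$ such that $\Phi(\{re^{i\gamma}: r>0\})$ intersects both $\mathcal{F}_\infty$ and $\mathcal{J}_p$. Then $F$ is not constant.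
   Context: $\log_\lambda z=\log z/\log\lambda$. Fatou and Julia sets are the standard notions of complex dynamics for the polynomial $p$. *)

(* Defs.v *)
From Stdlib Require Import Reals.
From Coquelicot Require Import Coquelicot.
Open Scope R_scope.

Definition cexp (z : C) : C :=
  (exp (fst z) * cos (snd z), exp (fst z) * sin (snd z)).

(* Principal argument in (-pi, pi]; on C \ (-oo,0] it is 2 atan(y/(|z|+x)),
   on the closed negative real half-line (and at 0) it is set to pi. *)
Definition carg (z : C) : R :=
  if Req_EM_T (Cmod z + fst z) 0 then PI
  else 2 * atan (snd z / (Cmod z + fst z)).

Definition clog (z : C) : C := (ln (Cmod z), carg z).
Definition cpow (z s : C) : C := cexp (Cmult s (clog z)).

Definition peval (a : nat -> R) (d : nat) (z : C) : C :=
  @sum_n C_AbelianMonoid (fun k => Cmult (RtoC (a k)) (@pow_n C_Ring z k)) d.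

Fixpoint iter (f : C -> C) (n : nat) (z : C) : C :=
  match n with O => z | S n => f (iter f n z) end.

Definition strict_incr (phi : nat -> nat) : Prop :=
  forall k, (phi k < phi (S k))%nat.

Definition fatou (f : C -> C) (z : C) : Prop :=
  exists r, 0 < r /\
  forall phi : nat -> nat, strict_incr phi ->
  exists psi : nat -> nat, strict_incr psi /\
   ((exists g : C -> C, forall eps, 0 < eps -> exists N, forall j, (N <= j)%nat ->
        forall w, Cmod (Cminus w z) <= r ->
          Cmod (Cminus (iter f (phi (psi j)) w) (g w)) < eps)
    \/
    (forall M, exists N, forall j, (N <= j)%nat ->
        forall w, Cmod (Cminus w z) <= r -> M < Cmod (iter f (phi (psi j)) w))).

Definition julia (f : C -> C) (z : C) : Prop := ~ fatou f z.

Definition connected_set (S : C -> Prop) : Prop :=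
  forall U V : C -> Prop, @open C_UniformSpace U -> @open C_UniformSpace V ->
    (forall z, S z -> U z \/ V z) ->
    (forall z, ~ (S z /\ U z /\ V z)) ->
    (forall z, ~ (S z /\ U z)) \/ (forall z, ~ (S z /\ V z)).

(* The (finite part of the) Fatou component containing oo: the points z lying
   in a connected unbounded subset of the Fatou set (in C). *)
Definition fatou_inf (f : C -> C) (z : C) : Prop :=
  exists S : C -> Prop, connected_set S /\ (forall w, S w -> fatou f w) /\
    S z /\ (forall R, exists w, S w /\ R < Cmod w).

Definition sector (beta : R) (z : C) : Prop := z <> RtoC 0 /\ Rabs (carg z) < beta.

Definition holo_at (f : C -> C) (z : C) : Prop := @ex_derive C_AbsRing C_NormedModule f z.

(* Main.v *)
Require Import Defs.
From Stdlib Require Import Reals Lra Lia Psatz Classical.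
From Coquelicot Require Import Coquelicot.
Open Scope R_scope.

(** Suppose [F = c]. Since [p] is real, so is [Phi] on the real axis, hence [c]
    is real, and [c > 0] because [Phi] maps small positive reals into the
    basin of infinity. In the coordinate [t = c z^rho] the function
    [K t = Phi z] satisfies [K (d t) = p (K t)] and [K t ~ alpha exp t] near
    the positive axis. As [p] expands relative distances near infinity,
    [K (t + 2 pi i) = K t] for large [Re t], and by the identity theorem on the
    whole upper half-plane. Since
    [K t] behaves like [t ^ (1 / rho)] at 0, while periodicity makes it
    differentiable there, [rho <= 1]; so rays in the upper half of the [z]-plane
    correspond to rays in the upper half of the [t]-plane.

    The set of [t] for which [K t] escapes is open and invariant under [t -> d t]
    and [t -> t + 2 pi i], hence under the dense group of translations by
    [2 pi i k / d^n], hence under all vertical translations. It contains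
    [Re t > 0] and avoids [Re t = 0]. If it avoids a line [Re t = x2 < 0], it
    avoids all lines [Re t = d^n x2], on which [K] is then bounded by the escape
    radius; by the maximum principle [K] is so bounded between these lines and
    the imaginary axis, and nothing in [Re t < 0] escapes. So along a ray
    either all points or no points escape.

    The maximum principle is derived from a four point mean value inequality,
    which only needs second order expansions; these exist for the polynomials
    [p^n (z / lam^n)], whose locally uniform limit is [Phi]. *)

(** Escaping is the dynamical notion that carries the argument: points of the unbounded Fatou
    component escape, and escaping points lie in the Fatou set. So the assumed ray contains one
    escaping and one non-escaping point, and it suffices that escaping be constant along each ray.

    Since [rho] need not be an integer, [t = c z ^ rho] has several branches. The one chosen is
    continuous on the closed upper half-plane without 0, which [t -> d t] and [t -> t + 2 pi i] map
    into itself. Rays with angle in [[0, pi]] are treated there; the others follow from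
    [Phi (conj z) = conj (Phi z)]. The inequality [rho <= 1] keeps the image [rho gamma] of an angle
    [gamma <= pi] in this half-plane.

    The period is compatible with the functional equation because [d] is an integer: [2 pi i d^n] is
    again a period of [exp].

    [Phi] is given with one complex derivative, which does not feed the four point inequality
    directly; second order expansions are built by algebra for powers, [exp] and [log], and reach
    [Phi] through uniform limits. *)

(** * Elementary estimates for the complex modulus *)

Lemma Cmod_minus_sym (x y : C) : Cmod (x - y) = Cmod (y - x).
Proof. rewrite <- (Cmod_opp (x - y)). f_equal; ring. Qed.

Lemma Cmod_triangle_rev (x y : C) : Cmod x - Cmod y <= Cmod (x - y).
Proof.
  replace x with ((x - y) + y)%C at 1 by ring.
  pose proof (Cmod_triangle (x - y) y); lra.
Qed.

Lemma Rabs_fst_le (z : C) : Rabs (fst z) <= Cmod z.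
Proof. eapply Rle_trans; [apply Rmax_l | apply Rmax_Cmod]. Qed.

Lemma Rabs_snd_le (z : C) : Rabs (snd z) <= Cmod z.
Proof. eapply Rle_trans; [apply Rmax_r | apply Rmax_Cmod]. Qed.

Lemma Cmod_le_sum (z : C) : Cmod z <= Rabs (fst z) + Rabs (snd z).
Proof.
  unfold Cmod.
  rewrite <- (sqrt_Rsqr (Rabs (fst z) + Rabs (snd z))).
  - apply sqrt_le_1_alt. unfold Rsqr.
    rewrite <- !(pow2_abs (fst z)), <- !(pow2_abs (snd z)).
    pose proof (Rabs_pos (fst z)); pose proof (Rabs_pos (snd z)); nra.
  - pose proof (Rabs_pos (fst z)); pose proof (Rabs_pos (snd z)); lra.
Qed.

Lemma Cmod_sqr (z : C) : Cmod z * Cmod z = fst z * fst z + snd z * snd z.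
Proof.
  unfold Cmod. rewrite sqrt_sqrt; nra.
Qed.

(** * Two-jets of complex functions *)

Definition o2 (f : C -> C) : Prop :=
  forall eps, 0 < eps -> exists del, 0 < del /\
    forall h, Cmod h <= del -> Cmod (f h) <= eps * (Cmod h * Cmod h).

Definition bounded_near0 (f : C -> C) : Prop :=
  exists M del, 0 < del /\ forall h, Cmod h <= del -> Cmod (f h) <= M.

Lemma o2_ext (f g : C -> C) : (forall h, f h = g h) -> o2 f -> o2 g.
Proof.
  intros E H eps He. destruct (H eps He) as [del [Hd H']].
  exists del; split; auto. intros h Hh. rewrite <- E; auto.
Qed.

Lemma o2_plus (f g : C -> C) : o2 f -> o2 g -> o2 (fun h => f h + g h)%C.
Proof.
  intros Hf Hg eps He.
  destruct (Hf (eps / 2)) as [d1 [D1 H1]]; [lra|].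
  destruct (Hg (eps / 2)) as [d2 [D2 H2]]; [lra|].
  exists (Rmin d1 d2); split; [now apply Rmin_pos|].
  intros h Hh. specialize (H1 h (Rle_trans _ _ _ Hh (Rmin_l _ _))).
  specialize (H2 h (Rle_trans _ _ _ Hh (Rmin_r _ _))).
  pose proof (Cmod_triangle (f h) (g h)); lra.
Qed.

Lemma o2_mult (f g : C -> C) :
  o2 f -> bounded_near0 g -> o2 (fun h => f h * g h)%C.
Proof.
  intros Hf [M [d1 [D1 HM]]] eps He.
  assert (M0 : 0 < Rmax M 1) by (eapply Rlt_le_trans; [|apply Rmax_r]; lra).
  destruct (Hf (eps / Rmax M 1)) as [d2 [D2 H2]].
  { apply Rdiv_lt_0_compat; auto. }
  exists (Rmin d1 d2); split; [now apply Rmin_pos|].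
  intros h Hh. specialize (HM h (Rle_trans _ _ _ Hh (Rmin_l _ _))).
  specialize (H2 h (Rle_trans _ _ _ Hh (Rmin_r _ _))).
  rewrite Cmod_mult.
  replace (eps * (Cmod h * Cmod h))
    with ((eps / Rmax M 1 * (Cmod h * Cmod h)) * Rmax M 1) by (field; lra).
  apply Rmult_le_compat; auto using Cmod_ge_0.
  eapply Rle_trans; [apply HM|apply Rmax_l].
Qed.

Lemma o2_cubic (f : C -> C) (K del : R) : 0 < del ->
  (forall h, Cmod h <= del -> Cmod (f h) <= K * (Cmod h * Cmod h * Cmod h)) -> o2 f.
Proof.
  intros Hd H eps He.
  assert (K0 : 0 < Rmax K 1) by (eapply Rlt_le_trans; [|apply Rmax_r]; lra).
  exists (Rmin del (eps / Rmax K 1)); split.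
  { apply Rmin_pos; [assumption|apply Rdiv_lt_0_compat; auto]. }
  intros h Hh. specialize (H h (Rle_trans _ _ _ Hh (Rmin_l _ _))).
  assert (Hh2 : Cmod h <= eps / Rmax K 1) by (eapply Rle_trans; [apply Hh|apply Rmin_r]).
  pose proof (Cmod_ge_0 h) as Hp.
  assert (Hk : Rmax K 1 * Cmod h <= eps).
  { replace eps with (Rmax K 1 * (eps / Rmax K 1)) by (field; lra).
    apply Rmult_le_compat_l; lra. }
  pose proof (Rmax_l K 1).
  eapply Rle_trans; [apply H|].
  replace (K * (Cmod h * Cmod h * Cmod h)) with ((K * Cmod h) * (Cmod h * Cmod h)) by ring.
  apply Rmult_le_compat_r; nra.
Qed.

Lemma o2_hhh : o2 (fun h => h * h * h)%C.
Proof.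
  apply (o2_cubic _ 1 1); [lra|]. intros h _. rewrite !Cmod_mult. lra.
Qed.

Lemma bounded_near0_const (c : C) : bounded_near0 (fun _ => c).
Proof. exists (Cmod c), 1; split; [lra|]; intros; lra. Qed.

Lemma bounded_near0_id : bounded_near0 (fun h => h).
Proof. exists 1, 1; split; [lra|]; intros; lra. Qed.

Lemma bounded_near0_plus (f g : C -> C) :
  bounded_near0 f -> bounded_near0 g -> bounded_near0 (fun h => f h + g h)%C.
Proof.
  intros [M [d1 [D1 H1]]] [N [d2 [D2 H2]]].
  exists (M + N), (Rmin d1 d2); split; [now apply Rmin_pos|].
  intros h Hh. specialize (H1 h (Rle_trans _ _ _ Hh (Rmin_l _ _))).
  specialize (H2 h (Rle_trans _ _ _ Hh (Rmin_r _ _))).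
  pose proof (Cmod_triangle (f h) (g h)); lra.
Qed.

Lemma bounded_near0_mult (f g : C -> C) :
  bounded_near0 f -> bounded_near0 g -> bounded_near0 (fun h => f h * g h)%C.
Proof.
  intros [M [d1 [D1 H1]]] [N [d2 [D2 H2]]].
  exists (M * N), (Rmin d1 d2); split; [now apply Rmin_pos|].
  intros h Hh. specialize (H1 h (Rle_trans _ _ _ Hh (Rmin_l _ _))).
  specialize (H2 h (Rle_trans _ _ _ Hh (Rmin_r _ _))).
  rewrite Cmod_mult. apply Rmult_le_compat; auto using Cmod_ge_0.
Qed.

Lemma bounded_near0_o2 (f : C -> C) : o2 f -> bounded_near0 f.
Proof.
  intros H. destruct (H 1) as [d [D Hd]]; [lra|].
  exists (d * d), d; split; auto. intros h Hh.
  specialize (Hd h Hh). pose proof (Cmod_ge_0 h). nra.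
Qed.

Create HintDb jets.
#[local] Hint Resolve o2_hhh bounded_near0_const bounded_near0_id bounded_near0_plus
  bounded_near0_mult bounded_near0_o2 o2_plus o2_mult : jets.

(** [f2] is half the second derivative. A remainder [o (|h|^2)] is stable under products and
    composition and is all that the four point inequality consumes. *)
Definition jet2 (f : C -> C) (z f1 f2 : C) : Prop :=
  o2 (fun h => f (z + h) - (f z + f1 * h + f2 * (h * h)))%C.

Definition has_jet2 (f : C -> C) (z : C) : Prop := exists f1 f2, jet2 f z f1 f2.

Lemma has_jet2_ext (f g : C -> C) (z : C) :
  (forall w, f w = g w) -> has_jet2 f z -> has_jet2 g z.
Proof.
  intros E [f1 [f2 H]]. exists f1, f2. eapply o2_ext; [|apply H].
  intros h; simpl. now rewrite !E.
Qed.

Lemma has_jet2_const (c z : C) : has_jet2 (fun _ => c) z.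
Proof.
  exists 0%C, 0%C. apply (o2_cubic _ 1 1); [lra|]. intros h _.
  replace (c - (c + 0 * h + 0 * (h * h)))%C with (RtoC 0) by ring.
  rewrite Cmod_0. pose proof (Cmod_ge_0 h). apply Rmult_le_pos; [lra|].
  repeat apply Rmult_le_pos; auto.
Qed.

Lemma has_jet2_id (z : C) : has_jet2 (fun w => w) z.
Proof.
  exists 1%C, 0%C. apply (o2_cubic _ 1 1); [lra|]. intros h _.
  replace (z + h - (z + 1 * h + 0 * (h * h)))%C with (RtoC 0) by ring.
  rewrite Cmod_0. pose proof (Cmod_ge_0 h). apply Rmult_le_pos; [lra|].
  repeat apply Rmult_le_pos; auto.
Qed.

Lemma has_jet2_plus (f g : C -> C) (z : C) :
  has_jet2 f z -> has_jet2 g z -> has_jet2 (fun w => f w + g w)%C z.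
Proof.
  intros [f1 [f2 Hf]] [g1 [g2 Hg]]. exists (f1 + g1)%C, (f2 + g2)%C.
  eapply o2_ext; [|apply (o2_plus _ _ Hf Hg)]. intros h; simpl; ring.
Qed.

Lemma has_jet2_mult (f g : C -> C) (z : C) :
  has_jet2 f z -> has_jet2 g z -> has_jet2 (fun w => f w * g w)%C z.
Proof.
  intros [f1 [f2 Hf]] [g1 [g2 Hg]].
  exists (f1 * g z + f z * g1)%C, (f2 * g z + f1 * g1 + f z * g2)%C.
  unfold jet2 in *.
  set (r := fun h => (f (z + h) - (f z + f1 * h + f2 * (h * h)))%C) in Hf.
  set (s := fun h => (g (z + h) - (g z + g1 * h + g2 * (h * h)))%C) in Hg.
  (* After expansion of the product, each term beyond order two contains [r], [s] or [h * h * h]. *)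
  apply (o2_ext (fun h =>
    r h * (g z + g1 * h + g2 * (h * h)) + s h * (f z + f1 * h + f2 * (h * h))
    + r h * s h + (h * h * h) * (f1 * g2 + f2 * g1 + f2 * g2 * h))%C).
  { intros h; unfold r, s; ring. }
  auto 12 with jets.
Qed.

Lemma has_jet2_opp (f : C -> C) (z : C) :
  has_jet2 f z -> has_jet2 (fun w => - f w)%C z.
Proof.
  intros H. apply (has_jet2_ext (fun w => (-(1)) * f w)%C); [intros; ring|].
  apply has_jet2_mult; auto using has_jet2_const.
Qed.

Lemma has_jet2_minus (f g : C -> C) (z : C) :
  has_jet2 f z -> has_jet2 g z -> has_jet2 (fun w => f w - g w)%C z.
Proof. intros Hf Hg. apply has_jet2_plus; auto using has_jet2_opp. Qed.

Lemma jet2_incr_lin (f : C -> C) (z f1 f2 : C) : jet2 f z f1 f2 ->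
  exists K del, 0 < K /\ 0 < del /\
    forall h, Cmod h <= del -> Cmod (f (z + h)%C - f z) <= K * Cmod h.
Proof.
  intros H. destruct (H 1) as [d [D Hd]]; [lra|].
  exists (Cmod f1 + Cmod f2 + 2), (Rmin d 1).
  pose proof (Cmod_ge_0 f1); pose proof (Cmod_ge_0 f2).
  split; [lra|]. split; [apply Rmin_pos; lra|]. intros h Hh.
  assert (h1 : Cmod h <= 1) by (eapply Rle_trans; [apply Hh|apply Rmin_r]).
  specialize (Hd h (Rle_trans _ _ _ Hh (Rmin_l _ _))).
  set (e := (f (z + h) - (f z + f1 * h + f2 * (h * h)))%C) in *.
  replace (f (z + h) - f z)%C with (f1 * h + (f2 * (h * h) + e))%C by (unfold e; ring).
  pose proof (Cmod_triangle (f1 * h) (f2 * (h * h) + e)).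
  pose proof (Cmod_triangle (f2 * (h * h)) e).
  rewrite !Cmod_mult in *. pose proof (Cmod_ge_0 h).
  assert (Cmod h * Cmod h <= Cmod h) by nra.
  assert (Cmod f2 * (Cmod h * Cmod h) <= Cmod f2 * Cmod h) by nra.
  nra.
Qed.

Definition ccont (f : C -> C) (z : C) : Prop :=
  forall eps, 0 < eps -> exists del, 0 < del /\
    forall w, Cmod (w - z) <= del -> Cmod (f w - f z) <= eps.

Lemma has_jet2_cont (f : C -> C) (z : C) : has_jet2 f z -> ccont f z.
Proof.
  intros [f1 [f2 H]]. destruct (jet2_incr_lin f z f1 f2 H) as [K [d [HK [D Hd]]]].
  intros eps He. exists (Rmin d (eps / K)). split.
  { apply Rmin_pos; [assumption|now apply Rdiv_lt_0_compat]. }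
  intros w Hw. specialize (Hd (w - z)%C (Rle_trans _ _ _ Hw (Rmin_l _ _))).
  replace (z + (w - z))%C with w in Hd by ring.
  assert (Cmod (w - z) <= eps / K) by (eapply Rle_trans; [apply Hw|apply Rmin_r]).
  replace eps with (K * (eps / K)) by (field; lra).
  eapply Rle_trans; [apply Hd|]. apply Rmult_le_compat_l; lra.
Qed.

Lemma has_jet2_comp (g f : C -> C) (z : C) :
  has_jet2 f z -> has_jet2 g (f z) -> has_jet2 (fun w => g (f w)) z.
Proof.
  intros [f1 [f2 Hf]] [g1 [g2 Hg]].
  exists (g1 * f1)%C, (g1 * f2 + g2 * (f1 * f1))%C.
  destruct (jet2_incr_lin f z f1 f2 Hf) as [K [d [HK [D Hd]]]].
  unfold jet2 in *.
  set (k := fun h => (f (z + h) - f z)%C).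
  set (s := fun h => (g (f z + h) - (g (f z) + g1 * h + g2 * (h * h)))%C) in Hg.
  assert (Hs : o2 (fun h => s (k h))).
  { intros eps He. destruct (Hg (eps / (K * K))) as [d' [D' Hs]].
    { apply Rdiv_lt_0_compat; nra. }
    exists (Rmin d (d' / K)). split.
    { apply Rmin_pos; [assumption|now apply Rdiv_lt_0_compat]. }
    intros h Hh. specialize (Hd h (Rle_trans _ _ _ Hh (Rmin_l _ _))).
    assert (Hh2 : Cmod h <= d' / K) by (eapply Rle_trans; [apply Hh|apply Rmin_r]).
    assert (Hk : Cmod (k h) <= d').
    { replace d' with (K * (d' / K)) by (field; lra).
      eapply Rle_trans; [apply Hd|]. apply Rmult_le_compat_l; lra. }
    eapply Rle_trans; [apply (Hs _ Hk)|].
    replace (eps * (Cmod h * Cmod h))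
      with (eps / (K * K) * ((K * Cmod h) * (K * Cmod h))) by (field; lra).
    apply Rmult_le_compat_l.
    - apply Rlt_le, Rdiv_lt_0_compat; nra.
    - unfold k. apply Rmult_le_compat; auto using Cmod_ge_0. }
  set (r := fun h => (f (z + h) - (f z + f1 * h + f2 * (h * h)))%C) in Hf.
  (* With [k h = f1 h + f2 h^2 + r h], the remainder is [s (k h) + g1 r + g2 (k^2 - f1^2 h^2)]; the
     last bracket is sorted into multiples of [r] and of [h^3]. *)
  apply (o2_ext (fun h =>
    s (k h) + r h * g1
    + r h * (g2 * (f1 * h + f1 * h + f2 * (h * h) + f2 * (h * h) + r h))
    + (h * h * h) * (g2 * (f1 * f2 + f1 * f2 + f2 * f2 * h)))%C).
  { intros h; unfold s, k, r. replace (f z + (f (z + h) - f z))%C with (f (z + h)%C) by ring.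
    ring. }
  auto 16 with jets.
Qed.

(** The geometric series has the exact remainder [- h^3 / (z^3 (z + h))], and [|z + h| >= |z| / 2]
    for small [h]. *)
Lemma has_jet2_inv (z : C) : z <> 0%C -> has_jet2 (fun w => / w)%C z.
Proof.
  intros Hz. assert (Hm : 0 < Cmod z) by now apply Cmod_gt_0.
  exists (- (/ z * / z))%C, (/ z * / z * / z)%C.
  assert (Hb : forall h, Cmod h <= Cmod z / 2 -> Cmod z / 2 <= Cmod (z + h)).
  { intros h Hh. pose proof (Cmod_triangle_rev z (- h)%C) as T.
    rewrite Cmod_opp in T. replace (z - - h)%C with (z + h)%C in T by ring. lra. }
  apply (o2_cubic _ (Rabs (2 / (Cmod z * Cmod z * Cmod z * Cmod z))) (Cmod z / 2)); [lra|].
  intros h Hh. specialize (Hb h Hh).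
  assert (Hzh : (z + h)%C <> 0%C) by (apply Cmod_gt_0; lra).
  replace (/ (z + h) - (/ z + - (/ z * / z) * h + / z * / z * / z * (h * h)))%C
    with (- ((h * h * h) / (z * z * z * (z + h))))%C by (field; auto).
  rewrite Cmod_opp, Cmod_div, !Cmod_mult.
  2:{ repeat apply Cmult_neq_0; auto. }
  rewrite Rabs_pos_eq.
  2:{ apply Rlt_le, Rdiv_lt_0_compat; [lra|]. repeat apply Rmult_lt_0_compat; auto. }
  set (m := Cmod z) in *. set (q := Cmod (z + h)) in *. set (hh := Cmod h * Cmod h * Cmod h).
  assert (0 <= hh) by (unfold hh; pose proof (Cmod_ge_0 h); repeat apply Rmult_le_pos; auto).
  replace (2 / (m * m * m * m) * hh) with (hh * / (m * m * m * (m / 2))) by (field; lra).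
  unfold Rdiv at 1. apply Rmult_le_compat_l; auto.
  assert (0 < m * m * m) by (repeat apply Rmult_lt_0_compat; auto).
  apply Rinv_le_contravar; [apply Rmult_lt_0_compat; lra|].
  apply Rmult_le_compat_l; lra.
Qed.

Lemma has_jet2_pow (f : C -> C) (n : nat) (z : C) :
  has_jet2 f z -> has_jet2 (fun w => @pow_n C_Ring (f w) n) z.
Proof.
  intros Hf. induction n as [|n IH]; simpl.
  - apply has_jet2_const.
  - apply (has_jet2_mult f); auto.
Qed.

(** * The second order expansion of the exponential *)

(** The mean value theorem applied to the remainder, whose derivative is [o (x)] because [f'] is
    differentiable at 0. *)
Lemma taylor2 (f f' : R -> R) (l : R) :
  (forall x, is_derive f x (f' x)) -> is_derive f' 0 l ->
  forall eps, 0 < eps -> exists del, 0 < del /\ forall x, Rabs x <= del ->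
    Rabs (f x - (f 0 + f' 0 * x + l / 2 * (x * x))) <= eps * (x * x).
Proof.
  intros Hf Hf' eps He.
  apply is_derive_Reals in Hf'.
  destruct (Hf' eps He) as [del Hdel].
  assert (B : forall x, Rabs x < del -> Rabs (f' x - f' 0 - l * x) <= eps * Rabs x).
  { intros x Hx. destruct (Req_dec x 0) as [->|Hx0].
    - replace (f' 0 - f' 0 - l * 0) with 0 by ring. rewrite !Rabs_R0; lra.
    - specialize (Hdel x Hx0 Hx). rewrite Rplus_0_l in Hdel.
      replace (f' x - f' 0 - l * x) with (((f' x - f' 0) / x - l) * x) by (field; auto).
      rewrite Rabs_mult. apply Rmult_le_compat_r; [apply Rabs_pos|lra]. }
  exists (del / 2). pose proof (cond_pos del). split; [lra|].
  intros x Hx.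
  set (g := fun x => f x - (f 0 + f' 0 * x + l / 2 * (x * x))).
  destruct (MVT_gen g 0 x (fun x => f' x - f' 0 - l * x)) as [c [Hc Hg]].
  - intros y _. unfold g.
    replace (f' y - f' 0 - l * y) with (f' y - (f' 0 + l * y)) by ring.
    apply (is_derive_minus f (fun x => f 0 + f' 0 * x + l / 2 * (x * x))); [apply Hf|].
    auto_derive; auto; field.
  - intros y _. apply continuity_pt_filterlim, @ex_derive_continuous.
    unfold g. apply @ex_derive_minus; [eexists; apply Hf|]. auto_derive; auto.
  - assert (g 0 = 0) by (unfold g; ring).
    fold (g x). rewrite H0 in Hg. replace (g x) with ((f' c - f' 0 - l * c) * x) by lra.
    assert (Rabs c <= Rabs x).
    { destruct (Rle_dec 0 x).
      - rewrite Rmin_left, Rmax_right in Hc by lra. rewrite !Rabs_pos_eq; lra.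
      - rewrite Rmin_right, Rmax_left in Hc by lra. rewrite !Rabs_left1; lra. }
    rewrite Rabs_mult. rewrite <- (Rabs_pos_eq (x * x)) by nra. rewrite Rabs_mult, <- Rmult_assoc.
    apply Rmult_le_compat_r; [apply Rabs_pos|].
    eapply Rle_trans; [apply B; lra|]. apply Rmult_le_compat_l; lra.
Qed.

Lemma o2_real (r : R -> R) (k : C) :
  (forall eps, 0 < eps -> exists del, 0 < del /\ forall x, Rabs x <= del -> Rabs (r x) <= eps * (x * x)) ->
  o2 (fun h => RtoC (r (fst h)) * k)%C /\ o2 (fun h => RtoC (r (snd h)) * k)%C.
Proof.
  intros H. split; (apply o2_mult; [|apply bounded_near0_const]);
  intros eps He; destruct (H eps He) as [d [D Hd]]; exists d; split; auto;
  intros h Hh; rewrite Cmod_R; pose proof (Cmod_sqr h).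
  - eapply Rle_trans; [apply Hd; eapply Rle_trans; [apply Rabs_fst_le|]; auto|].
    apply Rmult_le_compat_l; nra.
  - eapply Rle_trans; [apply Hd; eapply Rle_trans; [apply Rabs_snd_le|]; auto|].
    apply Rmult_le_compat_l; nra.
Qed.

Lemma cexp_plus (z w : C) : cexp (z + w)%C = (cexp z * cexp w)%C.
Proof.
  unfold cexp, Cmult, Cplus; simpl. rewrite exp_plus, cos_plus, sin_plus.
  f_equal; ring.
Qed.

Lemma cexp_0 : cexp 0%C = 1%C.
Proof. unfold cexp; simpl. rewrite exp_0, cos_0, sin_0. unfold RtoC; f_equal; ring. Qed.

Lemma Cmod_cexp (z : C) : Cmod (cexp z) = exp (fst z).
Proof.
  pose proof (exp_pos (fst z)).
  assert (E : Cmod (cexp z) * Cmod (cexp z) = exp (fst z) * exp (fst z)).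
  { rewrite Cmod_sqr. unfold cexp; simpl.
    pose proof (sin2_cos2 (snd z)) as S; unfold Rsqr in S.
    transitivity (exp (fst z) * exp (fst z) * (sin (snd z) * sin (snd z) + cos (snd z) * cos (snd z))); [ring|].
    rewrite S; ring. }
  pose proof (Cmod_ge_0 (cexp z)). nra.
Qed.

Lemma jet2_cexp_0 : jet2 cexp 0%C 1%C (/ 2)%C.
Proof.
  destruct (o2_real (fun x => exp x - (exp 0 + exp 0 * x + 1 / 2 * (x * x))) 1%C) as [E _].
  { apply taylor2 with (f' := exp); [apply is_derive_exp|].
    pose proof (is_derive_exp 0) as D; rewrite exp_0 in D; exact D. }
  destruct (o2_real (fun x => cos x - (cos 0 + (- sin 0) * x + (-1) / 2 * (x * x))) 1%C) as [_ Hc].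
  { apply taylor2 with (f' := fun x => - sin x).
    - apply is_derive_cos.
    - replace (-1) with (opp (cos 0)) by (rewrite cos_0; reflexivity).
      apply (is_derive_opp sin), is_derive_sin. }
  destruct (o2_real (fun x => sin x - (sin 0 + cos 0 * x + 0 / 2 * (x * x))) Ci) as [_ Hs].
  { apply taylor2 with (f' := cos); [apply is_derive_sin|].
    pose proof (is_derive_cos 0) as D; rewrite sin_0, Ropp_0 in D; exact D. }
  rewrite exp_0, cos_0, sin_0 in *. simpl in E, Hc, Hs.
  set (r1 := fun h : C => (RtoC (exp (fst h) - (1 + 1 * fst h + 1 / 2 * (fst h * fst h))) * 1)%C) in E.
  set (r2 := fun h : C => (RtoC (cos (snd h) - (1 + - 0 * snd h + -1 / 2 * (snd h * snd h))) * 1)%C) in Hc.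
  set (r3 := fun h : C => (RtoC (sin (snd h) - (0 + 1 * snd h + 0 / 2 * (snd h * snd h))) * Ci)%C) in Hs.
  assert (B1 : bounded_near0 (fun h => RtoC (fst h))).
  { exists 1, 1; split; [lra|]. intros h Hh. rewrite Cmod_R. eapply Rle_trans; [apply Rabs_fst_le|auto]. }
  assert (B2 : bounded_near0 (fun h => RtoC (snd h))).
  { exists 1, 1; split; [lra|]. intros h Hh. rewrite Cmod_R. eapply Rle_trans; [apply Rabs_snd_le|auto]. }
  assert (T1 : o2 (fun h => RtoC (fst h) * RtoC (fst h) * RtoC (snd h))%C).
  { apply (o2_cubic _ 1 1); [lra|]. intros h _. rewrite !Cmod_mult, !Cmod_R.
    pose proof (Rabs_fst_le h); pose proof (Rabs_snd_le h); pose proof (Rabs_pos (fst h)); pose proof (Rabs_pos (snd h)).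
    rewrite Rmult_1_l. repeat apply Rmult_le_compat; auto. apply Rmult_le_pos; auto. }
  assert (T2 : o2 (fun h => RtoC (fst h) * RtoC (snd h) * RtoC (snd h))%C).
  { apply (o2_cubic _ 1 1); [lra|]. intros h _. rewrite !Cmod_mult, !Cmod_R.
    pose proof (Rabs_fst_le h); pose proof (Rabs_snd_le h); pose proof (Rabs_pos (fst h)); pose proof (Rabs_pos (snd h)).
    rewrite Rmult_1_l. repeat apply Rmult_le_compat; auto. apply Rmult_le_pos; auto. }
  unfold jet2.
  (* Multiplying the expansions of [exp x], [cos y] and [sin y] leaves, besides the real remainders,
     the mixed monomials of degree at least three, all of them multiples of [x^2 y] or [x y^2]. *)
  apply (o2_ext (fun h =>
     r1 h * (1 + Ci * RtoC (snd h) + (-(/2)) * (RtoC (snd h) * RtoC (snd h)) + (r2 h + r3 h)) +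
     (r2 h + r3 h) * (1 + RtoC (fst h) + / 2 * (RtoC (fst h) * RtoC (fst h)))
     + (RtoC (fst h) * RtoC (fst h) * RtoC (snd h)) * (Ci * / 2 + (-(/4)) * RtoC (snd h))
     + (RtoC (fst h) * RtoC (snd h) * RtoC (snd h)) * (-(/2)))%C).
  - intros [x y]. rewrite cexp_0. rewrite Cplus_0_l.
    unfold r1, r2, r3, cexp, Cminus, Copp, Cplus, Cmult, Ci, RtoC, Cinv; simpl.
    f_equal; field.
  - assert (o2 (fun h => (r2 h + r3 h)%C)) by auto with jets.
    auto 14 with jets.
Qed.

Lemma has_jet2_cexp (z : C) : has_jet2 cexp z.
Proof.
  exists (cexp z), (cexp z * / 2)%C.
  apply (o2_ext (fun h => (cexp (0 + h) - (cexp 0 + 1 * h + / 2 * (h * h))) * cexp z)%C).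
  - intros h. rewrite (cexp_plus z h), Cplus_0_l, cexp_0. ring.
  - apply o2_mult; [apply jet2_cexp_0|apply bounded_near0_const].
Qed.

(** * The complex logarithm *)

(** [carg] is twice an arctangent, and [sin b / (1 + cos b) = tan (b / 2)] recovers the half
    angle. *)
Lemma clog_cexp (s : C) : - PI < snd s < PI -> clog (cexp s) = s.
Proof.
  destruct s as [a b]; simpl; intros Hb.
  assert (Hc : 0 < cos (b / 2)) by (apply cos_gt_0; lra).
  assert (H1 : 1 + cos b = 2 * (cos (b / 2) * cos (b / 2))).
  { replace b with (2 * (b / 2)) at 1 by field. rewrite cos_2a_cos. ring. }
  assert (H2 : sin b = 2 * sin (b / 2) * cos (b / 2)).
  { replace b with (2 * (b / 2)) at 1 by field. apply sin_2a. }
  pose proof (exp_pos a) as Ha.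
  unfold clog, carg. rewrite Cmod_cexp. simpl.
  replace (exp a + exp a * cos b) with (exp a * (1 + cos b)) by ring.
  rewrite H1, H2, ln_exp.
  destruct Req_EM_T as [E|_].
  - exfalso. assert (0 < exp a * (2 * (cos (b / 2) * cos (b / 2)))); [|lra].
    repeat apply Rmult_lt_0_compat; lra.
  - f_equal.
    replace (exp a * (2 * sin (b / 2) * cos (b / 2)) / (exp a * (2 * (cos (b / 2) * cos (b / 2)))))
      with (tan (b / 2)) by (unfold tan; field; lra).
    rewrite atan_tan; lra.
Qed.

Lemma cexp_clog (z : C) : z <> 0%C -> cexp (clog z) = z.
Proof.
  intros Hz. apply Cmod_gt_0 in Hz. pose proof (Cmod_sqr z) as Hs.
  pose proof (Rabs_fst_le z) as Hx. apply Rabs_le_between in Hx.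
  unfold cexp, clog, carg; simpl. rewrite exp_ln by auto.
  destruct z as [x y]; simpl in *. set (r := Cmod (x, y)) in *.
  destruct Req_EM_T as [E|E].
  - rewrite cos_PI, sin_PI. assert (y * y = 0) by nra.
    f_equal; nra.
  (* [u] is the tangent of half the argument, and [1 + u^2 = 2 r / (r + x)]. *)
  - set (u := y / (r + x)).
    assert (Hrx : 0 < r + x) by lra.
    assert (Hu : 0 < sqrt (1 + u²)) by (apply sqrt_lt_R0; pose proof (Rle_0_sqr u); lra).
    assert (Hq : sqrt (1 + u²) * sqrt (1 + u²) = 2 * r / (r + x)).
    { rewrite sqrt_sqrt by (pose proof (Rle_0_sqr u); lra). unfold u, Rsqr.
      apply Rmult_eq_reg_r with ((r + x) * (r + x)); [|nra].
      field_simplify; [|lra|lra]. nra. }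
    rewrite cos_2a, sin_2a, cos_atan, sin_atan.
    replace (1 / sqrt (1 + u²) * (1 / sqrt (1 + u²)) - u / sqrt (1 + u²) * (u / sqrt (1 + u²)))
      with ((1 - u * u) / (sqrt (1 + u²) * sqrt (1 + u²))) by (field; lra).
    replace (2 * (u / sqrt (1 + u²)) * (1 / sqrt (1 + u²)))
      with ((2 * u) / (sqrt (1 + u²) * sqrt (1 + u²))) by (field; lra).
    rewrite Hq. unfold u. f_equal.
    + transitivity (((r + x) * (r + x) - y * y) / (2 * (r + x))); [field; lra|].
      apply Rmult_eq_reg_r with (2 * (r + x)); [|lra]. field_simplify; [|lra]. nra.
    + field; lra.
Qed.

Lemma ccont_pair_continuous (f : C -> R) (z : C) :
  continuity_2d_pt (fun x y => f (x, y)) (fst z) (snd z) ->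
  forall eps, 0 < eps -> exists del, 0 < del /\
    forall w, Cmod (w - z) <= del -> Rabs (f w - f z) <= eps.
Proof.
  intros H eps He. destruct (H (mkposreal eps He)) as [d Hd].
  exists (d / 2). pose proof (cond_pos d). split; [lra|].
  intros [x y] Hw. destruct z as [x0 y0]; simpl in *.
  pose proof (Rabs_fst_le ((x, y) - (x0, y0))) as F.
  pose proof (Rabs_snd_le ((x, y) - (x0, y0))) as G. simpl in F, G.
  apply Rlt_le, Hd; unfold Rminus; lra.
Qed.

Lemma continuity_2d_pt_Cmod (x y : R) : continuity_2d_pt (fun x y => Cmod (x, y)) x y.
Proof.
  intros eps. exists (mkposreal (eps / 2) ltac:(pose proof (cond_pos eps); lra)).
  simpl. intros u v Hu Hv.
  apply Rle_lt_trans with (Cmod ((u, v) - (x, y))).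
  - apply Rabs_le_between'. pose proof (Cmod_triangle_rev (u, v) (x, y)).
    pose proof (Cmod_triangle_rev (x, y) (u, v)). rewrite Cmod_minus_sym in H0. lra.
  - eapply Rle_lt_trans; [apply Cmod_le_sum|]. simpl. unfold Rminus in *. lra.
Qed.

(** The hypothesis excludes exactly the closed negative real half-line, the cut of [carg]. *)
Lemma ccont_clog (z : C) : 0 < Cmod z + fst z -> ccont clog z.
Proof.
  intros Hz. destruct z as [x y]; simpl in Hz.
  assert (Hr : 0 < Cmod (x, y)).
  { pose proof (Rabs_fst_le (x, y)) as F. simpl in F. apply Rabs_le_between in F. lra. }
  assert (C1 : continuity_2d_pt (fun x y => ln (Cmod (x, y))) x y).
  { apply (continuity_1d_2d_pt_comp ln (fun x y => Cmod (x, y))).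
    - apply continuity_pt_filterlim, @ex_derive_continuous. auto_derive; auto.
    - apply continuity_2d_pt_Cmod. }
  assert (C2 : continuity_2d_pt (fun x y => Cmod (x, y) + x) x y).
  { apply continuity_2d_pt_plus; [apply continuity_2d_pt_Cmod|apply continuity_2d_pt_id1]. }
  assert (C3 : continuity_2d_pt (fun x y => 2 * atan (y * / (Cmod (x, y) + x))) x y).
  { apply (continuity_2d_pt_mult (fun _ _ => 2)); [apply continuity_2d_pt_const|].
    apply (continuity_1d_2d_pt_comp atan (fun x y => y * / (Cmod (x, y) + x))).
    - apply continuity_pt_filterlim, @ex_derive_continuous. auto_derive; auto.
    - apply continuity_2d_pt_mult; [apply continuity_2d_pt_id2|].
      apply continuity_2d_pt_inv; [auto|lra]. }
  destruct (C2 (mkposreal _ Hz)) as [d0 Hd0]; simpl in Hd0.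
  intros eps He.
  destruct (ccont_pair_continuous (fun z => ln (Cmod z)) (x, y) C1 (eps / 2)) as [d1 [D1 H1]]; [lra|].
  destruct (ccont_pair_continuous (fun z => 2 * atan (snd z * / (Cmod z + fst z))) (x, y) C3 (eps / 2)) as [d2 [D2 H2]]; [lra|].
  pose proof (cond_pos d0).
  exists (Rmin (Rmin d1 d2) (d0 / 2)). split; [repeat apply Rmin_pos; lra|].
  intros w Hw.
  pose proof (Rmin_l (Rmin d1 d2) (d0 / 2)); pose proof (Rmin_r (Rmin d1 d2) (d0 / 2)).
  pose proof (Rmin_l d1 d2); pose proof (Rmin_r d1 d2).
  eapply Rle_trans; [apply Cmod_le_sum|].
  specialize (H1 w ltac:(lra)). specialize (H2 w ltac:(lra)).
  assert (Hw0 : 0 < Cmod w + fst w).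
  { destruct w as [u v]; simpl in *.
    pose proof (Rabs_fst_le ((u, v) - (x, y))) as F.
    pose proof (Rabs_snd_le ((u, v) - (x, y))) as G. simpl in F, G.
    specialize (Hd0 u v). apply Rabs_lt_between' in Hd0; unfold Rminus in *; lra. }
  unfold clog, carg; simpl fst; simpl snd.
  destruct Req_EM_T as [E|_]; [lra|]. destruct Req_EM_T as [E|_]; [simpl in E; lra|].
  unfold Rdiv, Rminus in *. simpl in *. lra.
Qed.

(* Quantitative inversion of the two-jet of [cexp]. *)
Lemma has_jet2_clog (z : C) : 0 < Cmod z + fst z -> has_jet2 clog z.
Proof.
  intros Hz.
  assert (Hz0 : z <> 0%C).
  { intros ->. rewrite Cmod_0 in Hz. simpl in Hz. lra. }
  pose proof (ccont_clog z Hz) as Hc.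
  set (k := fun h => (clog (z + h) - clog z)%C).
  assert (Hk0 : forall eps, 0 < eps -> exists del, 0 < del /\ forall h, Cmod h <= del -> Cmod (k h) <= eps).
  { intros eps He. destruct (Hc eps He) as [d [D Hd]]. exists d; split; auto.
    intros h Hh. apply Hd. now replace (z + h - z)%C with h by ring. }
  set (rho := fun w => (cexp (0 + w) - (cexp 0 + 1 * w + / 2 * (w * w)))%C).
  assert (Hzh : exists del, 0 < del /\ forall h, Cmod h <= del ->
     (h / z = k h + / 2 * (k h * k h) + rho (k h))%C).
  { assert (Hm : 0 < Cmod z) by now apply Cmod_gt_0.
    exists (Cmod z / 2); split; [lra|]. intros h Hh.
    assert (Hzh0 : (z + h)%C <> 0%C).
    { apply Cmod_gt_0. pose proof (Cmod_triangle_rev z (- h)%C) as T.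
      rewrite Cmod_opp in T. replace (z - - h)%C with (z + h)%C in T by ring. lra. }
    unfold rho. rewrite Cplus_0_l, cexp_0.
    assert (E : (cexp (k h) * z = z + h)%C).
    { rewrite <- (cexp_clog z Hz0) at 1. rewrite <- cexp_plus. unfold k.
      replace (clog (z + h) - clog z + clog z)%C with (clog (z + h)) by ring.
      now apply cexp_clog. }
    transitivity (cexp (k h) - 1)%C; [|ring].
    replace h with (cexp (k h) * z - z)%C at 1 by (rewrite E; ring). field; auto. }
  destruct Hzh as [d0 [D0 E]].
  destruct (jet2_cexp_0 (1/2)) as [dr [Dr Hr]]; [lra|].
  destruct (Hk0 (Rmin dr (1/2))) as [d1 [D1 Hk1]]; [apply Rmin_pos; lra|].
  (* From [h / z = w + w^2 / 2 + rho w] with [|w| <= 1/2] and [|rho w| <= |w|^2 / 2] follows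
     [|h / z| >= |w| - |w|^2 >= |w| / 2]. *)
  assert (Hlin : forall h, Cmod h <= Rmin d0 d1 -> Cmod (k h) <= 2 * Cmod (h / z)).
  { intros h Hh.
    specialize (E h (Rle_trans _ _ _ Hh (Rmin_l _ _))).
    specialize (Hk1 h (Rle_trans _ _ _ Hh (Rmin_r _ _))).
    pose proof (Rmin_l dr (1/2)); pose proof (Rmin_r dr (1/2)).
    specialize (Hr (k h) ltac:(lra)). fold (rho (k h)) in Hr.
    set (w := k h) in *. pose proof (Cmod_ge_0 w).
    pose proof (Cmod_triangle_rev w (- (/ 2 * (w * w) + rho w))%C) as T.
    rewrite Cmod_opp in T.
    replace (w - - (/ 2 * (w * w) + rho w))%C with (h / z)%C in T by (rewrite E; ring).
    pose proof (Cmod_triangle (/ 2 * (w * w)) (rho w)) as T2.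
    rewrite !Cmod_mult, Cmod_inv, Cmod_R, Rabs_pos_eq in T2; try lra.
    2:{ intros F. apply RtoC_inj in F. lra. }
    nra. }
  assert (Hbk : exists del K, 0 < del /\ 0 < K /\ forall h, Cmod h <= del -> Cmod (k h) <= K * Cmod h).
  { exists (Rmin d0 d1), (2 * / Cmod z). split; [now apply Rmin_pos|].
    assert (0 < Cmod z) by now apply Cmod_gt_0. split.
    - apply Rmult_lt_0_compat; [lra|now apply Rinv_0_lt_compat].
    - intros h Hh. rewrite Rmult_assoc, (Rmult_comm (/ _)).
      replace (Cmod h * / Cmod z) with (Cmod (h / z)); [now apply Hlin|].
      rewrite Cmod_div; auto. }
  destruct Hbk as [d [K [D [HK Hb]]]].
  assert (Hrho : o2 (fun h => rho (k h))).
  { intros eps He. destruct (jet2_cexp_0 (eps / (K * K))) as [d' [D' Hs]].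
    { apply Rdiv_lt_0_compat; nra. }
    exists (Rmin d (d' / K)). split.
    { apply Rmin_pos; [assumption|now apply Rdiv_lt_0_compat]. }
    intros h Hh. specialize (Hb h (Rle_trans _ _ _ Hh (Rmin_l _ _))).
    assert (Hh2 : Cmod h <= d' / K) by (eapply Rle_trans; [apply Hh|apply Rmin_r]).
    assert (Hk : Cmod (k h) <= d').
    { replace d' with (K * (d' / K)) by (field; lra).
      eapply Rle_trans; [apply Hb|]. apply Rmult_le_compat_l; lra. }
    eapply Rle_trans; [apply (Hs _ Hk)|].
    replace (eps * (Cmod h * Cmod h))
      with (eps / (K * K) * ((K * Cmod h) * (K * Cmod h))) by (field; lra).
    apply Rmult_le_compat_l.
    - apply Rlt_le, Rdiv_lt_0_compat; nra.
    - apply Rmult_le_compat; auto using Cmod_ge_0. }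
  assert (Hkb : bounded_near0 k).
  { exists 1. destruct (Hk0 1) as [dd [DD HH]]; [lra|]. exists dd; auto. }
  assert (Hkkk : o2 (fun h => k h * k h * k h)%C).
  { apply (o2_cubic _ (K * K * K) d); auto. intros h Hh. specialize (Hb h Hh).
    rewrite !Cmod_mult.
    replace (K * K * K * (Cmod h * Cmod h * Cmod h)) with ((K * Cmod h) * (K * Cmod h) * (K * Cmod h)) by ring.
    pose proof (Cmod_ge_0 (k h)).
    repeat apply Rmult_le_compat; auto. apply Rmult_le_pos; auto. }
  exists (/ z)%C, (- (/ 2 * (/ z * / z)))%C.
  set (r := fun h => rho (k h)) in Hrho.
  (* Substituting [h / z = k + k^2 / 2 + r] into [k - h / z + (h / z)^2 / 2] cancels [k] and [k^2]
     and leaves this sum. *)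
  assert (G : o2 (fun h =>
     r h * (-(1)) +
     r h * (k h + / 2 * (k h * k h) + / 2 * r h)
     + (k h * k h * k h) * (/2 + / 8 * k h))%C).
  { auto 14 with jets. }
  intros eps He. destruct (G eps He) as [d2 [D2 H2]].
  exists (Rmin d0 d2). split; [now apply Rmin_pos|]. intros h Hh.
  specialize (E h (Rle_trans _ _ _ Hh (Rmin_l _ _))).
  specialize (H2 h (Rle_trans _ _ _ Hh (Rmin_r _ _))).
  eapply Rle_trans; [|apply H2]. right. f_equal.
  fold (r h) in E.
  replace (clog (z + h) - (clog z + / z * h + - (/ 2 * (/ z * / z)) * (h * h)))%C
    with (k h - h / z + / 2 * ((h / z) * (h / z)))%C by (unfold k; field; auto).
  rewrite E. unfold r. set (w := k h). set (q := rho w).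
  assert (N8 : RtoC 8 <> 0%C) by (intros F; apply RtoC_inj in F; lra).
  assert (N2 : RtoC 2 <> 0%C) by (intros F; apply RtoC_inj in F; lra).
  replace (/ 8)%C with (/ 2 * / 2 * / 2)%C.
  2:{ replace (RtoC 8) with (2 * 2 * 2)%C by (rewrite <- !RtoC_mult; f_equal; ring). field; auto. }
  field; auto.
Qed.

(** * The maximum principle *)

(** Compactness of [[a, b]] without covers: [I] is an ideal of small sets that contains a
    neighbourhood of every point. The supremum of the [x] with [[a, x]] in the ideal must be [b]. *)
Lemma segment_ideal (I : (R -> Prop) -> Prop) (a b : R) : a <= b ->
  (forall A B : R -> Prop, (forall x, A x -> B x) -> I B -> I A) ->
  (forall A B : R -> Prop, I A -> I B -> I (fun x => A x \/ B x)) ->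
  (forall x, a <= x <= b -> exists del, 0 < del /\ I (fun y => Rabs (y - x) < del)) ->
  I (fun y => a <= y <= b).
Proof.
  intros Hab Imono Iunion Iloc.
  set (E := fun x => a <= x <= b /\ I (fun y => a <= y <= x)).
  destruct (completeness E) as [m [Hub Hlub]].
  { exists b. intros x [Hx _]; lra. }
  { exists a. split; [lra|]. destruct (Iloc a) as [d [D Hd]]; [lra|].
    revert Hd; apply Imono. intros x Hx. replace (x - a) with 0 by lra. now rewrite Rabs_R0. }
  assert (Ham : a <= m).
  { apply Hub. split; [lra|]. destruct (Iloc a) as [d [D Hd]]; [lra|].
    revert Hd; apply Imono. intros x Hx. replace (x - a) with 0 by lra. now rewrite Rabs_R0. }
  assert (Hmb : m <= b) by (apply Hlub; intros x [Hx _]; lra).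
  destruct (Iloc m) as [d [D Hd]]; [lra|].
  assert (Hx : exists x, E x /\ m - d < x).
  { apply NNPP. intros N. assert (m <= m - d); [|lra]. apply Hlub. intros x Ex.
    apply Rnot_lt_le. intros Hlt. apply N. now exists x. }
  destruct Hx as [x [[Hxab HxI] Hxm]].
  assert (Hxm' : x <= m) by (apply Hub; now split).
  set (t := Rmin b (m + d / 2)).
  assert (Et : E t).
  { split.
    - unfold t. split; [apply Rmin_glb; lra|apply Rmin_l].
    - pose proof (Rmin_r b (m + d / 2)). fold t in H.
      generalize (Iunion _ _ HxI Hd). apply Imono. intros y Hy.
      destruct (Rle_dec y x); [left; lra|right]. apply Rabs_def1; lra. }
  assert (t <= m) by (apply Hub; auto).
  assert (Etb : t = b).
  { unfold t in *. unfold Rmin in *. destruct Rle_dec; lra. }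
  rewrite <- Etb. apply Et.
Qed.

Lemma box_ideal (I : (C -> Prop) -> Prop) (a b c d : R) : a <= b -> c <= d ->
  (forall A B : C -> Prop, (forall z, A z -> B z) -> I B -> I A) ->
  (forall A B : C -> Prop, I A -> I B -> I (fun z => A z \/ B z)) ->
  (forall z, exists del, 0 < del /\ I (fun w => Cmod (w - z) < del)) ->
  I (fun z => a <= fst z <= b /\ c <= snd z <= d).
Proof.
  intros Hab Hcd Imono Iunion Iloc.
  apply (segment_ideal (fun A => I (fun z => A (fst z) /\ c <= snd z <= d))); auto.
  { intros A B HAB. apply Imono. firstorder. }
  { intros A B HA HB. generalize (Iunion _ _ HA HB). apply Imono. tauto. }
  intros x Hx.
  (* Tube argument: a subset of the vertical line over [x] counts as small if some horizontal
     thickening of it is in [I]; a union takes the smaller of the two widths. *)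
  apply (segment_ideal (fun B => exists del, 0 < del /\
            I (fun z => Rabs (fst z - x) < del /\ B (snd z)))); auto.
  { intros A B HAB [e [He HI]]. exists e; split; auto. revert HI. apply Imono. firstorder. }
  { intros A B [e [He HI]] [e' [He' HI']]. exists (Rmin e e'). split; [now apply Rmin_pos|].
    generalize (Iunion _ _ HI HI'). apply Imono. intros z [H1 [H2|H2]];
    pose proof (Rmin_l e e'); pose proof (Rmin_r e e'); [left|right]; split; auto; lra. }
  intros y Hy. destruct (Iloc (x, y)) as [e [He HI]].
  exists (e / 2); split; [lra|]. exists (e / 2); split; [lra|].
  revert HI. apply Imono. intros z [H1 H2].
  eapply Rle_lt_trans; [apply Cmod_le_sum|]. simpl. unfold Rminus in *. lra.
Qed.

Definition interior_pt (Q : C -> Prop) (z : C) : Prop :=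
  exists del, 0 < del /\ forall w, Cmod (w - z) < del -> Q w.

Definition closed_pred (Q : C -> Prop) : Prop :=
  forall z, ~ Q z -> exists del, 0 < del /\ forall w, Cmod (w - z) < del -> ~ Q w.

(** Its Laplacian is [4 - 2 > 0], yet it tends to minus infinity along vertical lines. So it both
    makes the maximum principle strict and acts as a barrier at the far ends of a vertical strip. *)
Definition bump (y0 : R) (z : C) : R := 2 * (fst z * fst z) - (snd z - y0) * (snd z - y0).

(** Over the four points the linear terms cancel in pairs, and the quadratic ones cancel because
    [(i h)^2 = - h^2]. *)
Lemma four_point_mean (g : C -> C) (z : C) : has_jet2 g z ->
  forall eps, 0 < eps -> exists del, 0 < del /\ forall h : R, 0 < h <= del ->
    4 * Cmod (g z) <= Cmod (g (z + h)%C) + Cmod (g (z - h)%C)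
      + Cmod (g (z + Ci * h)%C) + Cmod (g (z - Ci * h)%C) + eps * (h * h).
Proof.
  intros [g1 [g2 H]] eps He. destruct (H (eps / 4)) as [d [D Hd]]; [lra|].
  exists d; split; auto. intros h [h0 hd].
  set (r := fun h => (g (z + h) - (g z + g1 * h + g2 * (h * h)))%C) in Hd.
  assert (M1 : Cmod h = h) by (rewrite Cmod_R; apply Rabs_pos_eq; lra).
  assert (M2 : Cmod (- h)%C = h) by (rewrite Cmod_opp; auto).
  assert (M3 : Cmod (Ci * h)%C = h) by (rewrite Cmod_mult, Cmod_Ci, M1; ring).
  assert (M4 : Cmod (- (Ci * h))%C = h) by (rewrite Cmod_opp; auto).
  pose proof (Hd (RtoC h) ltac:(rewrite M1; auto)) as R1; rewrite M1 in R1.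
  pose proof (Hd (- h)%C ltac:(rewrite M2; auto)) as R2; rewrite M2 in R2.
  pose proof (Hd (Ci * h)%C ltac:(rewrite M3; auto)) as R3; rewrite M3 in R3.
  pose proof (Hd (- (Ci * h))%C ltac:(rewrite M4; auto)) as R4; rewrite M4 in R4.
  assert (Ci2 : (Ci * Ci = - (1))%C) by (unfold Ci, Cmult, Copp, RtoC; simpl; f_equal; ring).
  assert (E : (4 * g z = (g (z + h) + g (z - h) + (g (z + Ci * h) + g (z - Ci * h)))
     + - (r (RtoC h) + r (- h) + (r (Ci * h) + r (- (Ci * h)))))%C).
  { unfold r, Cminus.
    replace (Ci * h * (Ci * h))%C with ((Ci * Ci) * (h * h))%C by ring.
    replace (- (Ci * h) * - (Ci * h))%C with ((Ci * Ci) * (h * h))%C by ring.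
    rewrite Ci2. replace (RtoC 4) with (1 + 1 + 1 + 1)%C; [ring|].
    rewrite <- !RtoC_plus; f_equal; ring. }
  replace (4 * Cmod (g z)) with (Cmod (4 * g z)%C).
  2:{ rewrite Cmod_mult, Cmod_R, Rabs_pos_eq; lra. }
  rewrite E. eapply Rle_trans; [apply Cmod_triangle|]. rewrite Cmod_opp.
  pose proof (Cmod_triangle (g (z + h) + g (z - h))%C (g (z + Ci * h) + g (z - Ci * h))%C).
  pose proof (Cmod_triangle (g (z + h))%C (g (z - h))%C).
  pose proof (Cmod_triangle (g (z + Ci * h))%C (g (z - Ci * h))%C).
  pose proof (Cmod_triangle (r h + r (- h))%C (r (Ci * h) + r (- (Ci * h)))%C).
  pose proof (Cmod_triangle (r h) (r (- h))%C).
  pose proof (Cmod_triangle (r (Ci * h))%C (r (- (Ci * h)))%C).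
  unfold r in *. lra.
Qed.

Lemma bump_cont (y0 : R) (z : C) eps : 0 < eps -> exists del, 0 < del /\
    forall w, Cmod (w - z) <= del -> Rabs (bump y0 w - bump y0 z) <= eps.
Proof.
  apply ccont_pair_continuous. unfold bump; simpl.
  apply continuity_2d_pt_minus.
  - apply continuity_2d_pt_mult; [apply continuity_2d_pt_const|].
    apply continuity_2d_pt_mult; apply continuity_2d_pt_id1.
  - apply (continuity_2d_pt_mult (fun _ y => y - y0) (fun _ y => y - y0));
    (apply (continuity_2d_pt_minus (fun _ y => y) (fun _ _ => y0));
     [apply continuity_2d_pt_id2|apply continuity_2d_pt_const]).
Qed.

(* The Laplacian of [bump] is positive, so by the four point mean value
   inequality [|g| + eps * bump] has no interior maximum. *)
Lemma max_principle_jet (Q : C -> Prop) (T : R) (g : C -> C) (y0 eps B : R) :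
  0 < eps -> closed_pred Q -> (forall z, Q z -> Cmod z <= T) ->
  (forall z, Q z -> has_jet2 g z) ->
  (forall z, Q z -> ~ interior_pt Q z -> Cmod (g z) + eps * bump y0 z <= B) ->
  forall z, Q z -> Cmod (g z) + eps * bump y0 z <= B.
Proof.
  intros He Qcl Qbd Qjet QB z0 Qz0. apply Rnot_lt_le. intros Hlt.
  set (u := fun z => Cmod (g z) + eps * bump y0 z).
  assert (T0 : 0 <= T) by (eapply Rle_trans; [apply Cmod_ge_0|apply (Qbd z0 Qz0)]).
  (* Compactness of the box: if no maximum were attained, the sets on which [u] stays below some
     value [u w0] with [w0] in [Q] would form an ideal containing a neighbourhood of every point,
     hence the whole box, which contains its own [w0]. *)
  assert (Hmax : exists zs, Q zs /\ forall w, Q w -> u w <= u zs).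
  { apply NNPP. intros Hno.
    assert (HI : exists w0, Q w0 /\ forall w, (- T <= fst w <= T /\ - T <= snd w <= T) -> Q w -> u w < u w0).
    { apply (box_ideal (fun A => exists w0, Q w0 /\ forall w, A w -> Q w -> u w < u w0)); try lra.
      - intros A A' HA [w0 [H1 H2]]. exists w0; split; auto.
      - intros A A' [w0 [H1 H2]] [w1 [H3 H4]].
        destruct (Rle_dec (u w0) (u w1)); [exists w1|exists w0]; split; auto;
        intros w [Hw|Hw] Qw; try (specialize (H2 w Hw Qw)); try (specialize (H4 w Hw Qw)); lra.
      - intros z. destruct (classic (Q z)) as [Qz|Qz].
        + assert (Hw : exists w0, Q w0 /\ u z < u w0).
          { apply NNPP. intros N. apply Hno. exists z; split; auto. intros w Qw.
            apply Rnot_lt_le. intros L. apply N. now exists w. }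
          destruct Hw as [w0 [Qw0 L]].
          destruct (has_jet2_cont g z (Qjet z Qz) ((u w0 - u z) / 4)) as [d1 [D1 H1]]; [lra|].
          destruct (bump_cont y0 z ((u w0 - u z) / 4 / eps)) as [d2 [D2 H2]].
          { apply Rdiv_lt_0_compat; lra. }
          exists (Rmin d1 d2); split; [now apply Rmin_pos|]. exists w0; split; auto.
          intros w Hw Qw. pose proof (Rmin_l d1 d2); pose proof (Rmin_r d1 d2).
          specialize (H1 w ltac:(lra)). specialize (H2 w ltac:(lra)).
          pose proof (Cmod_triangle_rev (g w) (g z)).
          apply Rabs_le_between in H2.
          assert (eps * (bump y0 w - bump y0 z) <= (u w0 - u z) / 4).
          { replace ((u w0 - u z) / 4) with (eps * ((u w0 - u z) / 4 / eps)) by (field; lra).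
            apply Rmult_le_compat_l; lra. }
          unfold u in *. lra.
        + destruct (Qcl z Qz) as [d [D Hd]]. exists d; split; auto.
          exists z0; split; auto. intros w Hw Qw. exfalso. now apply (Hd w). }
    destruct HI as [w0 [Qw0 H]].
    pose proof (Qbd w0 Qw0). pose proof (Rabs_fst_le w0) as F. pose proof (Rabs_snd_le w0) as G.
    apply Rabs_le_between in F. apply Rabs_le_between in G.
    specialize (H w0 ltac:(split; lra) Qw0). lra. }
  destruct Hmax as [zs [Qzs Hmax]].
  assert (Hu : B < u zs) by (eapply Rlt_le_trans; [apply Hlt|apply (Hmax z0 Qz0)]).
  assert (Hint : interior_pt Q zs).
  { apply NNPP. intros N. specialize (QB zs Qzs N). unfold u in Hu. lra. }
  destruct Hint as [d [D Hd]].
  destruct (four_point_mean g zs (Qjet zs Qzs) eps He) as [d1 [D1 H1]].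
  set (h := Rmin d1 (d / 2)).
  assert (h0 : 0 < h) by (apply Rmin_pos; lra).
  assert (hd1 : h <= d1) by apply Rmin_l. assert (hd : h < d) by (pose proof (Rmin_r d1 (d / 2)); unfold h; lra).
  specialize (H1 h ltac:(lra)).
  assert (M1 : Cmod h = h) by (rewrite Cmod_R; apply Rabs_pos_eq; lra).
  assert (Q1 : Q (zs + h)%C).
  { apply Hd. replace (zs + h - zs)%C with (RtoC h) by ring. lra. }
  assert (Q2 : Q (zs - h)%C).
  { apply Hd. replace (zs - h - zs)%C with (- h)%C by ring. rewrite Cmod_opp. lra. }
  assert (Q3 : Q (zs + Ci * h)%C).
  { apply Hd. replace (zs + Ci * h - zs)%C with (Ci * h)%C by ring. rewrite Cmod_mult, Cmod_Ci. lra. }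
  assert (Q4 : Q (zs - Ci * h)%C).
  { apply Hd. replace (zs - Ci * h - zs)%C with (- (Ci * h))%C by ring.
    rewrite Cmod_opp, Cmod_mult, Cmod_Ci. lra. }
  apply Hmax in Q1; apply Hmax in Q2; apply Hmax in Q3; apply Hmax in Q4.
  unfold u in Q1, Q2, Q3, Q4.
  (* Multiplied by [eps], the excess [2 h^2] outweighs the error [eps h^2] of the four point
     inequality. *)
  assert (Eb : bump y0 (zs + h) + bump y0 (zs - h) + bump y0 (zs + Ci * h) + bump y0 (zs - Ci * h)
     = 4 * bump y0 zs + 2 * (h * h)).
  { destruct zs as [x y]. unfold bump, Ci, RtoC; simpl. ring. }
  assert (0 < eps * (h * h)) by (apply Rmult_lt_0_compat; nra).
  set (b1 := bump y0 (zs + h)) in *. set (b2 := bump y0 (zs - h)) in *.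
  set (b3 := bump y0 (zs + Ci * h)) in *. set (b4 := bump y0 (zs - Ci * h)) in *.
  assert (E2 : eps * (b1 + b2 + b3 + b4) = eps * (4 * bump y0 zs + 2 * (h * h))) by (rewrite Eb; auto).
  lra.
Qed.

(** The maximum principle passes to uniform limits, and [Phi] is reached as such a limit of rescaled
    iterates of the polynomial. *)
Definition jet2_approx (f : C -> C) (Q : C -> Prop) : Prop :=
  forall eta, 0 < eta -> exists g : C -> C,
    (forall z, Q z -> has_jet2 g z) /\ forall z, Q z -> Cmod (f z - g z) <= eta.

Lemma max_principle_bump (Q : C -> Prop) (T : R) (f : C -> C) (y0 eps B : R) :
  0 < eps -> closed_pred Q -> (forall z, Q z -> Cmod z <= T) -> jet2_approx f Q ->
  (forall z, Q z -> ~ interior_pt Q z -> Cmod (f z) + eps * bump y0 z <= B) ->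
  forall z, Q z -> Cmod (f z) + eps * bump y0 z <= B.
Proof.
  intros He Qcl Qbd Hf QB z Qz. apply Rnot_lt_le. intros Hlt.
  set (eta := (Cmod (f z) + eps * bump y0 z - B) / 4).
  destruct (Hf eta) as [g [Hg Hfg]]; [unfold eta; lra|].
  assert (K : Cmod (g z) + eps * bump y0 z <= B + eta).
  { apply (max_principle_jet Q T g y0 eps (B + eta)); auto.
    intros w Qw Nw. specialize (QB w Qw Nw). specialize (Hfg w Qw).
    pose proof (Cmod_triangle_rev (g w) (f w)). rewrite Cmod_minus_sym in Hfg. lra. }
  specialize (Hfg z Qz). pose proof (Cmod_triangle_rev (f z) (g z)).
  unfold eta in *. lra.
Qed.

Lemma max_principle (Q : C -> Prop) (T : R) (f : C -> C) (B : R) :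
  closed_pred Q -> (forall z, Q z -> Cmod z <= T) -> jet2_approx f Q ->
  (forall z, Q z -> ~ interior_pt Q z -> Cmod (f z) <= B) ->
  forall z, Q z -> Cmod (f z) <= B.
Proof.
  intros Qcl Qbd Hf QB z Qz. apply Rnot_lt_le. intros Hlt.
  set (m := Cmod (f z) - B).
  set (M := 2 * (T * T) + 1).
  assert (T0 : 0 <= T) by (eapply Rle_trans; [apply Cmod_ge_0|apply (Qbd z Qz)]).
  assert (M0 : 0 < M) by (unfold M; nra).
  assert (Hb : forall w, Q w -> - M <= bump 0 w <= M).
  { intros w Qw. specialize (Qbd w Qw). pose proof (Cmod_sqr w). pose proof (Cmod_ge_0 w).
    unfold bump, M. nra. }
  (* [M] bounds [|bump|] on [Q], so the perturbation costs at most a quarter of the supposed excess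
     [m], once on the boundary and once at [z]. *)
  set (eps := m / (4 * M)).
  assert (Heps : 0 < eps) by (unfold eps, m; apply Rdiv_lt_0_compat; lra).
  assert (HeM : eps * M = m / 4) by (unfold eps; field; lra).
  pose proof (max_principle_bump Q T f 0 eps (B + m / 4) Heps Qcl Qbd Hf) as K.
  specialize (K ltac:(intros w Qw Nw; specialize (QB w Qw Nw); specialize (Hb w Qw); nra) z Qz).
  specialize (Hb z Qz). unfold m in *. nra.
Qed.

Lemma jet2_approx_mult (f m : C -> C) (Q : C -> Prop) (M : R) :
  jet2_approx f Q -> (forall z, Q z -> has_jet2 m z) ->
  (forall z, Q z -> Cmod (m z) <= M) -> jet2_approx (fun z => f z * m z)%C Q.
Proof.
  intros Hf Hm HM eta He.
  assert (M0 : 0 < Rmax M 1) by (eapply Rlt_le_trans; [|apply Rmax_r]; lra).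
  destruct (Hf (eta / Rmax M 1)) as [g [Hg Hfg]]; [now apply Rdiv_lt_0_compat|].
  exists (fun z => g z * m z)%C. split.
  - intros z Qz. apply has_jet2_mult; auto.
  - intros z Qz. replace (f z * m z - g z * m z)%C with ((f z - g z) * m z)%C by ring.
    rewrite Cmod_mult. replace eta with (eta / Rmax M 1 * Rmax M 1) by (field; lra).
    apply Rmult_le_compat; auto using Cmod_ge_0.
    eapply Rle_trans; [now apply HM|apply Rmax_l].
Qed.

Lemma closed_annulus (t1 : C) (r R1 : R) : closed_pred (fun z => r <= Cmod (z - t1) <= R1).
Proof.
  intros z Hz.
  assert (H : Cmod (z - t1) < r \/ R1 < Cmod (z - t1)) by lra.
  destruct H as [H|H].
  - exists (r - Cmod (z - t1)). split; [lra|]. intros w Hw.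
    pose proof (Cmod_triangle (w - z) (z - t1)) as T.
    replace (w - z + (z - t1))%C with (w - t1)%C in T by ring. lra.
  - exists (Cmod (z - t1) - R1). split; [lra|]. intros w Hw.
    pose proof (Cmod_triangle (z - w) (w - t1)) as T. rewrite (Cmod_minus_sym z w) in T.
    replace (z - w + (w - t1))%C with (z - t1)%C in T by ring. lra.
Qed.

Lemma interior_annulus (t1 z : C) (r R1 : R) : r < Cmod (z - t1) < R1 ->
  interior_pt (fun z => r <= Cmod (z - t1) <= R1) z.
Proof.
  intros H. set (del := Rmin (Cmod (z - t1) - r) (R1 - Cmod (z - t1))).
  exists del. split; [apply Rmin_pos; lra|]. intros w Hw.
  pose proof (Rmin_l (Cmod (z - t1) - r) (R1 - Cmod (z - t1))).
  pose proof (Rmin_r (Cmod (z - t1) - r) (R1 - Cmod (z - t1))). fold del in H0, H1.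
  pose proof (Cmod_triangle (w - z) (z - t1)) as T.
  replace (w - z + (z - t1))%C with (w - t1)%C in T by ring.
  pose proof (Cmod_triangle (z - w) (w - t1)) as T2. rewrite (Cmod_minus_sym z w) in T2.
  replace (z - w + (w - t1))%C with (z - t1)%C in T2 by ring. lra.
Qed.

(* Apply the maximum principle to [f z / (z - t1) ^ N] and let [N] tend to infinity. *)
Lemma identity_disc (f : C -> C) (t1 : C) (r R1 M : R) : 0 < r ->
  jet2_approx f (fun z => r <= Cmod (z - t1) <= R1) ->
  (forall z, Cmod (z - t1) <= R1 -> Cmod (f z) <= M) ->
  (forall z, Cmod (z - t1) <= r -> f z = 0%C) ->
  forall z, Cmod (z - t1) < R1 -> f z = 0%C.
Proof.
  intros Hr Hf HM Hz z Hzr.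
  destruct (Rle_dec (Cmod (z - t1)) r) as [L|L]; [now apply Hz|].
  set (s := Cmod (z - t1)) in *.
  assert (N1 : forall w, r <= Cmod (w - t1) -> (w - t1)%C <> 0%C).
  { intros w Hw E. rewrite E, Cmod_0 in Hw. lra. }
  assert (M0 : 0 <= M) by (eapply Rle_trans; [apply Cmod_ge_0|apply (HM z); unfold s in *; lra]).
  assert (P : forall n w, r <= Cmod (w - t1) ->
     Cmod (@pow_n C_Ring (/ (w - t1))%C n) = (/ Cmod (w - t1)) ^ n).
  { intros n w Hw. induction n as [|n IH]; simpl; [apply Cmod_1|].
    rewrite <- IH, <- Cmod_inv by auto. apply Cmod_mult. }
  assert (B : forall n, Cmod (f z) <= M * (s / R1) ^ n).
  { intros n.
    assert (Hn : Cmod (f z * @pow_n C_Ring (/ (z - t1))%C n)%C <= M * (/ R1) ^ n).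
    { apply (max_principle (fun z => r <= Cmod (z - t1) <= R1) (Cmod t1 + R1)
              (fun z => (f z * @pow_n C_Ring (/ (z - t1))%C n)%C)); auto.
      - apply closed_annulus.
      - intros w Hw. pose proof (Cmod_triangle t1 (w - t1)) as T.
        replace (t1 + (w - t1))%C with w in T by ring. lra.
      - apply (jet2_approx_mult _ _ _ ((/ r) ^ n)); auto.
        + intros w Hw. apply (has_jet2_pow (fun w => / (w - t1))%C).
          apply (has_jet2_comp (fun u => / u)%C (fun w => w - t1)%C).
          * apply has_jet2_minus; [apply has_jet2_id|apply has_jet2_const].
          * apply has_jet2_inv, N1; lra.
        + intros w Hw. rewrite P by lra. apply pow_incr. split.
          * apply Rlt_le, Rinv_0_lt_compat; lra.
          * apply Rinv_le_contravar; lra.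
      - intros w Hw Hni. rewrite Cmod_mult, P by lra.
        destruct (Rle_dec (Cmod (w - t1)) r) as [Lw|Lw].
        + rewrite Hz, Cmod_0, Rmult_0_l by auto.
          apply Rmult_le_pos; auto. apply pow_le, Rlt_le, Rinv_0_lt_compat; lra.
        + destruct (Req_dec (Cmod (w - t1)) R1) as [E|E].
          * rewrite E. apply Rmult_le_compat_r; [|apply HM; lra].
            apply pow_le, Rlt_le, Rinv_0_lt_compat; lra.
          * exfalso. apply Hni, interior_annulus. lra.
      - unfold s in *; lra. }
    rewrite Cmod_mult, P in Hn by (unfold s in *; lra). fold s in Hn.
    replace (Cmod (f z)) with ((Cmod (f z) * (/ s) ^ n) * s ^ n).
    2:{ rewrite Rmult_assoc, <- Rpow_mult_distr, Rinv_l, pow1 by lra. ring. }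
    unfold Rdiv. rewrite Rpow_mult_distr, (Rmult_comm (s ^ n)), <- Rmult_assoc.
    apply Rmult_le_compat_r; auto. apply pow_le; lra. }
  apply Cmod_eq_0. apply Rle_antisym; [|apply Cmod_ge_0]. apply Rnot_lt_le. intros Hpos.
  assert (M1 : 0 < M).
  { specialize (B 0%nat). simpl in B. lra. }
  destruct (pow_lt_1_zero (s / R1)) with (y := Cmod (f z) / M) as [N HN].
  - rewrite Rabs_pos_eq.
    + apply Rmult_lt_reg_r with R1; [lra|]. unfold Rdiv. rewrite Rmult_assoc, Rinv_l; lra.
    + apply Rlt_le, Rdiv_lt_0_compat; lra.
  - now apply Rdiv_lt_0_compat.
  - specialize (HN N (le_n _)). rewrite Rabs_pos_eq in HN.
    2:{ apply pow_le, Rlt_le, Rdiv_lt_0_compat; lra. }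
    specialize (B N).
    assert (M * (s / R1) ^ N < Cmod (f z)); [|lra].
    replace (Cmod (f z)) with (M * (Cmod (f z) / M)) by (field; lra).
    apply Rmult_lt_compat_l; auto.
Qed.

(** * Real polynomials *)

Notation cpow_n := (@pow_n C_Ring).

Lemma Cmod_cpow_n (z : C) (n : nat) : Cmod (cpow_n z n) = Cmod z ^ n.
Proof.
  induction n as [|n IH]; simpl; [apply Cmod_1|].
  rewrite <- IH. apply Cmod_mult.
Qed.

Lemma peval_0 (a : nat -> R) (z : C) : peval a 0 z = RtoC (a 0%nat).
Proof. unfold peval. rewrite sum_O. simpl. apply Cmult_1_r. Qed.

Lemma peval_S (a : nat -> R) (n : nat) (z : C) :
  peval a (S n) z = (peval a n z + RtoC (a (S n)) * cpow_n z (S n))%C.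
Proof. unfold peval. rewrite sum_Sn. reflexivity. Qed.

(** Divided difference of the power function, the sum of the [x^(n-1-j) y^j], written without
    division so that it also covers [x = y]. *)
Fixpoint pow_quot (x y : C) (n : nat) : C :=
  match n with O => 0%C | S k => (cpow_n x k + y * pow_quot x y k)%C end.

Fixpoint peval_quot (a : nat -> R) (n : nat) (x y : C) : C :=
  match n with O => 0%C
  | S k => (peval_quot a k x y + RtoC (a (S k)) * pow_quot x y (S k))%C end.

Lemma pow_quot_spec (x y : C) (n : nat) :
  (cpow_n x n - cpow_n y n = (x - y) * pow_quot x y n)%C.
Proof.
  induction n as [|n IH]; [simpl; change (@one C_Ring) with (RtoC 1); ring|].
  change (cpow_n x (S n)) with (x * cpow_n x n)%C. change (cpow_n y (S n)) with (y * cpow_n y n)%C.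
  simpl pow_quot.
  transitivity ((x - y) * cpow_n x n + y * (cpow_n x n - cpow_n y n))%C; [ring|].
  rewrite IH. ring.
Qed.

Lemma peval_quot_spec (a : nat -> R) (n : nat) (x y : C) :
  (peval a n x - peval a n y = (x - y) * peval_quot a n x y)%C.
Proof.
  induction n as [|n IH]; [rewrite !peval_0; simpl; ring|].
  rewrite !peval_S. change (peval_quot a (S n) x y) with (peval_quot a n x y + RtoC (a (S n)) * pow_quot x y (S n))%C.
  transitivity ((peval a n x - peval a n y) + RtoC (a (S n)) * (cpow_n x (S n) - cpow_n y (S n)))%C; [ring|].
  rewrite IH, pow_quot_spec. ring.
Qed.

Lemma pow_quot_bound (x y : C) (M : R) (n : nat) : Cmod x <= M -> Cmod y <= M ->
  Cmod (pow_quot x y (S n)) <= INR (S n) * M ^ n.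
Proof.
  intros Hx Hy. assert (M0 : 0 <= M) by (eapply Rle_trans; [apply Cmod_ge_0|apply Hx]).
  induction n as [|n IH].
  - simpl. change (@one C_Ring) with (RtoC 1). replace (1 + y * 0)%C with (RtoC 1) by ring. rewrite Cmod_1; lra.
  - change (pow_quot x y (S (S n))) with (cpow_n x (S n) + y * pow_quot x y (S n))%C.
    eapply Rle_trans; [apply Cmod_triangle|]. rewrite Cmod_mult, Cmod_cpow_n.
    rewrite (S_INR (S n)).
    assert (Cmod x ^ S n <= M ^ S n) by (apply pow_incr; split; auto using Cmod_ge_0).
    assert (Cmod y * Cmod (pow_quot x y (S n)) <= M * (INR (S n) * M ^ n)).
    { apply Rmult_le_compat; auto using Cmod_ge_0. }
    simpl pow in *. lra.
Qed.

Lemma peval_lipschitz (a : nat -> R) (n : nat) (M : R) : exists L, 0 < L /\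
  forall x y, Cmod x <= M -> Cmod y <= M ->
    Cmod (peval a n x - peval a n y) <= L * Cmod (x - y).
Proof.
  assert (H : exists L, 0 < L /\ forall x y, Cmod x <= M -> Cmod y <= M ->
    Cmod (peval_quot a n x y) <= L).
  { induction n as [|n [L [L0 IH]]].
    - exists 1; split; [lra|]. intros; simpl. rewrite Cmod_0; lra.
    - exists (L + Rabs (a (S n)) * (INR (S n) * Rabs M ^ n)). split.
      + pose proof (pos_INR (S n)). pose proof (pow_le (Rabs M) n (Rabs_pos _)).
        pose proof (Rabs_pos (a (S n))).
        assert (0 <= Rabs (a (S n)) * (INR (S n) * Rabs M ^ n)) by (repeat apply Rmult_le_pos; auto).
        lra.
      + intros x y Hx Hy.
        change (peval_quot a (S n) x y) with (peval_quot a n x y + RtoC (a (S n)) * pow_quot x y (S n))%C.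
        eapply Rle_trans; [apply Cmod_triangle|]. rewrite Cmod_mult, Cmod_R.
        apply Rplus_le_compat; auto. apply Rmult_le_compat_l; [apply Rabs_pos|].
        apply pow_quot_bound; (eapply Rle_trans; [eassumption|apply Rle_abs]). }
  destruct H as [L [L0 HL]]. exists L; split; auto. intros x y Hx Hy.
  rewrite peval_quot_spec, Cmod_mult, Rmult_comm.
  apply Rmult_le_compat_r; auto using Cmod_ge_0.
Qed.

(** The divided difference is the factor by which distances change. Near 0 it differs from the
    derivative [a 1] by an error linear in the points, the form in which [linearizer_approx_near0]
    takes it. *)
Lemma peval_quot_near0 (a : nat -> R) (n : nat) : exists K, 0 <= K /\
  forall x y, Cmod x <= 1 -> Cmod y <= 1 ->
    Cmod (peval_quot a (S n) x y - RtoC (a 1%nat)) <= K * (Cmod x + Cmod y).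
Proof.
  induction n as [|n [K [K0 IH]]].
  - exists 0; split; [lra|]. intros x y _ _. simpl. change (@one C_Ring) with (RtoC 1).
    replace (0 + a 1%nat * (1 + y * 0) - a 1%nat)%C with (RtoC 0) by ring. rewrite Cmod_0; lra.
  - exists (K + Rabs (a (S (S n))) * INR (S n)). 
    assert (1 <= INR (S n)) by (rewrite S_INR; pose proof (pos_INR n); lra).
    pose proof (Rabs_pos (a (S (S n)))) as Ha.
    split; [nra|]. intros x y Hx Hy. specialize (IH x y Hx Hy).
    change (peval_quot a (S (S n)) x y)
      with (peval_quot a (S n) x y + RtoC (a (S (S n))) * (cpow_n x (S n) + y * pow_quot x y (S n)))%C.
    replace (peval_quot a (S n) x y + RtoC (a (S (S n))) * (cpow_n x (S n) + y * pow_quot x y (S n)) - a 1%nat)%C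
      with (peval_quot a (S n) x y - a 1%nat + RtoC (a (S (S n))) * (cpow_n x (S n) + y * pow_quot x y (S n)))%C by ring.
    eapply Rle_trans; [apply Cmod_triangle|]. rewrite Cmod_mult, Cmod_R.
    pose proof (Cmod_triangle (cpow_n x (S n)) (y * pow_quot x y (S n))) as T.
    rewrite Cmod_mult, Cmod_cpow_n in T.
    pose proof (pow_quot_bound x y 1 n Hx Hy) as P. rewrite pow1, Rmult_1_r in P.
    pose proof (Cmod_ge_0 x); pose proof (Cmod_ge_0 y).
    assert (Cmod x ^ S n <= Cmod x).
    { simpl. assert (Cmod x ^ n <= 1 ^ n) by (apply pow_incr; lra). rewrite pow1 in *. nra. }
    assert (Cmod y * Cmod (pow_quot x y (S n)) <= Cmod y * INR (S n)) by (apply Rmult_le_compat_l; auto).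
    rewrite Rmult_plus_distr_r. apply Rplus_le_compat; auto.
    rewrite Rmult_assoc. apply Rmult_le_compat_l; auto. nra.
Qed.

Lemma peval_bound_large (a : nat -> R) (n : nat) : exists K, 0 <= K /\
  forall x, 1 <= Cmod x -> Cmod (peval a n x) <= K * Cmod x ^ n.
Proof.
  induction n as [|n [K [K0 IH]]].
  - exists (Rabs (a 0%nat)); split; [apply Rabs_pos|]. intros x _.
    rewrite peval_0, Cmod_R. simpl; lra.
  - exists (K + Rabs (a (S n))). pose proof (Rabs_pos (a (S n))). split; [lra|].
    intros x Hx. rewrite peval_S. eapply Rle_trans; [apply Cmod_triangle|].
    rewrite Cmod_mult, Cmod_R, Cmod_cpow_n. specialize (IH x Hx).
    assert (0 <= Cmod x ^ n) by (apply pow_le; lra).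
    assert (Cmod x ^ n <= Cmod x ^ S n) by (simpl; nra). nra.
Qed.

Lemma peval_quot_bound_large (a : nat -> R) (n : nat) : exists K, 0 <= K /\
  forall x y, 1 <= Cmod x -> Cmod y <= 2 * Cmod x ->
    Cmod (peval_quot a (S n) x y) <= K * Cmod x ^ n.
Proof.
  assert (P : forall n x y, 1 <= Cmod x -> Cmod y <= 2 * Cmod x ->
    Cmod (RtoC (a (S n)) * pow_quot x y (S n))%C <= Rabs (a (S n)) * (INR (S n) * 2 ^ n) * Cmod x ^ n).
  { intros k x y Hx Hy. rewrite Cmod_mult, Cmod_R, Rmult_assoc.
    apply Rmult_le_compat_l; [apply Rabs_pos|].
    rewrite Rmult_assoc, <- Rpow_mult_distr. apply pow_quot_bound; lra. }
  induction n as [|n [K [K0 IH]]].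
  - exists (Rabs (a 1%nat) * (INR 1 * 2 ^ 0)). split.
    + pose proof (Rabs_pos (a 1%nat)). simpl; lra.
    + intros x y Hx Hy.
      change (peval_quot a 1 x y) with (0 + RtoC (a 1%nat) * pow_quot x y 1)%C.
      rewrite Cplus_0_l. now apply P.
  - exists (K + Rabs (a (S (S n))) * (INR (S (S n)) * 2 ^ S n)). split.
    + pose proof (Rabs_pos (a (S (S n)))). pose proof (pos_INR (S (S n))).
      assert (0 <= 2 ^ S n) by (apply pow_le; lra).
      assert (0 <= Rabs (a (S (S n))) * (INR (S (S n)) * 2 ^ S n)) by auto using Rmult_le_pos. lra.
    + intros x y Hx Hy.
      change (peval_quot a (S (S n)) x y) with (peval_quot a (S n) x y + RtoC (a (S (S n))) * pow_quot x y (S (S n)))%C.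
      eapply Rle_trans; [apply Cmod_triangle|]. specialize (IH x y Hx Hy). specialize (P (S n) x y Hx Hy).
      assert (0 <= Cmod x ^ n) by (apply pow_le; lra).
      assert (Cmod x ^ n <= Cmod x ^ S n) by (simpl; nra). nra.
Qed.

(** If [y] is relatively close to [x], the divided difference is relatively close to the derivative
    of the power, whatever the size of [x]. *)
Lemma pow_quot_near_diag (n : nat) : exists K, 0 <= K /\
  forall x y eta, 0 <= eta <= 1 -> Cmod (y - x) <= eta * Cmod x ->
    Cmod (pow_quot x y (S n) - RtoC (INR (S n)) * cpow_n x n) <= K * eta * Cmod x ^ n.
Proof.
  induction n as [|n [K [K0 IH]]].
  - exists 0; split; [lra|]. intros x y eta _ _. simpl. change (@one C_Ring) with (RtoC 1).
    replace (1 + y * 0 - 1 * 1)%C with (RtoC 0) by ring. rewrite Cmod_0. lra.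
  - exists (2 * K + INR (S n)). pose proof (pos_INR (S n)) as Hn. split; [lra|].
    intros x y eta He Hxy. specialize (IH x y eta He Hxy).
    rewrite (S_INR (S n)), RtoC_plus.
    change (pow_quot x y (S (S n))) with (x * cpow_n x n + y * pow_quot x y (S n))%C.
    change (cpow_n x (S n)) with (x * cpow_n x n)%C.
    set (q := pow_quot x y (S n)) in *. set (m := RtoC (INR (S n))) in *. set (w := cpow_n x n) in *.
    replace (x * w + y * q - (m + 1) * (x * w))%C
      with (y * (q - m * w) + (y - x) * (m * w))%C by ring.
    eapply Rle_trans; [apply Cmod_triangle|]. rewrite !Cmod_mult.
    assert (Ew : Cmod w = Cmod x ^ n) by apply Cmod_cpow_n.
    assert (Em : Cmod m = INR (S n)) by (unfold m; rewrite Cmod_R; now apply Rabs_pos_eq).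
    rewrite Ew, Em. pose proof (Cmod_ge_0 x) as Hx.
    assert (W0 : 0 <= Cmod x ^ n) by (apply pow_le; auto).
    assert (Hy : Cmod y <= 2 * Cmod x).
    { pose proof (Cmod_triangle (y - x) x) as T. replace (y - x + x)%C with y in T by ring. nra. }
    assert (T1 : Cmod y * Cmod (q - m * w) <= (2 * Cmod x) * (K * eta * Cmod x ^ n)).
    { apply Rmult_le_compat; auto using Cmod_ge_0. }
    assert (T2 : Cmod (y - x) * (INR (S n) * Cmod x ^ n) <= (eta * Cmod x) * (INR (S n) * Cmod x ^ n)).
    { apply Rmult_le_compat_r; auto. apply Rmult_le_pos; auto. }
    simpl pow. lra.
Qed.

Lemma peval_escape (a : nat -> R) (m : nat) : a (S (S m)) <> 0 ->
  exists R, 1 <= R /\ forall w, R <= Cmod w -> 2 * Cmod w <= Cmod (peval a (S (S m)) w).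
Proof.
  intros Ha. destruct (peval_bound_large a (S m)) as [K [K0 HK]].
  pose proof (Rabs_pos_lt _ Ha) as A0. set (A := Rabs (a (S (S m)))) in *.
  (* At this radius [A |w| >= K + 2]: the leading term exceeds the bound [K |w|^(m+1)] of the others
     by [2 |w|^(m+1) >= 2 |w|]. *)
  exists (1 + (K + 2) / A).
  assert (Hq : 0 < (K + 2) / A) by (apply Rdiv_lt_0_compat; lra).
  split; [lra|]. intros w Hw. specialize (HK w ltac:(lra)).
  rewrite peval_S. set (x := Cmod w) in *.
  pose proof (Cmod_triangle_rev (RtoC (a (S (S m))) * cpow_n w (S (S m))) (- peval a (S m) w)) as T.
  rewrite Cmod_mult, Cmod_R, Cmod_opp, Cmod_cpow_n in T. fold A x in T.
  match type of T with _ <= Cmod ?u => replace u with (peval a (S m) w + RtoC (a (S (S m))) * cpow_n w (S (S m)))%C in T by ring end.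
  assert (H1 : 1 <= x ^ m) by (apply pow_R1_Rle; lra).
  assert (H2 : K + 2 <= A * x).
  { replace (K + 2) with (A * ((K + 2) / A)) by (field; lra). apply Rmult_le_compat_l; lra. }
  change (x ^ S (S m)) with (x * (x * x ^ m)) in T. change (x ^ S m) with (x * x ^ m) in HK.
  assert (2 * x <= 2 * (x * x ^ m)) by nra.
  assert ((K + 2) * (x * x ^ m) <= (A * x) * (x * x ^ m)).
  { apply Rmult_le_compat_r; auto. apply Rmult_le_pos; lra. }
  lra.
Qed.

(** The divided difference is about [d] times [p x / x], so relative distances are multiplied by
    about [d >= 2]; only the factor 1 is claimed, which leaves room for the errors. Products replace
    the quotients by [Cmod x] and by the modulus of [p x]. *)
Lemma peval_relative_expanding (a : nat -> R) (m : nat) : a (S (S m)) <> 0 ->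
  exists R eta, 1 <= R /\ 0 < eta /\ forall x y, R <= Cmod x -> Cmod (y - x) <= eta * Cmod x ->
    Cmod (y - x) * Cmod (peval a (S (S m)) x)
      <= Cmod (peval a (S (S m)) y - peval a (S (S m)) x) * Cmod x.
Proof.
  intros Ha. destruct (peval_bound_large a (S m)) as [K1 [K10 HK1]].
  destruct (peval_quot_bound_large a m) as [K2 [K20 HK2]].
  destruct (pow_quot_near_diag (S m)) as [K3 [K30 HK3]].
  pose proof (Rabs_pos_lt _ Ha) as A0. set (A := Rabs (a (S (S m)))) in *.
  (* Then [K3 * eta <= 1/4], so the divided difference of the leading power is at least
     [7/4 |x|^(m+1)]. The radius below gives [2 (K1 + K2) <= A |x|], so the spare [3/4] absorbs the
     lower terms. *)
  set (eta := / (1 + 4 * K3)).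
  assert (E0 : 0 < eta) by (apply Rinv_0_lt_compat; lra).
  assert (E1 : eta * (1 + 4 * K3) = 1) by (unfold eta; field; lra).
  exists (1 + 2 * (K1 + K2) / A), eta.
  assert (Hq : 0 <= 2 * (K1 + K2) / A).
  { apply Rmult_le_pos; [lra|]. apply Rlt_le, Rinv_0_lt_compat; auto. }
  split; [lra|]. split; auto. intros x y Hx Hxy.
  assert (E2 : 0 <= eta <= 1) by nra.
  assert (E3 : K3 * eta <= 1 / 4) by nra.
  assert (Hy : Cmod y <= 2 * Cmod x).
  { pose proof (Cmod_triangle (y - x) x) as T. replace (y - x + x)%C with y in T by ring. nra. }
  specialize (HK1 x ltac:(lra)). specialize (HK2 x y ltac:(lra) Hy). specialize (HK3 x y eta E2 Hxy).
  rewrite (Cmod_minus_sym (peval _ _ y)), peval_quot_spec, Cmod_mult, (Cmod_minus_sym x y), Rmult_assoc.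
  apply Rmult_le_compat_l; [apply Cmod_ge_0|].
  rewrite peval_S.
  pose proof (Cmod_triangle (peval a (S m) x) (RtoC (a (S (S m))) * cpow_n x (S (S m)))) as T.
  rewrite Cmod_mult, Cmod_R, Cmod_cpow_n in T. fold A in T.
  change (peval_quot a (S (S m)) x y)
    with (peval_quot a (S m) x y + RtoC (a (S (S m))) * pow_quot x y (S (S m)))%C.
  set (D1 := peval_quot a (S m) x y) in *. set (D2 := pow_quot x y (S (S m))) in *.
  pose proof (Cmod_triangle_rev (RtoC (a (S (S m))) * D2) (- D1)) as T2.
  match type of T2 with _ <= Cmod ?u => replace u with (D1 + RtoC (a (S (S m))) * D2)%C in T2 by ring end.
  rewrite Cmod_mult, Cmod_R, Cmod_opp in T2. fold A in T2.
  pose proof (Cmod_triangle_rev (RtoC (INR (S (S m))) * cpow_n x (S m)) (RtoC (INR (S (S m))) * cpow_n x (S m) - D2)) as T3.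
  match type of T3 with _ <= Cmod ?u => replace u with D2 in T3 by ring end.
  rewrite (Cmod_minus_sym _ D2), Cmod_mult, Cmod_R, Cmod_cpow_n in T3.
  rewrite (Rabs_pos_eq (INR (S (S m)))) in T3 by apply pos_INR.
  assert (N2 : 2 <= INR (S (S m))) by (rewrite !S_INR; pose proof (pos_INR m); lra).
  set (X := Cmod x) in *. assert (X1 : 1 <= X) by lra.
  assert (P : 0 < X ^ m) by (apply pow_lt; lra).
  change (X ^ S (S m)) with (X * (X * X ^ m)) in *. change (X ^ S m) with (X * X ^ m) in *.
  set (W := X ^ m) in *.
  assert (H2 : 2 * (K1 + K2) <= A * X).
  { replace (2 * (K1 + K2)) with (A * (2 * (K1 + K2) / A)) by (field; lra). apply Rmult_le_compat_l; lra. }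
  assert (XW : 0 < X * W) by nra.
  assert (F1 : (7/4) * (X * W) <= Cmod D2) by nra.
  assert (F2 : A * ((7/4) * (X * W)) <= A * Cmod D2) by (apply Rmult_le_compat_l; lra).
  assert (F3 : 2 * (K1 + K2) * (X * W) <= (A * X) * (X * W)) by (apply Rmult_le_compat_r; lra).
  assert (F4 : (A * ((7/4) * (X * W)) - K2 * W) * X <= Cmod (D1 + RtoC (a (S (S m))) * D2)%C * X).
  { apply Rmult_le_compat_r; lra. }
  assert (0 <= K1 * (X * W)) by (apply Rmult_le_pos; lra).
  assert (0 <= K2 * (X * W)) by (apply Rmult_le_pos; lra).
  lra.
Qed.

Lemma has_jet2_peval (a : nat -> R) (n : nat) (z : C) : has_jet2 (peval a n) z.
Proof.
  induction n as [|n IH].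
  - apply (has_jet2_ext (fun _ => RtoC (a 0%nat))); [|apply has_jet2_const].
    intros w; now rewrite peval_0.
  - apply (has_jet2_ext (fun w => peval a n w + RtoC (a (S n)) * cpow_n w (S n))%C).
    { intros w; now rewrite peval_S. }
    apply has_jet2_plus; auto. apply has_jet2_mult; [apply has_jet2_const|].
    apply (has_jet2_pow (fun w => w)), has_jet2_id.
Qed.

Lemma peval_conj (a : nat -> R) (n : nat) (z : C) :
  peval a n (Cconj z) = Cconj (peval a n z).
Proof.
  assert (P : forall k, cpow_n (Cconj z) k = Cconj (cpow_n z k)).
  { induction k as [|k IH].
    - simpl. unfold Cconj, one; simpl. now rewrite Ropp_0.
    - change (cpow_n (Cconj z) (S k)) with (Cconj z * cpow_n (Cconj z) k)%C.
      change (cpow_n z (S k)) with (z * cpow_n z k)%C. rewrite IH.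
      unfold Cconj, Cmult; simpl. f_equal; ring. }
  induction n as [|n IH].
  - rewrite !peval_0. unfold Cconj, RtoC; simpl. now rewrite Ropp_0.
  - rewrite !peval_S, IH, P. unfold Cconj, Cmult, Cplus, RtoC; simpl. f_equal; ring.
Qed.

(** * Escaping points and the Fatou set *)

(** A single large iterate decides: beyond an [escape_radius] the modulus at least doubles at each
    step, so the orbit tends to infinity. *)
Definition escapes (f : C -> C) (R : R) (z : C) : Prop := exists n, R <= Cmod (iter f n z).

Definition escape_radius (f : C -> C) (R : R) : Prop :=
  1 <= R /\ forall w, R <= Cmod w -> 2 * Cmod w <= Cmod (f w).

Lemma iter_plus (f : C -> C) (m n : nat) (z : C) : iter f (m + n) z = iter f m (iter f n z).
Proof. induction m; simpl; congruence. Qed.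

Lemma iter_S_r (f : C -> C) (n : nat) (z : C) : iter f (S n) z = iter f n (f z).
Proof. induction n; simpl in *; congruence. Qed.

Lemma iter_escape_growth (f : C -> C) (R : R) (z : C) : escape_radius f R -> R <= Cmod z ->
  forall n, 2 ^ n * R <= Cmod (iter f n z).
Proof.
  intros [R1 H] Hz. induction n as [|n IH]; simpl; [lra|].
  assert (1 <= 2 ^ n) by (apply pow_R1_Rle; lra).
  specialize (H (iter f n z) ltac:(nra)). lra.
Qed.

Lemma escapes_image (f : C -> C) (R : R) (z : C) : escape_radius f R ->
  escapes f R (f z) <-> escapes f R z.
Proof.
  intros HR. split; intros [n Hn].
  - exists (S n). now rewrite iter_S_r.
  - exists n. rewrite <- iter_S_r. simpl. destruct HR as [R1 H]. specialize (H _ Hn). lra.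
Qed.

Lemma escapes_iter (f : C -> C) (R : R) (n : nat) (z : C) : escape_radius f R ->
  escapes f R (iter f n z) <-> escapes f R z.
Proof.
  intros HR. induction n as [|n IH]; simpl; [tauto|].
  rewrite escapes_image; auto.
Qed.

Lemma escapes_unbounded (f : C -> C) (R : R) (z : C) : escape_radius f R -> escapes f R z ->
  forall M, exists N, forall n, (N <= n)%nat -> M < Cmod (iter f n z).
Proof.
  intros HR [n0 Hn0] M. destruct (Pow_x_infinity 2) with (b := Rabs M + 1) as [N HN].
  { rewrite Rabs_pos_eq; lra. }
  exists (N + n0)%nat. intros n Hn.
  pose proof (iter_escape_growth f R _ HR Hn0 (n - n0)) as G.
  rewrite <- iter_plus in G. replace (n - n0 + n0)%nat with n in G by lia.
  specialize (HN (n - n0)%nat ltac:(lia)). rewrite Rabs_pos_eq in HN by (apply pow_le; lra).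
  destruct HR as [R1 _]. pose proof (Rle_abs M). pose proof (Rabs_pos M). nra.
Qed.

Lemma ccont_comp (g f : C -> C) (z : C) : ccont f z -> ccont g (f z) -> ccont (fun w => g (f w)) z.
Proof.
  intros Hf Hg eps He. destruct (Hg eps He) as [d [D Hd]]. destruct (Hf d D) as [d' [D' Hd']].
  exists d'; split; auto.
Qed.

Lemma ccont_iter (f : C -> C) (n : nat) : (forall z, ccont f z) -> forall z, ccont (iter f n) z.
Proof.
  intros Hf. induction n as [|n IH]; intros z.
  - intros eps He; exists eps; split; auto.
  - apply (ccont_comp f (iter f n)); auto.
Qed.

Lemma escapes_locally_uniform (f : C -> C) (R : R) (z : C) : escape_radius f R ->
  (forall z, ccont f z) -> escapes f R z ->
  exists n del, 0 < del /\ forall w, Cmod (w - z) <= del -> R <= Cmod (iter f n w).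
Proof.
  intros HR Hf [n Hn]. pose proof HR as [R1 H].
  destruct (ccont_iter f (S n) Hf z R) as [d [D Hd]]; [lra|].
  exists (S n), d; split; auto. intros w Hw. specialize (Hd w Hw).
  specialize (H _ Hn). change (f (iter f n z)) with (iter f (S n) z) in H.
  pose proof (Cmod_triangle_rev (iter f (S n) z) (iter f (S n) w)) as T.
  rewrite Cmod_minus_sym in T. lra.
Qed.

Lemma strict_incr_ge (phi : nat -> nat) : strict_incr phi -> forall k, (k <= phi k)%nat.
Proof. intros H. induction k; [lia|]. specialize (H k). lia. Qed.

Lemma escapes_fatou (f : C -> C) (R : R) (z : C) : escape_radius f R ->
  (forall z, ccont f z) -> escapes f R z -> fatou f z.
Proof.
  intros HR Hf Hz. destruct (escapes_locally_uniform f R z HR Hf Hz) as [n [d [D Hd]]].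
  exists d; split; auto. intros phi Hphi. exists (fun k => k). split; [intros k; lia|].
  right. intros M. destruct (Pow_x_infinity 2) with (b := Rabs M + 1) as [N HN].
  { rewrite Rabs_pos_eq; lra. }
  exists (N + n)%nat. intros j Hj w Hw.
  pose proof (strict_incr_ge phi Hphi j) as Hpj.
  pose proof (iter_escape_growth f R _ HR (Hd w Hw) (phi j - n)) as G.
  rewrite <- iter_plus in G. replace (phi j - n + n)%nat with (phi j) in G by lia.
  specialize (HN (phi j - n)%nat ltac:(lia)). rewrite Rabs_pos_eq in HN by (apply pow_le; lra).
  destruct HR as [R1 _]. pose proof (Rle_abs M). pose proof (Rabs_pos M). nra.
Qed.

(** Normality of the full sequence of iterates gives one subsequence for the entire disc; a finite
    limit at a point is incompatible with an escaping orbit there. *)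
Lemma fatou_escape_dichotomy (f : C -> C) (R : R) (z : C) : escape_radius f R -> fatou f z ->
  exists r, 0 < r /\ ((forall w, Cmod (w - z) <= r -> escapes f R w) \/
                      (forall w, Cmod (w - z) <= r -> ~ escapes f R w)).
Proof.
  intros HR [r [Hr H]]. exists r; split; auto.
  destruct (H (fun k => k)) as [psi [Hpsi [[g Hg]|Hinf]]]; [intros k; lia| |].
  - right. intros w Hw Hesc. destruct (Hg 1) as [N HN]; [lra|].
    destruct (escapes_unbounded f R w HR Hesc (Cmod (g w) + 1)) as [N' HN'].
    specialize (HN (N + N')%nat ltac:(lia) w Hw).
    specialize (HN' (psi (N + N')%nat)).
    pose proof (strict_incr_ge psi Hpsi (N + N')). specialize (HN' ltac:(lia)).
    pose proof (Cmod_triangle_rev (iter f (psi (N + N')%nat) w) (g w)). lra.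
  - left. intros w Hw. destruct (Hinf R) as [N HN]. exists (psi N).
    apply Rlt_le, HN; auto.
Qed.

Lemma open_of_Cmod_balls (U : C -> Prop) :
  (forall z, U z -> exists r, 0 < r /\ forall w, Cmod (w - z) <= r -> U w) ->
  @open C_UniformSpace U.
Proof.
  intros H z Uz. destruct (H z Uz) as [r [Hr Hw]].
  exists (mkposreal (r / 2) ltac:(lra)). intros w [B1 B2]. apply Hw.
  eapply Rle_trans; [apply Cmod_le_sum|].
  unfold ball in B1, B2; simpl in B1, B2. unfold AbsRing_ball, abs, minus, plus, opp in B1, B2; simpl in B1, B2.
  simpl. lra.
Qed.

(** By the dichotomy the connected set [S] is covered by two disjoint open sets, the escaping points
    and the interior [V] of their complement; being unbounded, [S] meets the first. *)
Lemma fatou_inf_escapes (f : C -> C) (R : R) (z : C) : escape_radius f R ->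
  (forall z, ccont f z) -> fatou_inf f z -> escapes f R z.
Proof.
  intros HR Hf [S [Sconn [SF [Sz Sinf]]]].
  set (V := fun z => exists r, 0 < r /\ forall w, Cmod (w - z) <= r -> ~ escapes f R w).
  destruct (Sconn (escapes f R) V) as [N|N].
  - apply open_of_Cmod_balls. intros w Hw.
    destruct (escapes_locally_uniform f R w HR Hf Hw) as [n [d [D Hd]]].
    exists d; split; auto. intros u Hu. exists n; auto.
  - apply open_of_Cmod_balls. intros w [r [Hr Hw]]. exists (r / 2); split; [lra|].
    intros u Hu. exists (r / 2); split; [lra|]. intros v Hv. apply Hw.
    pose proof (Cmod_triangle (v - u) (u - w)) as T.
    replace (v - u + (u - w))%C with (v - w)%C in T by ring. lra.
  - intros w Sw. destruct (fatou_escape_dichotomy f R w HR (SF w Sw)) as [r [Hr [Hd|Hd]]].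
    + left. apply Hd. replace (w - w)%C with (RtoC 0) by ring. rewrite Cmod_0; lra.
    + right. exists r; auto.
  - intros w [_ [Hw [r [Hr Hn]]]]. apply (Hn w); auto.
    replace (w - w)%C with (RtoC 0) by ring. rewrite Cmod_0; lra.
  - exfalso. destruct (Sinf R) as [w [Sw Hw]]. apply (N w). split; auto.
    exists 0%nat. simpl. lra.
  - destruct (fatou_escape_dichotomy f R z HR (SF z Sz)) as [r [Hr [Hd|Hd]]].
    + apply Hd. replace (z - z)%C with (RtoC 0) by ring. rewrite Cmod_0; lra.
    + exfalso. apply (N z). split; auto. exists r; auto.
Qed.

(** * The Poincaré function as a limit of polynomials *)

Lemma is_derive_C_eps (f : C -> C) (z l : C) : @is_derive C_AbsRing C_NormedModule f z l ->
  forall eps, 0 < eps -> exists del, 0 < del /\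
    forall h, Cmod h <= del -> Cmod (f (z + h)%C - f z - l * h) <= eps * Cmod h.
Proof.
  intros [_ H] eps He. specialize (H z (fun P HP => HP) (mkposreal eps He)).
  destruct H as [d Hd]. exists (d / 2). pose proof (cond_pos d). split; [lra|].
  intros h Hh. specialize (Hd (z + h)%C).
  assert (B : @ball (AbsRing_UniformSpace C_AbsRing) z d (z + h)%C).
  { change (Cmod (z + h + - z) < d). replace (z + h + - z)%C with h by ring. lra. }
  specialize (Hd B).
  change (Cmod (f (z + h)%C + - f z + - ((z + h + - z) * l)) <= eps * Cmod (z + h + - z)) in Hd.
  replace (z + h + - z)%C with h in Hd by ring.
  eapply Rle_trans; [|apply Hd]. right. f_equal. ring.
Qed.

Lemma holo_lipschitz_at (f : C -> C) (z : C) : holo_at f z ->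
  exists K del, 0 < K /\ 0 < del /\ forall w, Cmod (w - z) <= del -> Cmod (f w - f z) <= K * Cmod (w - z).
Proof.
  intros [l H]. destruct (is_derive_C_eps f z l H 1) as [d [D Hd]]; [lra|].
  exists (Cmod l + 1), d. pose proof (Cmod_ge_0 l). split; [lra|]. split; auto.
  intros w Hw. specialize (Hd (w - z)%C Hw).
  replace (z + (w - z))%C with w in Hd by ring.
  pose proof (Cmod_triangle (f w - f z - l * (w - z)) (l * (w - z))) as T.
  replace (f w - f z - l * (w - z) + l * (w - z))%C with (f w - f z)%C in T by ring.
  rewrite Cmod_mult in T. lra.
Qed.

Lemma holo_ccont (f : C -> C) (z : C) : holo_at f z -> ccont f z.
Proof.
  intros H. destruct (holo_lipschitz_at f z H) as [K [d [HK [D Hd]]]]. intros eps He.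
  exists (Rmin d (eps / K)). split; [apply Rmin_pos; [auto|now apply Rdiv_lt_0_compat]|].
  intros w Hw. pose proof (Rmin_l d (eps / K)); pose proof (Rmin_r d (eps / K)).
  replace eps with (K * (eps / K)) by (field; lra).
  eapply Rle_trans; [apply Hd; lra|]. apply Rmult_le_compat_l; lra.
Qed.

(* If the multiplier is [lam] up to an error linear in the points, the error of
   [f^k (z / lam^n)] against [Phi (z / lam^(n-k))] stays below
   [eta |z| x (1 + x)] where [x = lam^(k-n)]: the factor [1 + x] absorbs the
   perturbation of the multiplier since [(1 + q x)(1 + x) <= 1 + lam x]. *)
Lemma linearizer_approx_near0 (f Phi : C -> C) (lam K : R) : 1 < lam -> 0 <= K ->
  (forall x y, Cmod x <= 1 -> Cmod y <= 1 ->
     Cmod (f x - f y) <= (lam + K * (Cmod x + Cmod y)) * Cmod (x - y)) ->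
  (forall z, Phi (lam * z)%C = f (Phi z)) ->
  (forall eps, 0 < eps -> exists del, 0 < del /\
     forall h, Cmod h <= del -> Cmod (Phi h - h) <= eps * Cmod h) ->
  exists r, 0 < r /\ forall eps, 0 < eps -> exists n,
    forall z, Cmod z <= r -> Cmod (Phi z - iter f n (z / lam ^ n)%C) <= eps.
Proof.
  intros Hl HK Hf Hfun Hd.
  destruct (Hd 1) as [d1 [D1 H1]]; [lra|].
  set (q := (lam - 1) / 2).
  assert (q0 : 0 < q) by (unfold q; lra).
  (* The bounds serve in turn for [|Phi h| <= 2 |h|], for keeping the points in the unit disc where
     [Hf] applies, and for [6 K r <= q], which controls the error of the multiplier. *)
  set (r := Rmin (Rmin d1 (1 / 4)) (q / (6 * K + 1))).
  assert (r0 : 0 < r).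
  { repeat apply Rmin_pos; try lra. apply Rdiv_lt_0_compat; lra. }
  assert (rd : r <= d1) by (unfold r; eapply Rle_trans; apply Rmin_l).
  assert (r4 : r <= 1 / 4) by (unfold r; eapply Rle_trans; [apply Rmin_l|apply Rmin_r]).
  assert (rq : 6 * K * r <= q).
  { assert (r <= q / (6 * K + 1)) by apply Rmin_r.
    assert (r * (6 * K + 1) <= q); [|nra].
    replace q with (q / (6 * K + 1) * (6 * K + 1)) by (field; lra).
    apply Rmult_le_compat_r; lra. }
  exists r; split; auto. intros eps He.
  set (eta := Rmin (1 / 2) (eps / 2)).
  assert (eta0 : 0 < eta) by (apply Rmin_pos; lra).
  assert (eta1 : eta <= 1 / 2) by apply Rmin_l.
  assert (eta2 : eta <= eps / 2) by apply Rmin_r.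
  destruct (Hd eta eta0) as [d2 [D2 H2]].
  (* [n] is so large that [|z| / lam^n <= d2], which starts the induction on the number of
     iterates. *)
  destruct (Pow_x_infinity lam) with (b := (r / d2 + 1)) as [n Hn].
  { rewrite Rabs_pos_eq; lra. }
  specialize (Hn n (le_n _)). rewrite Rabs_pos_eq in Hn by (apply pow_le; lra).
  exists n. intros z Hz. pose proof (Cmod_ge_0 z) as z0.
  assert (lp : forall k, 1 <= lam ^ k) by (intros k; apply pow_R1_Rle; lra).
  assert (lC : forall k, RtoC (lam ^ k) <> 0%C).
  { intros k E. apply RtoC_inj in E. specialize (lp k). lra. }
  assert (Mz : forall k, Cmod (z / RtoC (lam ^ k))%C = Cmod z / lam ^ k).
  { intros k. rewrite Cmod_div, Cmod_R, Rabs_pos_eq; auto. specialize (lp k); lra. }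
  assert (Main : forall k, (k <= n)%nat ->
    Cmod (Phi (z / RtoC (lam ^ (n - k)))%C - iter f k (z / RtoC (lam ^ n))%C)
      <= eta * Cmod z * / lam ^ (n - k) * (1 + / lam ^ (n - k))).
  { induction k as [|k IH]; intros Hk.
    - rewrite Nat.sub_0_r. simpl iter.
      assert (Hs : Cmod (z / RtoC (lam ^ n))%C <= d2).
      { rewrite Mz. apply Rmult_le_reg_r with (lam ^ n); [specialize (lp n); lra|].
        unfold Rdiv. rewrite Rmult_assoc, Rinv_l by (specialize (lp n); lra).
        assert (d2 * (r / d2 + 1) <= d2 * lam ^ n) by (apply Rmult_le_compat_l; lra).
        replace (d2 * (r / d2 + 1)) with (r + d2) in H by (field; lra). lra. }
      specialize (H2 _ Hs). rewrite Mz in H2. unfold Rdiv in H2.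
      assert (0 < / lam ^ n) by (apply Rinv_0_lt_compat; specialize (lp n); lra).
      assert (0 <= eta * Cmod z * / lam ^ n) by (repeat apply Rmult_le_pos; lra).
      eapply Rle_trans; [apply H2|]. nra.
    - specialize (IH ltac:(lia)).
      assert (El : lam ^ (n - k) = lam * lam ^ (n - S k)).
      { replace (n - k)%nat with (S (n - S k)) by lia. reflexivity. }
      set (v := Phi (z / RtoC (lam ^ (n - k)))%C) in *.
      set (u := iter f k (z / RtoC (lam ^ n))%C) in *.
      set (s := / lam ^ (n - k)) in *.
      assert (s0 : 0 < s) by (apply Rinv_0_lt_compat; specialize (lp (n - k)%nat); lra).
      assert (s1 : s <= 1).
      { unfold s. rewrite <- Rinv_1. apply Rinv_le_contravar; [lra|]. apply lp. }
      assert (Es : / lam ^ (n - S k) = lam * s).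
      { unfold s. rewrite El. field. split; [specialize (lp (n - S k)%nat); lra|lra]. }
      rewrite Es.
      assert (Ev : Phi (z / RtoC (lam ^ (n - S k)))%C = f v).
      { unfold v. rewrite <- Hfun. f_equal. rewrite El, RtoC_mult. field.
        split; auto. intros E; apply RtoC_inj in E; lra. }
      rewrite Ev. change (iter f (S k) (z / RtoC (lam ^ n))%C) with (f u).
      assert (zs0 : 0 <= Cmod z * s) by (apply Rmult_le_pos; lra).
      assert (zs1 : Cmod z * s <= r) by nra.
      assert (Hv : Cmod v <= 2 * (Cmod z * s)).
      { assert (Hs : Cmod (z / RtoC (lam ^ (n - k)))%C <= d1) by (rewrite Mz; unfold Rdiv; fold s; lra).
        specialize (H1 _ Hs). rewrite Mz in H1. fold v in H1. unfold Rdiv in H1. fold s in H1.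
        pose proof (Cmod_triangle_rev v (z / RtoC (lam ^ (n - k)))%C) as T.
        rewrite Mz in T. unfold Rdiv in T. fold s in T. lra. }
      assert (Hvu : Cmod (v - u) <= Cmod z * s).
      { eapply Rle_trans; [apply IH|].
        replace (eta * Cmod z * s * (1 + s)) with ((Cmod z * s) * (eta * (1 + s))) by ring.
        rewrite <- (Rmult_1_r (Cmod z * s)) at 2. apply Rmult_le_compat_l; auto. nra. }
      assert (Hu : Cmod u <= 3 * (Cmod z * s)).
      { pose proof (Cmod_triangle_rev u v) as T. rewrite Cmod_minus_sym in T. lra. }
      eapply Rle_trans; [apply Hf; lra|].
      assert (Hq : K * (Cmod v + Cmod u) <= q * s).
      { assert (K * (Cmod v + Cmod u) <= K * (6 * (r * s))).
        { apply Rmult_le_compat_l; auto. assert (Cmod z * s <= r * s) by (apply Rmult_le_compat_r; lra). lra. }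
        assert (6 * K * r * s <= q * s) by (apply Rmult_le_compat_r; lra). lra. }
      eapply Rle_trans with ((lam + q * s) * (eta * Cmod z * s * (1 + s))).
      { apply Rmult_le_compat; auto using Cmod_ge_0; try lra.
        pose proof (Cmod_ge_0 v); pose proof (Cmod_ge_0 u).
        assert (0 <= K * (Cmod v + Cmod u)) by (apply Rmult_le_pos; lra). lra. }
      replace ((lam + q * s) * (eta * Cmod z * s * (1 + s)))
        with ((eta * (Cmod z * s)) * ((lam + q * s) * (1 + s))) by ring.
      replace (eta * Cmod z * (lam * s) * (1 + lam * s)) with ((eta * (Cmod z * s)) * (lam * (1 + lam * s))) by ring.
      apply Rmult_le_compat_l; [apply Rmult_le_pos; lra|].
      assert (q * s * (1 + s) <= q * s * 2) by (apply Rmult_le_compat_l; nra).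
      assert (q * s * 2 = (lam - 1) * s) by (unfold q; field).
      assert (0 <= (lam - 1) * (lam - 1) * s) by (apply Rmult_le_pos; [apply Rle_0_sqr|lra]).
      lra. }
  specialize (Main n (le_n _)). rewrite Nat.sub_diag in Main.
  simpl (lam ^ 0) in Main. rewrite Rinv_1 in Main.
  replace (z / 1)%C with z in Main by (field; intros E; apply RtoC_inj in E; lra).
  rewrite <- RtoC_pow. eapply Rle_trans; [apply Main|]. nra.
Qed.

(** The equation [Phi z = f (Phi (z / lam))] enlarges the disc by the factor [lam] at each step; the
    bound on [Phi] is carried along because the Lipschitz constant of [f] depends on it. *)
Lemma linearizer_approx (f Phi : C -> C) (lam K : R) : 1 < lam -> 0 <= K ->
  (forall M, exists L, 0 < L /\ forall x y, Cmod x <= M -> Cmod y <= M ->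
     Cmod (f x - f y) <= L * Cmod (x - y)) ->
  (forall x y, Cmod x <= 1 -> Cmod y <= 1 ->
     Cmod (f x - f y) <= (lam + K * (Cmod x + Cmod y)) * Cmod (x - y)) ->
  (forall z, Phi (lam * z)%C = f (Phi z)) ->
  (forall eps, 0 < eps -> exists del, 0 < del /\
     forall h, Cmod h <= del -> Cmod (Phi h - h) <= eps * Cmod h) ->
  forall T, (exists B, forall z, Cmod z <= T -> Cmod (Phi z) <= B) /\
    forall eps, 0 < eps -> exists n,
      forall z, Cmod z <= T -> Cmod (Phi z - iter f n (z / lam ^ n)%C) <= eps.
Proof.
  intros Hl HK HL Hf Hfun Hd.
  destruct (linearizer_approx_near0 f Phi lam K Hl HK Hf Hfun Hd) as [r0 [Hr0 H0]].
  destruct (Hd 1) as [d1 [D1 H1]]; [lra|].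
  set (r := Rmin r0 d1).
  assert (Hr : 0 < r) by now apply Rmin_pos.
  set (P := fun T => (exists B, forall z, Cmod z <= T -> Cmod (Phi z) <= B) /\
    forall eps, 0 < eps -> exists n,
      forall z, Cmod z <= T -> Cmod (Phi z - iter f n (z / lam ^ n)%C) <= eps).
  assert (lC : RtoC lam <> 0%C) by (intros E; apply RtoC_inj in E; lra).
  assert (Step : forall k, P (lam ^ k * r)).
  { induction k as [|k [[B HB] IH]].
    - simpl. rewrite Rmult_1_l. split.
      + exists (2 * r). intros z Hz.
        specialize (H1 z (Rle_trans _ _ _ Hz (Rmin_r _ _))).
        pose proof (Cmod_triangle_rev (Phi z) z). lra.
      + intros eps He. destruct (H0 eps He) as [n Hn]. exists n. intros z Hz.
        apply Hn. eapply Rle_trans; [apply Hz|apply Rmin_l].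
    - assert (Hdiv : forall z, Cmod z <= lam ^ S k * r -> Cmod (z / lam)%C <= lam ^ k * r).
      { intros z Hz. rewrite Cmod_div, Cmod_R, Rabs_pos_eq; auto; [|lra].
        apply Rmult_le_reg_r with lam; [lra|]. unfold Rdiv. rewrite Rmult_assoc, Rinv_l by lra.
        simpl in Hz. lra. }
      assert (HB0 : 0 <= B).
      { eapply Rle_trans; [apply Cmod_ge_0|apply (HB 0%C)]. rewrite Cmod_0.
        apply Rmult_le_pos; [apply pow_le|]; lra. }
      destruct (HL (B + 1)) as [L [L0 HL']].
      assert (E : forall z, Phi z = f (Phi (z / lam)%C)).
      { intros z. rewrite <- Hfun. f_equal. field; auto. }
      split.
      + exists (L * B + Cmod (f 0%C)). intros z Hz. rewrite E.
        specialize (HB _ (Hdiv z Hz)).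
        specialize (HL' (Phi (z / lam)%C) 0%C ltac:(lra) ltac:(rewrite Cmod_0; lra)).
        replace (Phi (z / lam)%C - 0)%C with (Phi (z / lam)%C) in HL' by ring.
        pose proof (Cmod_triangle_rev (f (Phi (z / lam)%C)) (f 0%C)). nra.
      + intros eps He.
        destruct (IH (Rmin 1 (eps / L))) as [n Hn].
        { apply Rmin_pos; [lra|now apply Rdiv_lt_0_compat]. }
        exists (S n). intros z Hz. rewrite E. specialize (Hn _ (Hdiv z Hz)). specialize (HB _ (Hdiv z Hz)).
        replace (z / lam ^ S n)%C with (z / lam / lam ^ n)%C.
        2:{ rewrite <- !RtoC_pow. simpl. rewrite RtoC_mult. field. split; auto.
            intros F. apply RtoC_inj in F. pose proof (pow_lt lam n); lra. }
        set (u := iter f n (z / lam / lam ^ n)%C) in *. set (v := Phi (z / lam)%C) in *.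
        change (iter f (S n) (z / lam / lam ^ n)%C) with (f u).
        pose proof (Rmin_l 1 (eps / L)); pose proof (Rmin_r 1 (eps / L)).
        assert (Cmod u <= B + 1).
        { pose proof (Cmod_triangle_rev u v) as T. rewrite Cmod_minus_sym in T. lra. }
        eapply Rle_trans; [apply HL'; lra|].
        replace eps with (L * (eps / L)) by (field; lra). apply Rmult_le_compat_l; lra. }
  intros T. destruct (Pow_x_infinity lam) with (b := Rabs T / r) as [k Hk].
  { rewrite Rabs_pos_eq; lra. }
  specialize (Hk k (le_n _)). rewrite Rabs_pos_eq in Hk by (apply pow_le; lra).
  assert (HT : T <= lam ^ k * r).
  { eapply Rle_trans; [apply Rle_abs|]. replace (Rabs T) with (Rabs T / r * r) by (field; lra).
    apply Rmult_le_compat_r; lra. }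
  destruct (Step k) as [[B HB] Hn]. split.
  - exists B. intros z Hz. apply HB; lra.
  - intros eps He. destruct (Hn eps He) as [n Hn']. exists n. intros z Hz. apply Hn'; lra.
Qed.

(** * Closed rectangles *)

Lemma closed_box (a b c d : R) : closed_pred (fun z => a <= fst z <= b /\ c <= snd z <= d).
Proof.
  intros z Hz.
  assert (H : fst z < a \/ b < fst z \/ snd z < c \/ d < snd z) by lra.
  assert (P : forall w, Rabs (fst w - fst z) <= Cmod (w - z) /\ Rabs (snd w - snd z) <= Cmod (w - z)).
  { intros w. pose proof (Rabs_fst_le (w - z)); pose proof (Rabs_snd_le (w - z)). split; auto. }
  destruct H as [H|[H|[H|H]]];
  [exists (a - fst z)|exists (fst z - b)|exists (c - snd z)|exists (snd z - d)];
  (split; [lra|]; intros w Hw; destruct (P w) as [P1 P2];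
   apply Rabs_le_between in P1; apply Rabs_le_between in P2; lra).
Qed.

Lemma interior_box (a b c d : R) (z : C) : a < fst z < b -> c < snd z < d ->
  interior_pt (fun z => a <= fst z <= b /\ c <= snd z <= d) z.
Proof.
  intros H1 H2.
  set (m1 := Rmin (fst z - a) (b - fst z)). set (m2 := Rmin (snd z - c) (d - snd z)).
  exists (Rmin m1 m2). split; [repeat apply Rmin_pos; lra|]. intros w Hw.
  pose proof (Rmin_l m1 m2); pose proof (Rmin_r m1 m2).
  pose proof (Rmin_l (fst z - a) (b - fst z)); pose proof (Rmin_r (fst z - a) (b - fst z)).
  pose proof (Rmin_l (snd z - c) (d - snd z)); pose proof (Rmin_r (snd z - c) (d - snd z)).
  pose proof (Rabs_fst_le (w - z)) as P1; pose proof (Rabs_snd_le (w - z)) as P2.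
  apply Rabs_le_between in P1; apply Rabs_le_between in P2. simpl in P1, P2.
  unfold m1, m2 in *. split; lra.
Qed.

(** * Powers on the closed upper half-plane *)

(* The branch of the logarithm with values in [-PI/2 < Im <= 3 PI/2], which is
   continuous on the closed upper half-plane without 0. *)
Definition uplog (t : C) : C := (clog (- Ci * t) + (0, PI / 2)%R)%C.

(** The power [(t / c) ^ kap], which inverts [t = c z ^ rho] when [kap = 1 / rho]. *)
Definition upower (kap c : R) (t : C) : C := cexp (RtoC kap * (uplog t - RtoC (ln c)))%C.

(** The plane without the closed negative imaginary half-axis, the cut of [uplog]. *)
Definition slit (t : C) : Prop := 0 < Cmod t + snd t.

Lemma Cmod_mulNCi (t : C) : Cmod (- Ci * t) = Cmod t.
Proof. rewrite Cmod_mult, Cmod_opp, Cmod_Ci. ring. Qed.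

Lemma slit_rot (t : C) : slit t -> 0 < Cmod (- Ci * t) + fst (- Ci * t)%C.
Proof. unfold slit. rewrite Cmod_mulNCi. simpl. intros; lra. Qed.

Lemma slit_neq_0 (t : C) : slit t -> t <> 0%C.
Proof. unfold slit. intros H ->. rewrite Cmod_0 in H. simpl in H. lra. Qed.

Lemma slit_up (t : C) : 0 < snd t -> slit t.
Proof. unfold slit. pose proof (Cmod_ge_0 t). lra. Qed.

Lemma slit_up_closed (t : C) : 0 <= snd t -> t <> 0%C -> slit t.
Proof. unfold slit. intros H1 H2. apply Cmod_gt_0 in H2. lra. Qed.

Lemma cexp_uplog (t : C) : t <> 0%C -> cexp (uplog t) = t.
Proof.
  intros Ht. unfold uplog. rewrite cexp_plus, cexp_clog.
  - destruct t as [x y]. unfold cexp; simpl. rewrite exp_0, cos_PI2, sin_PI2.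
    unfold Ci, Cmult, Copp; simpl. f_equal; ring.
  - apply Cmod_gt_0. rewrite Cmod_mulNCi. now apply Cmod_gt_0.
Qed.

Lemma uplog_cexp (s : C) : - (PI / 2) < snd s < 3 * PI / 2 -> uplog (cexp s) = s.
Proof.
  intros Hs. unfold uplog.
  assert (E : (- Ci * cexp s = cexp (s + (0, - (PI / 2))%R))%C).
  { rewrite cexp_plus. destruct s as [x y]. unfold cexp; simpl.
    rewrite exp_0, cos_neg, sin_neg, cos_PI2, sin_PI2.
    unfold Ci, Cmult, Copp; simpl. f_equal; ring. }
  rewrite E, clog_cexp.
  - destruct s as [x y]. unfold Cplus; simpl. f_equal; lra.
  - simpl. lra.
Qed.

Lemma has_jet2_uplog (t : C) : slit t -> has_jet2 uplog t.
Proof.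
  intros Ht. apply has_jet2_plus; [|apply has_jet2_const].
  apply (has_jet2_comp clog (fun t => - Ci * t)%C).
  - apply has_jet2_mult; [apply has_jet2_const|apply has_jet2_id].
  - now apply has_jet2_clog, slit_rot.
Qed.

Lemma has_jet2_upower (kap c : R) (t : C) : slit t -> has_jet2 (upower kap c) t.
Proof.
  intros Ht. apply (has_jet2_comp cexp (fun t => RtoC kap * (uplog t - RtoC (ln c)))%C); [|apply has_jet2_cexp].
  apply has_jet2_mult; [apply has_jet2_const|].
  apply has_jet2_minus; [now apply has_jet2_uplog|apply has_jet2_const].
Qed.

Lemma Cmod_upower (kap c : R) (t : C) : Cmod (upower kap c t) = exp (kap * (ln (Cmod t) - ln c)).
Proof.
  unfold upower. rewrite Cmod_cexp. f_equal. unfold uplog, clog; rewrite Cmod_mulNCi. simpl. ring.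
Qed.

Lemma clog_scal (r : R) (z : C) : 0 < r -> z <> 0%C -> clog (RtoC r * z) = (RtoC (ln r) + clog z)%C.
Proof.
  intros Hr Hz. apply Cmod_gt_0 in Hz. unfold clog, carg.
  rewrite Cmod_mult, Cmod_R, Rabs_pos_eq, ln_mult by lra.
  unfold Cplus; simpl. f_equal. rewrite Rplus_0_l.
  replace (r * Cmod z + (r * fst z - 0 * snd z)) with (r * (Cmod z + fst z)) by ring.
  destruct Req_EM_T as [E|E]; destruct Req_EM_T as [E'|E']; auto.
  - exfalso. apply E'. nra.
  - exfalso. apply E. rewrite E'. ring.
  - f_equal. f_equal. field. lra.
Qed.

Lemma upower_scal (kap c r : R) (t : C) : 0 < r -> t <> 0%C ->
  upower kap c (RtoC r * t) = (RtoC (exp (kap * ln r)) * upower kap c t)%C.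
Proof.
  intros Hr Ht. unfold upower, uplog.
  replace (- Ci * (RtoC r * t))%C with (RtoC r * (- Ci * t))%C by ring.
  rewrite clog_scal; auto.
  2:{ apply Cmod_gt_0. rewrite Cmod_mulNCi. now apply Cmod_gt_0. }
  replace (RtoC (exp (kap * ln r))) with (cexp (RtoC kap * RtoC (ln r))%C).
  2:{ unfold cexp; simpl. rewrite !Rmult_0_l, !Rmult_0_r, Rminus_0_r, Rplus_0_l, cos_0, sin_0.
      unfold RtoC. f_equal; ring. }
  rewrite <- cexp_plus. f_equal. ring.
Qed.

Lemma upower_bound (kap c T : R) : 0 < kap -> exists B, forall t, slit t -> Cmod t <= T ->
  Cmod (upower kap c t) <= B.
Proof.
  intros Hk. exists (exp (kap * (ln (Rmax T 1) - ln c))). intros t Ht HT.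
  rewrite Cmod_upower.
  assert (0 < Cmod t) by now apply Cmod_gt_0, slit_neq_0.
  assert (ln (Cmod t) <= ln (Rmax T 1)).
  { apply ln_le; auto. eapply Rle_trans; [apply HT|apply Rmax_l]. }
  assert (H2 : kap * (ln (Cmod t) - ln c) <= kap * (ln (Rmax T 1) - ln c)) by (apply Rmult_le_compat_l; lra).
  destruct H2 as [H2|H2]; [left; now apply exp_increasing|right; now rewrite H2].
Qed.

Lemma cexp_2PI (z : C) (k : nat) : cexp (z + (0, 2 * INR k * PI)%R)%C = cexp z.
Proof.
  destruct z as [x y]. unfold cexp; simpl. rewrite Rplus_0_r.
  now rewrite cos_period, sin_period.
Qed.

Lemma Cscal_pair (r x y : R) : (RtoC r * (x, y))%C = (r * x, r * y).
Proof. unfold Cmult, RtoC; simpl. f_equal; ring. Qed.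

(** * The Poincaré function in the coordinate [t = c z^rho] *)

Section Core.

(** [kap] stands for [1 / rho = ln lam / ln d], so [exp (kap * ln D)] is [lam], and the functional
    equation of [Phi] becomes [K (D t) = f (K t)]. *)
Context (f Phi : C -> C) (d : nat) (kap c rad : R).
Let D := INR d.
Let K := fun t => Phi (upower kap c t).

Context (d2 : (2 <= d)%nat).
Context (kap0 : 0 < kap).
Context (f_jet : forall z, has_jet2 f z).
Context (f_esc : escape_radius f rad).
Context (f_0 : f 0%C = 0%C).
Context (f_expanding : exists R1 eta, 1 <= R1 /\ 0 < eta /\
  forall x y, R1 <= Cmod x -> Cmod (y - x) <= eta * Cmod x ->
    Cmod (y - x) * Cmod (f x) <= Cmod (f y - f x) * Cmod x).
Context (Phi_fun : forall z, Phi (RtoC (exp (kap * ln D)) * z)%C = f (Phi z)).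
Context (Phi_0 : Phi 0%C = 0%C).
Context (Phi_holo : forall z, holo_at Phi z).
Context (Phi_near0 : exists del, 0 < del /\ forall h, Cmod h <= del -> Cmod (Phi h - h) <= / 2 * Cmod h).
Context (Phi_approx : forall T, (exists B, forall z, Cmod z <= T -> Cmod (Phi z) <= B) /\
  forall eps, 0 < eps -> exists g, (forall z, has_jet2 g z) /\
    forall z, Cmod z <= T -> Cmod (Phi z - g z) <= eps).
(** The inequality between [snd t] and [sin b * Cmod t] describes the sector [0 <= arg t <= b]
    without an argument function. The error sits in the exponent, hence is a relative error of
    [K t]. *)
Context (K_asym : exists b s0, 0 < b < PI / 2 /\ forall eta, 0 < eta -> exists X, forall t,
  0 < fst t -> 0 <= snd t -> snd t <= sin b * Cmod t -> X <= Cmod t ->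
  exists e, Cmod e <= eta /\ K t = cexp (s0 + t + e)%C).

Lemma D_ge_2 : 2 <= D.
Proof. unfold D. change 2 with (INR 2). now apply le_INR. Qed.

Lemma D_pow_ge_1 (n : nat) : 1 <= D ^ n.
Proof. apply pow_R1_Rle. pose proof D_ge_2; lra. Qed.

Lemma D_pow_large (x : R) : exists n, x <= D ^ n.
Proof.
  destruct (Pow_x_infinity D) with (b := x) as [n Hn].
  - pose proof D_ge_2. rewrite Rabs_pos_eq; lra.
  - exists n. specialize (Hn n (le_n _)). rewrite Rabs_pos_eq in Hn; [lra|].
    pose proof (D_pow_ge_1 n); lra.
Qed.

Lemma f_cont (z : C) : ccont f z.
Proof. now apply has_jet2_cont. Qed.

Lemma K_scal1 (t : C) : t <> 0%C -> K (RtoC D * t)%C = f (K t).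
Proof.
  intros Ht. unfold K. rewrite upower_scal; auto. pose proof D_ge_2; lra.
Qed.

Lemma K_scal (n : nat) (t : C) : t <> 0%C -> K (RtoC (D ^ n) * t)%C = iter f n (K t).
Proof.
  intros Ht. induction n as [|n IH].
  - simpl. f_equal. apply Cmult_1_l.
  - simpl. rewrite <- IH, <- K_scal1.
    + f_equal. rewrite RtoC_mult. ring.
    + apply Cmult_neq_0; auto. intros E. apply RtoC_inj in E. pose proof (D_pow_ge_1 n); lra.
Qed.

Lemma pair_neq_0 (x y : R) : 0 < y -> (x, y) <> RtoC 0.
Proof. intros Hy E. apply (f_equal snd) in E. simpl in E. lra. Qed.

Lemma K_cont (t : C) : slit t -> ccont K t.
Proof.
  intros Ht. apply (ccont_comp Phi (upower kap c)).
  - now apply has_jet2_cont, has_jet2_upower.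
  - now apply holo_ccont.
Qed.

Lemma K_bound (T : R) : exists B, forall t, slit t -> Cmod t <= T -> Cmod (K t) <= B.
Proof.
  destruct (upower_bound kap c T kap0) as [B0 H0].
  destruct (Phi_approx B0) as [[B HB] _]. exists B. intros t Ht HT. apply HB, H0; auto.
Qed.

Lemma K_approx (Q : C -> Prop) (T : R) : (forall t, Q t -> slit t) ->
  (forall t, Q t -> Cmod t <= T) -> jet2_approx K Q.
Proof.
  intros Qs QT eta He. destruct (upower_bound kap c T kap0) as [B0 H0].
  destruct (Phi_approx B0) as [_ HA]. destruct (HA eta He) as [g [Hg Hgf]].
  exists (fun t => g (upower kap c t)). split.
  - intros t Qt. apply (has_jet2_comp g (upower kap c)); auto. apply has_jet2_upower; auto.
  - intros t Qt. apply Hgf, H0; auto.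
Qed.

(** * Periodicity of [K] *)

Let shift (t : C) : C := (t + (0, 2 * PI)%R)%C.

Lemma shift_diff_approx (Q : C -> Prop) (T : R) : (forall t, Q t -> 0 < snd t) ->
  (forall t, Q t -> Cmod t <= T) -> jet2_approx (fun t => K (shift t) - K t)%C Q.
Proof.
  intros Qs QT eta He. 
  destruct (K_approx Q T) with (eta := eta / 2) as [g1 [Hg1 H1]]; auto using slit_up; [lra|].
  destruct (K_approx (fun w => exists t, Q t /\ w = shift t) (T + Cmod (0, 2 * PI)%R))
    with (eta := eta / 2) as [g2 [Hg2 H2]]; [| |lra|].
  - intros w [t [Qt ->]]. apply slit_up. unfold shift; simpl. specialize (Qs t Qt). pose proof PI_RGT_0; lra.
  - intros w [t [Qt ->]]. unfold shift. eapply Rle_trans; [apply Cmod_triangle|].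
    specialize (QT t Qt). lra.
  - exists (fun t => g2 (shift t) - g1 t)%C. split.
    + intros t Qt. apply has_jet2_minus; auto.
      apply (has_jet2_comp g2 shift).
      * unfold shift. apply has_jet2_plus; [apply has_jet2_id|apply has_jet2_const].
      * apply Hg2. eauto.
    + intros t Qt. specialize (H1 t Qt). specialize (H2 (shift t) ltac:(eauto)).
      replace (K (shift t) - K t - (g2 (shift t) - g1 t))%C
        with (K (shift t) - g2 (shift t) + - (K t - g1 t))%C by ring.
      eapply Rle_trans; [apply Cmod_triangle|]. rewrite Cmod_opp. lra.
Qed.

(* Both [K (D^n t)] and [K (D^n (t + 2 pi i))] are asymptotic to the same
   exponential, so their relative distance tends to 0; but it cannot decrease
   with [n]. *)
Lemma K_period_large (Y : R) : 0 < Y -> exists X, forall t, X <= fst t -> 0 < snd t <= Y ->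
  K (shift t) = K t.
Proof.
  intros HY. destruct f_expanding as [R1 [eta [HR1 [He Hexp]]]].
  destruct K_asym as [b [s0 [Hb Has]]].
  destruct (has_jet2_cont cexp 0%C (has_jet2_cexp 0%C) eta He) as [dl [Dl Hdl]].
  set (e0 := Rmin 1 (dl / 2)).
  assert (e00 : 0 < e0) by (apply Rmin_pos; lra).
  assert (e01 : e0 <= 1) by apply Rmin_l. assert (e0d : e0 <= dl / 2) by apply Rmin_r.
  destruct (Has e0 e00) as [X0 HX0].
  assert (Hsb : 0 < sin b) by (apply sin_gt_0; lra).
  pose proof PI_RGT_0 as Hpi.
  set (L := ln R1 + Rabs (fst s0) + 1).
  assert (L0 : 0 <= L).
  { unfold L. pose proof (Rabs_pos (fst s0)).
    assert (0 <= ln R1) by (rewrite <- ln_1; apply ln_le; lra). lra. }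
  (* The summands bring the points into the range of [HX0], make [|iter f n (K t)|] at least [R1],
     and put [t] and [shift t], of height at most [Y + 2 pi], into the sector. *)
  set (X := 1 + Rabs X0 + (L + Rabs (fst s0)) + (Y + 2 * PI) / sin b).
  assert (Hq : 0 < (Y + 2 * PI) / sin b) by (apply Rdiv_lt_0_compat; lra).
  exists X. intros t HtX HtY.
  pose proof (Rabs_pos X0). pose proof (Rle_abs X0). pose proof (Rabs_pos (fst s0)).
  assert (HXge1 : 1 <= X) by (unfold X; lra).
  assert (HXY : (Y + 2 * PI) / sin b <= X) by (unfold X; lra).
  assert (Gen : forall Z eta', 0 < eta' -> (forall t, 0 < fst t -> 0 <= snd t -> snd t <= sin b * Cmod t -> Z <= Cmod t ->
       exists e, Cmod e <= eta' /\ K t = cexp (s0 + t + e)%C) ->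
     forall n, Z <= D ^ n * X -> exists e e', Cmod e <= eta' /\ Cmod e' <= eta' /\
       iter f n (K t) = cexp (s0 + RtoC (D ^ n) * t + e)%C /\
       iter f n (K (shift t)) = cexp (s0 + RtoC (D ^ n) * t + e')%C).
  { intros Z eta' He' HZ n Hn. pose proof (D_pow_ge_1 n) as Dn.
    assert (Pt : forall u, fst u = fst t -> 0 < snd u <= Y + 2 * PI ->
      exists e, Cmod e <= eta' /\ iter f n (K u) = cexp (s0 + RtoC (D ^ n) * u + e)%C).
    { intros u Hu1 Hu2.
      assert (HC : X <= Cmod u).
      { pose proof (Rabs_fst_le u) as F. apply Rabs_le_between in F. lra. }
      rewrite <- K_scal by (destruct u; apply pair_neq_0; apply Hu2).
      assert (HCD : Cmod (RtoC (D ^ n) * u) = D ^ n * Cmod u).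
      { rewrite Cmod_mult, Cmod_R, Rabs_pos_eq; lra. }
      apply HZ; rewrite ?HCD.
      - destruct u as [ux uy]; rewrite Cscal_pair; simpl in *. apply Rmult_lt_0_compat; lra.
      - destruct u as [ux uy]; rewrite Cscal_pair; simpl in *. apply Rmult_le_pos; lra.
      - destruct u as [ux uy]; rewrite Cscal_pair; simpl in *.
        replace (sin b * (D ^ n * Cmod (ux, uy))) with (D ^ n * (sin b * Cmod (ux, uy))) by ring.
        apply Rmult_le_compat_l; [lra|].
        apply Rle_trans with (sin b * ((Y + 2 * PI) / sin b)).
        + replace (sin b * ((Y + 2 * PI) / sin b)) with (Y + 2 * PI) by (field; lra). lra.
        + apply Rmult_le_compat_l; lra.
      - eapply Rle_trans; [apply Hn|]. apply Rmult_le_compat_l; lra. }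
    destruct (Pt t) as [e [He1 He2]]; auto; [lra|].
    destruct (Pt (shift t)) as [e' [He1' He2']].
    { unfold shift; simpl; lra. }
    { unfold shift; simpl; lra. }
    exists e, e'. repeat split; auto. rewrite He2'. unfold shift.
    (* The shift contributes [2 pi i D^n], where [D^n] is the natural number [d^n]. *)
    rewrite <- (cexp_2PI (s0 + RtoC (D ^ n) * t + e') (d ^ n)). f_equal.
    rewrite pow_INR. fold D. destruct t as [tx ty]; destruct e'; destruct s0.
    unfold Cplus, Cmult, RtoC; simpl. f_equal; ring. }
  assert (HLR : R1 <= exp L).
  { rewrite <- (exp_ln R1) by lra. assert (HL : ln R1 <= L) by (unfold L; pose proof (Rabs_pos (fst s0)); lra).
    destruct HL as [HL| ->]; [left; now apply exp_increasing|right; auto]. }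
  assert (Dist : forall w e e',
     Cmod (cexp (w + e') - cexp (w + e)) = Cmod (cexp (e' - e) - 1) * Cmod (cexp (w + e))).
  { intros w e e'. rewrite <- Cmod_mult. f_equal.
    replace (w + e')%C with ((e' - e) + (w + e))%C by ring. rewrite cexp_plus. ring. }
  assert (Rel : forall n, 0 < Cmod (iter f n (K t)) /\
    Cmod (K (shift t) - K t) * Cmod (iter f n (K t)) <= Cmod (iter f n (K (shift t)) - iter f n (K t)) * Cmod (K t)).
  { induction n as [|n [IH0 IH]].
    - simpl. split; [|lra].
      destruct (Gen X0 e0 e00 HX0 0%nat) as [e [e' [_ [_ [G _]]]]]; [simpl; unfold X; lra|].
      simpl iter in G. rewrite G, Cmod_cexp. apply exp_pos.
    - pose proof (D_pow_ge_1 n) as Dn. pose proof (D_pow_ge_1 (S n)) as DSn.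
      destruct (Gen X0 e0 e00 HX0 (S n)) as [e1 [_ [_ [_ [G1 _]]]]]; [unfold X in *; nra|].
      split; [rewrite G1, Cmod_cexp; apply exp_pos|].
      destruct (Gen X0 e0 e00 HX0 n) as [e [e' [E1 [E2 [G G']]]]]; [unfold X in *; nra|].
      assert (Hlarge : R1 <= Cmod (iter f n (K t))).
      { rewrite G, Cmod_cexp. eapply Rle_trans; [apply HLR|].
        assert (HL : L <= fst (s0 + RtoC (D ^ n) * t + e)%C).
        { destruct t as [tx ty]. rewrite Cscal_pair. simpl in *.
          pose proof (Rabs_fst_le e) as F. apply Rabs_le_between in F.
          pose proof (Rle_abs (- fst s0)) as F2. rewrite Rabs_Ropp in F2.
          assert (tx <= D ^ n * tx) by (unfold X in *; nra).
          unfold X in *. lra. }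
        destruct HL as [HL| ->]; [left; now apply exp_increasing|right; auto]. }
      assert (Hclose : Cmod (iter f n (K (shift t)) - iter f n (K t)) <= eta * Cmod (iter f n (K t))).
      { rewrite G, G', Dist. apply Rmult_le_compat_r; [apply Cmod_ge_0|].
        rewrite <- cexp_0 at 1. apply Hdl. replace (e' - e - 0)%C with (e' + - e)%C by ring.
        eapply Rle_trans; [apply Cmod_triangle|]. rewrite Cmod_opp. lra. }
      pose proof (Hexp _ _ Hlarge Hclose) as HE.
      change (iter f (S n) (K t)) with (f (iter f n (K t))) in *.
      change (iter f (S n) (K (shift t))) with (f (iter f n (K (shift t)))).
      set (u := iter f n (K t)) in *. set (v := iter f n (K (shift t))) in *.
      apply Rmult_le_reg_r with (Cmod u); auto.
      pose proof (Cmod_ge_0 (f u)). pose proof (Cmod_ge_0 (K t)). nra. }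
  assert (Z : Cmod (K (shift t) - K t) = 0).
  { apply Rle_antisym; [|apply Cmod_ge_0]. apply Rnot_lt_le. intros Hpos.
    assert (K0 : 0 < Cmod (K t)) by apply (Rel 0%nat).
    (* Half the initial relative distance: once the exponents are accurate enough for [q], a later
       relative distance falls below the initial one. *)
    set (q := Cmod (K (shift t) - K t) / Cmod (K t) / 2).
    assert (q0 : 0 < q) by (unfold q; repeat apply Rdiv_lt_0_compat; lra).
    destruct (has_jet2_cont cexp 0%C (has_jet2_cexp 0%C) q q0) as [dl' [Dl' Hdl']].
    set (e1 := Rmin e0 (dl' / 2)).
    assert (e10 : 0 < e1) by (apply Rmin_pos; lra).
    assert (e11 : e1 <= e0) by apply Rmin_l. assert (e1d : e1 <= dl' / 2) by apply Rmin_r.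
    destruct (Has e1 e10) as [X1 HX1].
    destruct (D_pow_large X1) as [n Hn].
    destruct (Gen X1 e1 e10 HX1 n) as [e [e' [E1 [E2 [G G']]]]].
    { pose proof (D_pow_ge_1 n). unfold X in *; nra. }
    destruct (Rel n) as [_ HR].
    assert (Hcl : Cmod (iter f n (K (shift t)) - iter f n (K t)) <= q * Cmod (iter f n (K t))).
    { rewrite G, G', Dist. apply Rmult_le_compat_r; [apply Cmod_ge_0|].
      rewrite <- cexp_0 at 1. apply Hdl'. replace (e' - e - 0)%C with (e' + - e)%C by ring.
      eapply Rle_trans; [apply Cmod_triangle|]. rewrite Cmod_opp. lra. }
    destruct (Rel n) as [Un _].
    assert (HH : Cmod (K (shift t) - K t) * Cmod (iter f n (K t)) <= q * Cmod (iter f n (K t)) * Cmod (K t)).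
    { eapply Rle_trans; [apply HR|]. apply Rmult_le_compat_r; lra. }
    replace (Cmod (K (shift t) - K t)) with (2 * q * Cmod (K t)) in HH by (unfold q; field; lra).
    assert (0 < q * Cmod (iter f n (K t)) * Cmod (K t)) by auto using Rmult_lt_0_compat.
    lra. }
  apply Cmod_eq_0 in Z. replace (K (shift t)) with (K (shift t) - K t + K t)%C by ring.
  rewrite Z. ring.
Qed.

(* Propagate the vanishing of [K (shift t) - K t] to the left along a horizontal chain of discs. *)
Lemma K_period (t : C) : 0 < snd t -> K (shift t) = K t.
Proof.
  intros Ht. set (y0 := snd t) in *.
  destruct (K_period_large (2 * y0)) as [X HX]; [lra|].
  set (g := fun t => (K (shift t) - K t)%C).
  (* Discs of radius [2 r] around points of height [y0] stay above the real axis. Consecutive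
     centres are at distance [r], so the disc of radius [r / 2] around a new centre lies in the
     previous disc, where [g] already vanishes. *)
  set (r := y0 / 4). set (X1 := X + 2 * r).
  assert (Hr : 0 < r) by (unfold r; lra).
  assert (P : forall k z, Cmod (z - (X1 - INR k * r, y0)) < 2 * r -> g z = 0%C).
  { induction k as [|k IH]; intros z Hz.
    - pose proof (Rabs_fst_le (z - (X1 - INR 0 * r, y0))) as F1. apply Rabs_le_between in F1.
      pose proof (Rabs_snd_le (z - (X1 - INR 0 * r, y0))) as F2. apply Rabs_le_between in F2.
      set (m := Cmod (z - (X1 - INR 0 * r, y0))) in *. simpl in F1, F2.
      unfold g. rewrite HX; [ring| |]; unfold X1, r in *; lra.
    - set (tk := (X1 - INR (S k) * r, y0)) in *.
      assert (Up : forall w, Cmod (w - tk) <= 2 * r -> 0 < snd w).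
      { intros w Hw. pose proof (Rabs_snd_le (w - tk)) as F. apply Rabs_le_between in F.
        set (m := Cmod (w - tk)) in *. simpl in F. unfold r in *. lra. }
      assert (Bd : forall w, Cmod (w - tk) <= 2 * r -> Cmod w <= Cmod tk + 2 * r).
      { intros w Hw. pose proof (Cmod_triangle tk (w - tk)) as T.
        replace (tk + (w - tk))%C with w in T by ring. lra. }
      destruct (K_bound (Cmod tk + 2 * r + Cmod (0, 2 * PI)%R)) as [B HB].
      apply (identity_disc g tk (r / 2) (2 * r) (B + B)); auto.
      + lra.
      + apply (shift_diff_approx _ (Cmod tk + 2 * r)); intros w Hw; [apply Up|apply Bd]; lra.
      + intros w Hw. unfold g. eapply Rle_trans; [apply Cmod_triangle|]. rewrite Cmod_opp.
        specialize (Up w Hw). specialize (Bd w Hw). pose proof PI_RGT_0. pose proof (Cmod_ge_0 (0, 2 * PI)%R).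
        apply Rplus_le_compat; apply HB.
        * apply slit_up. unfold shift; simpl. lra.
        * unfold shift. eapply Rle_trans; [apply Cmod_triangle|]. lra.
        * now apply slit_up.
        * lra.
      + intros w Hw. apply IH.
        pose proof (Cmod_triangle (w - tk) (tk - (X1 - INR k * r, y0))) as T.
        replace (w - tk + (tk - (X1 - INR k * r, y0)%R))%C with (w - (X1 - INR k * r, y0)%R)%C in T by ring.
        replace (tk - (X1 - INR k * r, y0)%R)%C with (RtoC (- r)) in T.
        2:{ unfold tk. rewrite S_INR. unfold Cminus, Cplus, Copp, RtoC; simpl. f_equal; ring. }
        rewrite Cmod_R, Rabs_Ropp, Rabs_pos_eq in T; lra. }
  assert (P2 : forall k x, X1 - INR k * r <= x -> g (x, y0) = 0%C).
  { induction k as [|k IH]; intros x Hx.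
    - unfold g. rewrite HX; [ring|simpl in *; unfold X1 in *; lra|simpl; lra].
    - destruct (Rle_dec (X1 - INR k * r) x) as [L|L]; auto.
      apply (P (S k)). rewrite S_INR in *.
      replace ((x, y0) - (X1 - (INR k + 1) * r, y0)%R)%C with (RtoC (x - (X1 - (INR k + 1) * r))).
      2:{ unfold Cminus, Cplus, Copp, RtoC; simpl. f_equal; ring. }
      rewrite Cmod_R, Rabs_pos_eq; lra. }
  destruct (nfloor_ex (Rabs (X1 - fst t) / r)) as [k Hk].
  { apply Rmult_le_pos; [apply Rabs_pos|]. now apply Rlt_le, Rinv_0_lt_compat. }
  assert (G : g t = 0%C).
  { replace t with (fst t, y0) by (destruct t; reflexivity). apply (P2 (S k)). rewrite S_INR.
    assert (Rabs (X1 - fst t) <= (INR k + 1) * r).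
    { replace (Rabs (X1 - fst t)) with (Rabs (X1 - fst t) / r * r) by (field; lra).
      apply Rmult_le_compat_r; lra. }
    pose proof (Rle_abs (X1 - fst t)). lra. }
  unfold g in G. replace (K (shift t)) with (K (shift t) - K t + K t)%C by ring. rewrite G. ring.
Qed.

Lemma K_period_nat (k : nat) (x y : R) : 0 < y -> K (x, y + 2 * PI * INR k) = K (x, y).
Proof.
  intros Hy. induction k as [|k IH].
  - simpl. f_equal. f_equal. ring.
  - rewrite <- IH. rewrite <- (K_period (x, y + 2 * PI * INR k)).
    + f_equal. unfold shift, Cplus; simpl fst; simpl snd. rewrite S_INR. f_equal; ring.
    + simpl. pose proof PI_RGT_0. pose proof (pos_INR k).
      assert (0 <= 2 * PI * INR k) by (apply Rmult_le_pos; lra). lra.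
Qed.

(** Continuity carries the period to the boundary of the half-plane; this serves the negative real
    axis of the [t]-plane. *)
Lemma K_period_closed (x : R) : x <> 0 -> K (x, 2 * PI) = K (x, 0).
Proof.
  intros Hx. pose proof PI_RGT_0 as Hpi.
  assert (S1 : slit (x, 0)).
  { apply slit_up_closed; simpl; [lra|]. intros E. apply (f_equal fst) in E. simpl in E. lra. }
  assert (S2 : slit (x, 2 * PI)) by (apply slit_up; simpl; lra).
  assert (Z : Cmod (K (x, 2 * PI) - K (x, 0)) = 0).
  { apply Rle_antisym; [|apply Cmod_ge_0]. apply Rnot_lt_le. intros Hpos.
    set (m := Cmod (K (x, 2 * PI) - K (x, 0))) in *.
    destruct (K_cont _ S1 (m / 4)) as [d1 [D1 H1]]; [lra|].
    destruct (K_cont _ S2 (m / 4)) as [d3 [D3 H3]]; [lra|].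
    set (y := Rmin d1 d3). assert (y0 : 0 < y) by now apply Rmin_pos.
    assert (E : forall y1 : R, ((x, y1 + y)%R - (x, y1)%R)%C = (0, y)%R).
    { intros. unfold Cminus, Cplus, Copp; simpl. f_equal; ring. }
    assert (My : Cmod (0, y) <= y).
    { eapply Rle_trans; [apply Cmod_le_sum|]. simpl. rewrite Rabs_R0, Rabs_pos_eq; lra. }
    specialize (H1 (x, 0 + y)). rewrite E in H1.
    specialize (H3 (x, 2 * PI + y)). rewrite E in H3.
    specialize (H1 ltac:(eapply Rle_trans; [apply My|apply Rmin_l])).
    specialize (H3 ltac:(eapply Rle_trans; [apply My|apply Rmin_r])).
    replace (x, 2 * PI + y) with (x, (0 + y) + 2 * PI * INR 1) in H3 by (simpl; f_equal; ring).
    rewrite K_period_nat in H3 by lra.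
    pose proof (Cmod_triangle (K (x, 0 + y) - K (x, 0)) (- (K (x, 0 + y) - K (x, 2 * PI)))) as T.
    rewrite Cmod_opp in T.
    replace (K (x, 0 + y)%R - K (x, 0)%R + - (K (x, 0 + y)%R - K (x, 2 * PI)%R))%C
      with (K (x, 2 * PI)%R - K (x, 0)%R)%C in T by ring.
    fold m in T. lra. }
  apply Cmod_eq_0 in Z. replace (K (x, 2 * PI)) with (K (x, 2 * PI)%R - K (x, 0)%R + K (x, 0)%R)%C by ring.
  rewrite Z. ring.
Qed.

(** * Behaviour of [K] at 0 and at [2 pi i] *)

Lemma Cmod_imag (y : R) : 0 < y -> Cmod (0, y) = y.
Proof.
  intros Hy. unfold Cmod; simpl. replace (0 * (0 * 1) + y * (y * 1)) with (y * y) by ring.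
  apply sqrt_square; lra.
Qed.

Lemma K_2PI_near (y : R) : 0 < y -> K (0, 2 * PI + y) = K (0, y).
Proof.
  intros Hy. rewrite <- (K_period_nat 1 0 y Hy). f_equal. f_equal. simpl; ring.
Qed.

(** [K (2 pi i)] is the limit of [K (2 pi i + i y) = K (i y)], which tends to [Phi 0 = 0]. *)
Lemma K_2PI : K (0, 2 * PI) = 0%C.
Proof.
  pose proof PI_RGT_0 as Hpi.
  assert (S2 : slit (0, 2 * PI)) by (apply slit_up; simpl; lra).
  apply Cmod_eq_0. apply Rle_antisym; [|apply Cmod_ge_0]. apply Rnot_lt_le. intros Hpos.
  set (m := Cmod (K (0, 2 * PI))) in *.
  destruct (K_cont _ S2 (m / 4)) as [d1 [D1 H1]]; [lra|].
  destruct (holo_ccont Phi 0%C (Phi_holo 0%C) (m / 4)) as [d3 [D3 H3]]; [lra|].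
  (* The second bound is [c d3^(1/kap)], below which [upower] has modulus at most [d3]. *)
  set (y := Rmin d1 (exp (ln c + ln d3 / kap))).
  assert (y0 : 0 < y) by (apply Rmin_pos; auto using exp_pos).
  specialize (H1 (0, 2 * PI + y)).
  replace ((0, (2 * PI + y)%R) - (0, (2 * PI)%R))%C with (0, y) in H1.
  2:{ unfold Cminus, Cplus, Copp; simpl. f_equal; ring. }
  rewrite Cmod_imag in H1 by auto. specialize (H1 (Rmin_l _ _)).
  rewrite K_2PI_near in H1 by auto.
  specialize (H3 (upower kap c (0, y))).
  replace (upower kap c (0, y)%R - 0)%C with (upower kap c (0, y)) in H3 by ring.
  rewrite Cmod_upower, Cmod_imag in H3 by auto. rewrite Phi_0 in H3.
  assert (L : exp (kap * (ln y - ln c)) <= d3).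
  { rewrite <- (exp_ln d3) by auto.
    assert (Hl : kap * (ln y - ln c) <= ln d3).
    { replace (ln d3) with (kap * (ln d3 / kap)) by (field; lra). apply Rmult_le_compat_l; [lra|].
      assert (ln y <= ln c + ln d3 / kap); [|lra].
      rewrite <- (ln_exp (ln c + ln d3 / kap)). apply ln_le; auto. apply Rmin_r. }
    destruct Hl as [Hl| ->]; [left; now apply exp_increasing|right; auto]. }
  specialize (H3 L). fold (K (0, y)) in H3.
  replace (K (0, y)%R - 0)%C with (K (0, y)) in H3 by ring.
  pose proof (Cmod_triangle_rev (K (0, 2 * PI)) (K (0, y))) as T. rewrite Cmod_minus_sym in T.
  fold m in T. lra.
Qed.

(* [K] vanishes at least to first order at [2 pi i], while [|K (i y)|] is
   comparable to [y ^ kap]. *)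
Lemma kap_ge_1 : 1 <= kap.
Proof.
  apply Rnot_lt_le. intros Hlt. pose proof PI_RGT_0 as Hpi.
  assert (S2 : slit (0, 2 * PI)) by (apply slit_up; simpl; lra).
  destruct (holo_lipschitz_at Phi (upower kap c (0, 2 * PI)) (Phi_holo _)) as [L1 [d1 [HL1 [D1 H1]]]].
  destruct (has_jet2_upower kap c _ S2) as [u1 [u2 Hu]].
  destruct (jet2_incr_lin _ _ _ _ Hu) as [L2 [d3 [HL2 [D3 H3]]]].
  destruct Phi_near0 as [d4 [D4 H4]].
  set (B := Rmin (Rmin d3 (d1 / L2)) (exp (ln c + ln d4 / kap))).
  assert (B0 : 0 < B).
  { repeat apply Rmin_pos; auto using exp_pos. now apply Rdiv_lt_0_compat. }
  assert (Bd3 : B <= d3) by (unfold B; eapply Rle_trans; apply Rmin_l).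
  assert (Bd1 : B <= d1 / L2) by (unfold B; eapply Rle_trans; [apply Rmin_l|apply Rmin_r]).
  assert (Bd4 : B <= exp (ln c + ln d4 / kap)) by apply Rmin_r.
  (* Logarithm of [(y / c)^kap <= 2 |K (i y)| <= 2 L1 L2 y]: on the left [Phi z] is close to [z], on
     the right [K] vanishes at [2 pi i] and is Lipschitz there. *)
  assert (Key : forall y, 0 < y <= B -> kap * (ln y - ln c) <= ln (2 * (L1 * L2)) + ln y).
  { intros y [y0 yB].
    assert (Ey : (0, 2 * PI + y) = ((0, 2 * PI)%R + (0, y)%R)%C).
    { unfold Cplus; simpl. f_equal; ring. }
    specialize (H3 (0, y)). rewrite Cmod_imag in H3 by auto. specialize (H3 ltac:(lra)).
    rewrite <- Ey in H3.
    assert (Hq : L2 * y <= d1).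
    { replace d1 with (L2 * (d1 / L2)) by (field; lra). apply Rmult_le_compat_l; lra. }
    specialize (H1 (upower kap c (0, 2 * PI + y)) ltac:(lra)).
    fold (K (0, 2 * PI + y)) in H1. fold (K (0, 2 * PI)) in H1.
    rewrite K_2PI, K_2PI_near in H1 by auto.
    replace (K (0, y)%R - 0)%C with (K (0, y)) in H1 by ring.
    assert (H5 : Cmod (K (0, y)) <= L1 * L2 * y).
    { eapply Rle_trans; [apply H1|]. rewrite Rmult_assoc. apply Rmult_le_compat_l; lra. }
    specialize (H4 (upower kap c (0, y))). rewrite Cmod_upower, Cmod_imag in H4 by auto.
    assert (Hly : ln y <= ln c + ln d4 / kap).
    { rewrite <- (ln_exp (ln c + ln d4 / kap)). apply ln_le; auto. lra. }
    assert (L : exp (kap * (ln y - ln c)) <= d4).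
    { rewrite <- (exp_ln d4) by auto.
      assert (Hl : kap * (ln y - ln c) <= ln d4).
      { replace (ln d4) with (kap * (ln d4 / kap)) by (field; lra). apply Rmult_le_compat_l; lra. }
      destruct Hl as [Hl| ->]; [left; now apply exp_increasing|right; auto]. }
    specialize (H4 L). fold (K (0, y)) in H4.
    pose proof (Cmod_triangle_rev (upower kap c (0, y)) (K (0, y))) as T.
    rewrite Cmod_minus_sym, Cmod_upower, Cmod_imag in T by auto.
    rewrite <- (ln_exp (kap * (ln y - ln c))).
    assert (P2 : 0 < 2 * (L1 * L2)) by (apply Rmult_lt_0_compat; [lra|apply Rmult_lt_0_compat; lra]).
    rewrite <- ln_mult by auto. apply ln_le; [apply exp_pos|]. lra. }
  (* With [y = exp l], [Key] reads [(kap - 1) l <= M], which fails for [kap < 1] once [l] is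
     negative enough. *)
  set (M := ln (2 * (L1 * L2)) + kap * ln c).
  set (l := Rmin (ln B) (- (Rabs M + 1) / (1 - kap))).
  assert (lB : l <= ln B) by apply Rmin_l.
  assert (lM : l * (1 - kap) <= - (Rabs M + 1)).
  { replace (- (Rabs M + 1)) with (- (Rabs M + 1) / (1 - kap) * (1 - kap)) by (field; lra).
    apply Rmult_le_compat_r; [lra|apply Rmin_r]. }
  specialize (Key (exp l)). rewrite ln_exp in Key.
  assert (Hel : exp l <= B).
  { rewrite <- (exp_ln B) by auto. destruct lB as [Hl| ->]; [left; now apply exp_increasing|right; auto]. }
  specialize (Key (conj (exp_pos l) Hel)).
  pose proof (Rle_abs M) as F. unfold M in *. lra.
Qed.

(** * The escaping set in the coordinate [t] *)

Let E := fun x y : R => escapes f rad (K (x, y)).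

Lemma E_scal (n : nat) (x y : R) : 0 < y -> E (D ^ n * x) (D ^ n * y) <-> E x y.
Proof.
  intros Hy. unfold E. rewrite <- Cscal_pair, K_scal by now apply pair_neq_0.
  now apply escapes_iter.
Qed.

(** Scaling by [D ^ n] turns the translation into [k] full periods. *)
Lemma E_translate (n k : nat) (x y : R) : 0 < y ->
  E x (y + 2 * PI / D ^ n * INR k) <-> E x y.
Proof.
  intros Hy. pose proof (D_pow_ge_1 n) as Dn. pose proof PI_RGT_0.
  assert (0 <= 2 * PI / D ^ n * INR k).
  { apply Rmult_le_pos; [|apply pos_INR]. apply Rlt_le, Rdiv_lt_0_compat; lra. }
  rewrite <- (E_scal n x y Hy), <- (E_scal n x) by lra.
  replace (D ^ n * (y + 2 * PI / D ^ n * INR k)) with (D ^ n * y + 2 * PI * INR k) by (field; lra).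
  unfold E. rewrite K_period_nat; [tauto|]. apply Rmult_lt_0_compat; lra.
Qed.

(* Escaping is an open condition invariant under the dense group of
   translations by [2 pi i k / D^n]. *)
Lemma E_vertical (x y y' : R) : 0 < y -> 0 < y' -> E x y -> E x y'.
Proof.
  intros Hy Hy' HE. pose proof PI_RGT_0 as Hpi.
  destruct (escapes_locally_uniform f rad _ f_esc f_cont HE) as [n0 [d1 [D1 H1]]].
  destruct (K_cont (x, y) ltac:(apply slit_up; auto) d1 D1) as [del [Hdel H2]].
  assert (Hopen : forall y2, y <= y2 <= y + del -> E x y2).
  { intros y2 Hy2. exists n0. apply H1, H2.
    replace ((x, y2)%R - (x, y)%R)%C with (0, y2 - y)%R.
    2:{ unfold Cminus, Cplus, Copp; simpl. f_equal; ring. }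
    eapply Rle_trans; [apply Cmod_le_sum|]. simpl. rewrite Rabs_R0, Rabs_pos_eq; lra. }
  destruct (D_pow_large (2 * PI / del)) as [n Hn]. pose proof (D_pow_ge_1 n) as Dn.
  (* Translates by multiples of [h <= del] cannot jump over the escaping interval [[y, y + del]]. *)
  set (h := 2 * PI / D ^ n).
  assert (h0 : 0 < h) by (apply Rdiv_lt_0_compat; lra).
  assert (hd : h <= del).
  { unfold h. apply Rmult_le_reg_r with (D ^ n); [lra|].
    replace (2 * PI / D ^ n * D ^ n) with (2 * PI / del * del) by (field; lra).
    rewrite (Rmult_comm del). apply Rmult_le_compat_r; lra. }
  assert (Fl : forall u, 0 <= u -> exists k, INR k * h <= u < (INR k + 1) * h).
  { intros u Hu. destruct (nfloor_ex (u / h)) as [k Hk].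
    { apply Rmult_le_pos; auto. now apply Rlt_le, Rinv_0_lt_compat. }
    exists k. replace u with (u / h * h) by (field; lra). split.
    - apply Rmult_le_compat_r; lra.
    - apply Rmult_lt_compat_r; lra. }
  destruct (Rle_dec y y') as [L|L].
  - destruct (Fl (y' - y)) as [k Hk]; [lra|].
    replace y' with ((y' - h * INR k) + h * INR k) by ring.
    apply (proj2 (E_translate n k x (y' - h * INR k) ltac:(lra))). apply Hopen. lra.
  (* From below, [k + 1] steps are needed: [y' + k h <= y < y' + (k + 1) h]. *)
  - destruct (Fl (y - y')) as [k Hk]; [lra|].
    apply (proj1 (E_translate n (S k) x y' Hy')). fold h. apply Hopen. rewrite S_INR. lra.
Qed.

Lemma E_scal_line (n : nat) (x : R) : E (D ^ n * x) 1 <-> E x 1.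
Proof.
  pose proof (D_pow_ge_1 n). rewrite <- (E_scal n x 1) by lra.
  split; apply E_vertical; lra.
Qed.

Lemma K_large_right : exists X, forall x y, X <= x -> 0 <= y <= 1 -> rad <= Cmod (K (x, y)).
Proof.
  destruct K_asym as [b [s0 [Hb Has]]].
  destruct (Has 1) as [X HX]; [lra|].
  assert (Hsb : 0 < sin b) by (apply sin_gt_0; lra).
  destruct f_esc as [Hrad Hesc].
  exists (Rabs X + 1 + ln rad + Rabs (fst s0) + / sin b). intros x y Hx Hy.
  pose proof (Rabs_pos X). pose proof (Rle_abs X). pose proof (Rabs_pos (fst s0)).
  pose proof (Rinv_0_lt_compat _ Hsb) as Hi.
  assert (0 <= ln rad) by (rewrite <- ln_1; apply ln_le; lra).
  pose proof (Rabs_fst_le (x, y)) as F. simpl in F. apply Rabs_le_between in F.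
  destruct (HX (x, y)) as [e [He HK]]; simpl; try lra.
  - apply Rle_trans with (sin b * / sin b); [rewrite Rinv_r; lra|].
    apply Rmult_le_compat_l; lra.
  - rewrite HK, Cmod_cexp. rewrite <- (exp_ln rad) by lra.
    pose proof (Rabs_fst_le e) as Fe. apply Rabs_le_between in Fe.
    pose proof (Rle_abs (- fst s0)) as F2. rewrite Rabs_Ropp in F2.
    left. apply exp_increasing. simpl. lra.
Qed.

Lemma E_right (x y : R) : 0 < x -> 0 < y -> E x y.
Proof.
  intros Hx Hy. apply (E_vertical x 1); [lra|auto|].
  destruct K_large_right as [X HX]. destruct (D_pow_large (X / x)) as [n Hn].
  apply (proj1 (E_scal_line n x)). exists 0%nat. apply HX; [|lra].
  replace X with (X / x * x) by (field; lra). apply Rmult_le_compat_r; lra.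
Qed.

Lemma E_real (x : R) : 0 < x -> E x 0.
Proof.
  intros Hx. destruct K_large_right as [X HX]. destruct (D_pow_large (X / x)) as [n Hn].
  exists n. rewrite <- K_scal, Cscal_pair.
  2:{ intros H. apply (f_equal fst) in H. simpl in H. lra. }
  apply HX; [|lra].
  replace X with (X / x * x) by (field; lra). apply Rmult_le_compat_r; lra.
Qed.

(** The line [Re t = 0] contains [2 pi i], where [K] takes the fixed point 0 of [f]. *)
Lemma E_zero (y : R) : 0 < y -> ~ E 0 y.
Proof.
  intros Hy HE. pose proof PI_RGT_0.
  apply (E_vertical 0 y (2 * PI)) in HE; [|auto|lra].
  destruct HE as [n Hn]. rewrite K_2PI in Hn.
  assert (Z : forall k, iter f k 0%C = 0%C).
  { induction k as [|k IH]; simpl; [reflexivity|now rewrite IH]. }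
  rewrite Z, Cmod_0 in Hn. destruct f_esc. lra.
Qed.

Lemma not_escapes_bound (z : C) : ~ escapes f rad z -> Cmod z <= rad.
Proof. intros H. apply Rnot_lt_le. intros L. apply H. exists 0%nat. simpl; lra. Qed.

(* Phragmen-Lindelof in the half-strip, where [K] is bounded by periodicity. *)
Lemma strip_bound (a x y : R) : a < x < 0 -> 0 < y -> (forall y, 0 < y -> ~ E a y) ->
  Cmod (K (x, y)) <= rad.
Proof.
  intros Hx Hy Ha. pose proof PI_RGT_0 as Hpi.
  assert (HS : exists S, 0 <= S /\ forall u v, a <= u <= 0 -> 1 <= v -> Cmod (K (u, v)) <= S).
  { destruct (K_bound (- a + (1 + 2 * PI))) as [B HB].
    exists (Rmax B 0). split; [apply Rmax_r|]. intros u v Hu Hv.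
    eapply Rle_trans; [|apply Rmax_l].
    destruct (nfloor_ex ((v - 1) / (2 * PI))) as [k Hk].
    { apply Rmult_le_pos; [lra|]. apply Rlt_le, Rinv_0_lt_compat; lra. }
    assert (Hk' : INR k * (2 * PI) <= v - 1 < (INR k + 1) * (2 * PI)).
    { replace (v - 1) with ((v - 1) / (2 * PI) * (2 * PI)) by (field; lra). split.
      - apply Rmult_le_compat_r; lra.
      - apply Rmult_lt_compat_r; lra. }
    replace v with ((v - 2 * PI * INR k) + 2 * PI * INR k) by ring.
    rewrite K_period_nat by lra. apply HB; [apply slit_up; simpl; lra|].
    eapply Rle_trans; [apply Cmod_le_sum|]. simpl.
    rewrite (Rabs_left1 u), Rabs_pos_eq; lra. }
  destruct HS as [S [S0 HS]].
  apply Rnot_lt_le. intros Hlt. set (m := Cmod (K (x, y)) - rad).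
  (* In the strip the term of the barrier quadratic in [Re t] costs at most [2 eps a^2 = m / 2]. *)
  set (eps := m / (4 * (a * a))).
  assert (a2 : 0 < a * a) by nra.
  assert (He : 0 < eps) by (apply Rdiv_lt_0_compat; unfold m; lra).
  assert (Hea : eps * (2 * (a * a)) = m / 2) by (unfold eps; field; lra).
  assert (Hr1 : 1 <= rad) by apply f_esc.
  (* On the horizontal sides the barrier contributes [- eps Y^2 <= - S], which cancels the bound [S]
     on [K]. *)
  set (Y := 1 + S / eps).
  assert (HSe : 0 <= S / eps) by (apply Rmult_le_pos; [auto|]; now apply Rlt_le, Rinv_0_lt_compat).
  assert (HY : S <= eps * (Y * Y)).
  { replace S with (eps * (S / eps)) by (field; lra). apply Rmult_le_compat_l; [lra|].
    unfold Y. nra. }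
  destruct (nfloor_ex ((Y + 2) / (2 * PI))) as [k Hk].
  { apply Rmult_le_pos; [unfold Y; lra|]. apply Rlt_le, Rinv_0_lt_compat; lra. }
  (* Periodicity lets the point be raised until the box of half-height [Y] around it lies in the
     region where [S] bounds [K]. *)
  set (y1 := y + 2 * PI * INR (Datatypes.S k)).
  assert (Hy1 : Y + 2 <= y1).
  { unfold y1. rewrite S_INR. replace (Y + 2) with ((Y + 2) / (2 * PI) * (2 * PI)) by (field; lra).
    assert ((Y + 2) / (2 * PI) * (2 * PI) <= (INR k + 1) * (2 * PI)) by (apply Rmult_le_compat_r; lra). lra. }
  assert (Hb : Cmod (K (x, y1)) + eps * bump y1 (x, y1) <= rad + m / 2).
  { apply (max_principle_bump (fun z => a <= fst z <= 0 /\ y1 - Y <= snd z <= y1 + Y) (- a + (y1 + Y))); auto.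
    - apply closed_box.
    - intros z Hz. eapply Rle_trans; [apply Cmod_le_sum|].
      rewrite (Rabs_left1 (fst z)), Rabs_pos_eq; lra.
    - apply (K_approx _ (- a + (y1 + Y))).
      + intros z Hz. apply slit_up. lra.
      + intros z Hz. eapply Rle_trans; [apply Cmod_le_sum|].
        rewrite (Rabs_left1 (fst z)), Rabs_pos_eq; lra.
    - intros [u v] Hz Hni. simpl in Hz. unfold bump; simpl.
      assert (Hu2 : eps * (2 * (u * u)) <= m / 2).
      { rewrite <- Hea. apply Rmult_le_compat_l; [lra|]. nra. }
      assert (Hv2 : 0 <= eps * ((v - y1) * (v - y1))) by (apply Rmult_le_pos; [lra|apply Rle_0_sqr]).
      destruct (Req_dec u a) as [->|Nu].
      { pose proof (not_escapes_bound _ (Ha v ltac:(lra))). lra. }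
      destruct (Req_dec u 0) as [->|Nu0].
      { pose proof (not_escapes_bound _ (E_zero v ltac:(lra))). lra. }
      assert (Hv : (v - y1) * (v - y1) = Y * Y).
      { destruct (Req_dec v (y1 - Y)) as [->|Nv]; [ring|].
        destruct (Req_dec v (y1 + Y)) as [->|Nv']; [ring|].
        exfalso. apply Hni, interior_box; simpl; lra. }
      rewrite Hv. specialize (HS u v ltac:(lra) ltac:(lra)). lra.
    - unfold Y in *; simpl; lra. }
  unfold y1 in Hb at 1. rewrite K_period_nat in Hb by auto.
  unfold bump in Hb; simpl fst in Hb; simpl snd in Hb.
  assert (0 <= eps * (2 * (x * x))) by (apply Rmult_le_pos; [lra|]; nra).
  unfold m in *. nra.
Qed.

Lemma E_left (x1 x2 : R) : x1 < 0 -> x2 < 0 -> E x1 1 -> E x2 1.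
Proof.
  intros Hx1 Hx2 H1. apply NNPP. intros H2.
  destruct (D_pow_large (x1 / x2 + 1)) as [n Hn].
  set (a := D ^ n * x2).
  assert (Ha : a < x1).
  { unfold a. replace x1 with (x1 / x2 * x2) at 1 by (field; lra). nra. }
  assert (HEa : forall k y, 0 < y -> ~ E (D ^ k * a) y).
  { intros k y Hy HE. apply H2. apply (proj1 (E_scal_line (k + n) x2)).
    rewrite pow_add, Rmult_assoc. fold a. apply (E_vertical _ y); auto; lra. }
  assert (HB : forall k, Cmod (iter f k (K (x1, 1))) <= rad).
  { intros k. pose proof (D_pow_ge_1 k). rewrite <- K_scal, Cscal_pair by (apply pair_neq_0; lra).
    apply (strip_bound (D ^ k * a)); [|lra|apply HEa].
    split; [apply Rmult_lt_compat_l; lra|]. nra. }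
  (* An iterate of modulus at least [rad] is followed by one of modulus at least [2 rad], against
     the bound. *)
  destruct H1 as [k Hk]. specialize (HB (S k)). simpl in HB.
  destruct f_esc as [Hr He]. specialize (He _ Hk). lra.
Qed.

Lemma ray_dichotomy (r1 r2 gam : R) : 0 < c -> 0 < r1 -> 0 < r2 -> 0 <= gam <= PI ->
  escapes f rad (Phi (RtoC r1 * cexp (0, gam))%C) -> escapes f rad (Phi (RtoC r2 * cexp (0, gam))%C).
Proof.
  intros c0 Hr1 Hr2 Hg. pose proof kap_ge_1 as Hk. pose proof PI_RGT_0 as Hpi.
  (* In polar form [t = c z ^ rho] sends the angle [gam] to [th] and the radius [r] to
     [tau r = c r^(1/kap)]. *)
  set (th := gam / kap).
  assert (Hth : 0 <= th <= gam).
  { unfold th. split.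
    - apply Rmult_le_pos; [lra|]. now apply Rlt_le, Rinv_0_lt_compat.
    - apply Rmult_le_reg_r with kap; auto. unfold Rdiv. rewrite Rmult_assoc, Rinv_l by lra. nra. }
  set (tau := fun r => exp (ln c + ln r / kap)).
  assert (Tp : forall r, 0 < tau r) by (intros; apply exp_pos).
  assert (HK : forall r, 0 < r -> Phi (RtoC r * cexp (0, gam))%C = K (tau r * cos th, tau r * sin th)).
  { intros r Hr. unfold K. f_equal.
    change (tau r * cos th, tau r * sin th) with (cexp (ln c + ln r / kap, th)%R).
    unfold upower. rewrite uplog_cexp by (simpl; lra).
    replace (RtoC kap * ((ln c + ln r / kap, th)%R - RtoC (ln c)))%C with (RtoC (ln r) + (0, gam)%R)%C.
    - rewrite cexp_plus. f_equal. unfold cexp; simpl. rewrite exp_ln, cos_0, sin_0 by auto.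
      unfold RtoC. f_equal; ring.
    - unfold Cplus, Cmult, Cminus, Copp, RtoC, th; simpl. f_equal; field; lra. }
  rewrite (HK r1 Hr1), (HK r2 Hr2).
  pose proof (Tp r1) as T1. pose proof (Tp r2) as T2.
  set (t1 := tau r1) in *. set (t2 := tau r2) in *.
  destruct (Req_dec th 0) as [H0|H0].
  { intros _. rewrite H0, cos_0, sin_0, !Rmult_1_r, Rmult_0_r. now apply E_real. }
  (* Each point of the ray is moved vertically to height 1, so that only the sign of [cos th]
     matters. For [th = PI] the point is real and is first lifted to height [2 pi]. *)
  assert (Line : forall t, 0 < t -> escapes f rad (K (t * cos th, t * sin th)) <-> E (t * cos th) 1).
  { intros t Ht. destruct (Req_dec th PI) as [HP|HP].
    - rewrite HP, sin_PI, cos_PI, Rmult_0_r. rewrite <- K_period_closed by lra.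
      fold (E (t * -1) (2 * PI)). split; apply E_vertical; lra.
    - assert (0 < sin th) by (apply sin_gt_0; lra).
      assert (0 < t * sin th) by now apply Rmult_lt_0_compat.
      fold (E (t * cos th) (t * sin th)). split; apply E_vertical; lra. }
  rewrite !Line by auto. intros H1.
  destruct (Rtotal_order (cos th) 0) as [L|[Z|G]].
  - apply (E_left (t1 * cos th)); auto; nra.
  - exfalso. rewrite Z, Rmult_0_r in H1. revert H1. apply E_zero; lra.
  - apply E_right; [|lra]. now apply Rmult_lt_0_compat.
Qed.

End Core.

(** * Reality of the constant and reduction to one ray *)

Lemma carg_bound (z : C) : - PI < carg z <= PI.
Proof.
  pose proof PI_RGT_0. unfold carg. destruct Req_EM_T; [lra|].
  pose proof (atan_bound (snd z / (Cmod z + fst z))). lra.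
Qed.

Lemma clog_pos_real (x : R) : 0 < x -> clog x = RtoC (ln x).
Proof.
  intros Hx. rewrite <- (exp_ln x) at 1 by auto.
  replace (RtoC (exp (ln x))) with (cexp (RtoC (ln x))).
  - apply clog_cexp. simpl. pose proof PI_RGT_0; lra.
  - unfold cexp, RtoC; simpl. rewrite cos_0, sin_0. f_equal; ring.
Qed.

Lemma cexp_real (x : R) : cexp (RtoC x) = RtoC (exp x).
Proof. unfold cexp, RtoC; simpl. rewrite cos_0, sin_0. f_equal; ring. Qed.

Lemma peval_at_0 (a : nat -> R) (n : nat) : peval a n 0%C = RtoC (a 0%nat).
Proof.
  induction n as [|n IH]; [apply peval_0|]. rewrite peval_S, IH.
  change (cpow_n (RtoC 0) (S n)) with (0 * cpow_n (RtoC 0) n)%C. ring.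
Qed.

(** At [(h, 0)] the divided difference is close to both [a 1] and [lam]. *)
Lemma peval_derive_0 (a : nat -> R) (n : nat) (lam : R) : a 0%nat = 0 ->
  @is_derive C_AbsRing C_NormedModule (peval a (S n)) (RtoC 0) (RtoC lam) -> a 1%nat = lam.
Proof.
  intros a0 Hder. apply NNPP. intros N.
  set (m := Rabs (a 1%nat - lam)).
  assert (m0 : 0 < m) by (apply Rabs_pos_lt; lra).
  destruct (is_derive_C_eps _ _ _ Hder (m / 4)) as [del [D Hd]]; [lra|].
  destruct (peval_quot_near0 a n) as [K [K0 HK]].
  set (h := Rmin del (Rmin 1 (m / (4 * (K + 1))))).
  assert (h0 : 0 < h).
  { repeat apply Rmin_pos; try lra. apply Rdiv_lt_0_compat; lra. }
  assert (hd : h <= del) by apply Rmin_l.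
  assert (h1 : h <= 1) by (unfold h; eapply Rle_trans; [apply Rmin_r|apply Rmin_l]).
  assert (hK : K * h <= m / 4).
  { assert (h <= m / (4 * (K + 1))) by (unfold h; eapply Rle_trans; apply Rmin_r).
    apply Rle_trans with ((K + 1) * (m / (4 * (K + 1)))).
    - apply Rmult_le_compat; lra.
    - right; field; lra. }
  assert (Mh : Cmod h = h) by (rewrite Cmod_R; apply Rabs_pos_eq; lra).
  specialize (Hd h ltac:(rewrite Mh; auto)). rewrite Mh in Hd.
  rewrite Cplus_0_l, peval_quot_spec in Hd.
  specialize (HK h 0%C ltac:(rewrite Mh; auto) ltac:(rewrite Cmod_0; lra)).
  rewrite Mh, Cmod_0, Rplus_0_r in HK.
  set (q := peval_quot a (S n) h 0) in *.
  replace ((h - 0) * q - lam * h)%C with (RtoC h * (q - lam))%C in Hd by ring.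
  rewrite Cmod_mult, Mh, (Rmult_comm (m / 4)) in Hd. apply Rmult_le_reg_l in Hd; auto.
  assert (m <= m / 4 + m / 4); [|lra].
  unfold m at 1. rewrite <- Cmod_R, RtoC_minus.
  replace (a 1%nat - lam)%C with ((q - lam) - (q - a 1%nat))%C by ring.
  eapply Rle_trans; [apply Cmod_triangle|]. rewrite Cmod_opp. lra.
Qed.

Lemma has_jet2_iter (f : C -> C) (n : nat) (z : C) :
  (forall z, has_jet2 f z) -> has_jet2 (iter f n) z.
Proof.
  intros Hf. induction n as [|n IH]; [apply has_jet2_id|].
  apply (has_jet2_comp f (iter f n)); auto.
Qed.

Lemma iter_peval_conj (a : nat -> R) (d n : nat) (z : C) :
  iter (peval a d) n (Cconj z) = Cconj (iter (peval a d) n z).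
Proof. induction n as [|n IH]; simpl; [auto|]. now rewrite IH, peval_conj. Qed.

Lemma escapes_conj (a : nat -> R) (d : nat) (R : R) (z : C) :
  escapes (peval a d) R (Cconj z) -> escapes (peval a d) R z.
Proof.
  intros [n Hn]. exists n. now rewrite iter_peval_conj, Cmod_conj in Hn.
Qed.

(** The signs of the coordinates confine the angle to [[0, pi/2]], where the sine is increasing. *)
Lemma uplog_near_axis (b : R) (t : C) : 0 < b < PI / 2 -> 0 < fst t -> 0 <= snd t ->
  snd t <= sin b * Cmod t -> 0 <= snd (uplog t) <= b.
Proof.
  intros Hb Hx Hy Hs. pose proof PI_RGT_0 as Hpi.
  assert (Ht : t <> 0%C) by (intros ->; simpl in Hx; lra).
  pose proof (cexp_uplog t Ht) as E. apply Cmod_gt_0 in Ht.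
  assert (Hu : - (PI / 2) < snd (uplog t) <= 3 * (PI / 2)).
  { unfold uplog, clog; simpl. pose proof (carg_bound (- Ci * t)) as B. simpl in B. lra. }
  assert (M : exp (fst (uplog t)) = Cmod t) by (rewrite <- E at 2; now rewrite Cmod_cexp).
  set (u := uplog t) in *.
  assert (E1 : Cmod t * cos (snd u) = fst t) by (rewrite <- M, <- E at 1; reflexivity).
  assert (E2 : Cmod t * sin (snd u) = snd t) by (rewrite <- M, <- E at 1; reflexivity).
  assert (U1 : snd u < PI / 2).
  { apply Rnot_le_lt. intros L. pose proof (cos_le_0 (snd u) L ltac:(lra)). nra. }
  assert (U2 : 0 <= snd u).
  { apply Rnot_lt_le. intros L. pose proof (sin_lt_0_var (snd u) ltac:(lra) L). nra. }
  split; auto. apply Rnot_lt_le. intros L.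
  pose proof (sin_increasing_1 b (snd u) ltac:(lra) ltac:(lra) ltac:(lra) ltac:(lra) L). nra.
Qed.

Lemma cexp_pos_angle (w : C) : Cmod w = 1 -> cexp (0, carg w) = w.
Proof.
  intros Hw. rewrite <- (cexp_clog w) at 2.
  - unfold clog. now rewrite Hw, ln_1.
  - apply Cmod_gt_0. lra.
Qed.

(* Compare [v] with [v + PI / (2 |B|)]. *)
Lemma sin_zero_slope (A B V : R) :
  (forall v, V < v -> exists e, Rabs e <= 1 / 4 /\ sin (A + v * B + e) = 0) -> B = 0.
Proof.
  intros H. apply NNPP. intros NB. pose proof (Rabs_pos_lt B NB) as HB. pose proof PI_RGT_0 as Hpi.
  set (w := PI / 2 / Rabs B). assert (w0 : 0 < w) by (repeat apply Rdiv_lt_0_compat; lra).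
  destruct (H (V + 1)) as [e1 [He1 S1]]; [lra|].
  destruct (H (V + 1 + w)) as [e2 [He2 S2]]; [lra|].
  apply Rabs_le_between in He1. apply Rabs_le_between in He2.
  set (x := A + (V + 1) * B + e1) in *.
  assert (Ex : A + (V + 1 + w) * B + e2 = x + (w * B + (e2 - e1))) by (unfold x; ring).
  rewrite Ex, sin_plus, S1 in S2.
  assert (C1 : cos x <> 0).
  { intros C0. pose proof (sin2_cos2 x) as SC. rewrite S1, C0 in SC. unfold Rsqr in SC. lra. }
  assert (Z : sin (w * B + (e2 - e1)) = 0).
  { apply Rmult_eq_reg_l with (cos x); auto. lra. }
  pose proof PI2_1 as P1.
  (* The errors change the phase by at most [1/2], too little to undo the quarter turn [w * B]. *)
  assert (Hc : 0 < cos (e2 - e1)) by (apply cos_gt_0; lra).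
  assert (HwB : w * B = PI / 2 \/ w * B = - (PI / 2)).
  { unfold w. destruct (Rle_dec 0 B).
    - left. rewrite Rabs_pos_eq by auto. field; auto.
    - right. rewrite Rabs_left by lra. field; auto. }
  rewrite sin_plus in Z. destruct HwB as [W|W]; rewrite W in Z;
  rewrite ?sin_neg, ?cos_neg, sin_PI2, cos_PI2 in Z; lra.
Qed.

Theorem theorem2
  (d : nat) (a : nat -> R) (lam beta : R) (Phi F : C -> C) :
  (2 <= d)%nat ->
  a 0%nat = 0 ->
  a d <> 0 ->
  1 < lam ->
  @is_derive C_AbsRing C_NormedModule (peval a d) (RtoC 0) (RtoC lam) ->
  0 < beta ->
  (forall z, sector beta z -> fatou_inf (peval a d) z) ->
  (* Phi entire with Phi(lam z) = p(Phi z), Phi(0)=0, Phi'(0)=1 *)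
  (forall z, holo_at Phi z) ->
  (forall z, Phi (Cmult (RtoC lam) z) = peval a d (Phi z)) ->
  Phi (RtoC 0) = RtoC 0 ->
  @is_derive C_AbsRing C_NormedModule Phi (RtoC 0) (RtoC 1) ->
  (* F holomorphic and 1-periodic on the strip |Im w| < beta / log lam *)
  (forall w, Rabs (snd w) < beta / ln lam -> holo_at F w) ->
  (forall w, Rabs (snd w) < beta / ln lam -> F (Cplus w (RtoC 1)) = F w) ->
  (* asymptotics:  Phi z = a_d^(-1/(d-1)) exp(z^rho F(log_lam z) + o(|z|^-M)) *)
  (forall eps M delta, 0 < eps -> 0 < M -> 0 < delta ->
     exists R0, forall z, z <> RtoC 0 -> Rabs (carg z) <= beta - eps -> R0 < Cmod z ->
       exists e, Cmod e <= delta * Rpower (Cmod z) (- M) /\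
         Phi z = Cmult (cpow (RtoC (a d)) (RtoC (- 1 / INR (d - 1))))
                   (cexp (Cplus (Cmult (cpow z (RtoC (ln (INR d) / ln lam)))
                                       (F (Cdiv (clog z) (RtoC (ln lam))))) e))) ->
  (* a ray whose image meets both F_oo and the Julia set *)
  (exists gamma r1 r2, 0 < r1 /\ 0 < r2 /\
     fatou_inf (peval a d) (Phi (Cmult (RtoC r1) (cexp (0%R, gamma)))) /\
     julia (peval a d) (Phi (Cmult (RtoC r2) (cexp (0%R, gamma))))) ->
  ~ (exists c : C, forall w, Rabs (snd w) < beta / ln lam -> F w = c).
Proof.
  intros Hd a0 ad Hlam Hder Hbeta Hsec Pholo Pfun P0 Pder _ _ Hasym Hray [cF HF].
  pose proof PI_RGT_0 as Hpi.
  destruct d as [|[|m]]; [lia|lia|]. set (d := S (S m)) in *. set (f := peval a d) in *.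
  assert (Ha1 : a 1%nat = lam) by now apply (peval_derive_0 a (S m)).
  assert (fjet : forall z, has_jet2 f z) by (intros; apply has_jet2_peval).
  assert (fcont : forall z, ccont f z) by (intros; now apply has_jet2_cont).
  assert (f0 : f 0%C = 0%C) by (unfold f; now rewrite peval_at_0, a0).
  destruct (peval_escape a m ad) as [rad fesc]. change (escape_radius f rad) in fesc.
  assert (Pnear : forall eps, 0 < eps -> exists del, 0 < del /\
     forall h, Cmod h <= del -> Cmod (Phi h - h) <= eps * Cmod h).
  { intros eps He. destruct (is_derive_C_eps _ _ _ Pder eps He) as [del [D H]].
    exists del; split; auto. intros h Hh. specialize (H h Hh).
    rewrite Cplus_0_l, P0 in H. now replace (Phi h - 0 - 1 * h)%C with (Phi h - h)%C in H by ring. }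
  destruct (peval_quot_near0 a (S m)) as [K1 [K10 HK1]]. rewrite Ha1 in HK1.
  assert (Papp : forall T, (exists B, forall z, Cmod z <= T -> Cmod (Phi z) <= B) /\
    forall eps, 0 < eps -> exists n,
      forall z, Cmod z <= T -> Cmod (Phi z - iter f n (z / lam ^ n)%C) <= eps).
  { apply (linearizer_approx f Phi lam K1); auto.
    - intros M. apply peval_lipschitz.
    - intros x y Hx Hy. unfold f. rewrite peval_quot_spec, Cmod_mult, Rmult_comm.
      apply Rmult_le_compat_r; [apply Cmod_ge_0|]. specialize (HK1 x y Hx Hy).
      pose proof (Cmod_triangle_rev (peval_quot a d x y) lam) as T.
      rewrite Cmod_R, (Rabs_pos_eq lam) in T by lra. fold d in HK1. lra. }
  (* Iterates of a real polynomial commute with conjugation, and so does their limit. *)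
  assert (Pconj : forall z, Phi (Cconj z) = Cconj (Phi z)).
  { intros z. assert (Z : Cmod (Phi (Cconj z) - Cconj (Phi z)) = 0).
    { apply Rle_antisym; [|apply Cmod_ge_0]. apply Rnot_lt_le. intros Hpos.
      set (e := Cmod (Phi (Cconj z) - Cconj (Phi z))) in *.
      destruct (proj2 (Papp (Cmod z)) (e / 4)) as [n Hn]; [lra|].
      pose proof (Hn z ltac:(lra)) as H1. pose proof (Hn (Cconj z) ltac:(rewrite Cmod_conj; lra)) as H2.
      assert (Hlc : RtoC (lam ^ n) <> 0%C).
      { intros E. apply RtoC_inj in E. pose proof (pow_lt lam n ltac:(lra)). lra. }
      replace (Cconj z / lam ^ n)%C with (Cconj (z / lam ^ n)) in H2.
      2:{ rewrite <- RtoC_pow. unfold Cdiv. rewrite <- RtoC_inv by (intros E; apply Hlc; now rewrite E).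
          unfold Cconj, Cmult, RtoC; simpl. f_equal; ring. }
      unfold f in H2. rewrite iter_peval_conj in H2. fold f in H2.
      set (q := iter f n (z / lam ^ n)) in *.
      pose proof (Cmod_triangle (Phi (Cconj z) - Cconj q) (Cconj (q - Phi z))) as T.
      rewrite Cmod_conj, (Cmod_minus_sym q) in T.
      replace (Phi (Cconj z) - Cconj q + Cconj (q - Phi z))%C with (Phi (Cconj z) - Cconj (Phi z))%C in T.
      2:{ unfold Cminus, Cplus, Copp, Cconj; simpl. f_equal; ring. }
      fold e in T. lra. }
    apply Cmod_eq_0 in Z. replace (Phi (Cconj z)) with (Phi (Cconj z) - Cconj (Phi z) + Cconj (Phi z))%C by ring.
    rewrite Z. ring. }
  assert (Preal : forall x : R, snd (Phi x) = 0).
  { intros x. pose proof (Pconj x) as H. replace (Cconj x) with (RtoC x) in H.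
    2:{ unfold Cconj, RtoC; simpl. now rewrite Ropp_0. }
    apply (f_equal snd) in H. unfold Cconj in H; simpl in H. lra. }
  set (D := INR d). assert (D2 : 2 <= D) by (unfold D; change 2 with (INR 2); now apply le_INR).
  assert (lD : 0 < ln D) by (rewrite <- ln_1; apply ln_increasing; lra).
  assert (ll : 0 < ln lam) by (rewrite <- ln_1; apply ln_increasing; lra).
  set (rho := ln D / ln lam). assert (rho0 : 0 < rho) by now apply Rdiv_lt_0_compat.
  set (kap := ln lam / ln D). assert (kap0 : 0 < kap) by now apply Rdiv_lt_0_compat.
  assert (rk : rho * kap = 1) by (unfold rho, kap; field; lra).
  (* A logarithm of the leading factor, so that the asymptotics become a single exponential. *)
  set (s0 := (RtoC (- 1 / INR (d - 1)) * clog (RtoC (a d)))%C).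
  (* The case [M = 1] on the half-sector: for [|z| > 1] the factor [|z|^(-1)] is at most 1, and
     [log_lam z] lies inside the strip where [F] is constant. *)
  assert (Asy : forall eta, 0 < eta -> exists X, 1 <= X /\ forall z, Rabs (carg z) <= beta / 2 ->
     X < Cmod z -> exists e, Cmod e <= eta /\ Phi z = cexp (s0 + cpow z rho * cF + e)%C).
  { intros eta He. destruct (Hasym (beta / 2) 1 eta) as [R0 HR]; try lra.
    exists (Rmax 1 R0). split; [apply Rmax_l|]. intros z Hz HX.
    pose proof (Rmax_l 1 R0); pose proof (Rmax_r 1 R0).
    destruct (HR z) as [e [He1 He2]]; [|lra|lra|].
    { intros ->. rewrite Cmod_0 in HX. lra. }
    exists e. split.
    - eapply Rle_trans; [apply He1|]. rewrite <- (Rmult_1_r eta) at 2.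
      apply Rmult_le_compat_l; [lra|]. unfold Rpower.
      assert (0 < ln (Cmod z)) by (rewrite <- ln_1; apply ln_increasing; lra).
      apply Rle_trans with (exp 0); [left; apply exp_increasing|rewrite exp_0]; lra.
    - rewrite He2, HF.
      + unfold cpow at 1. fold s0. rewrite <- cexp_plus. f_equal.
        fold D rho. ring.
      + unfold clog, Cdiv. rewrite <- RtoC_inv by lra. simpl.
        replace (Cmod z * 0) with 0 by ring.
        replace (ln (Cmod z) * 0 + carg z * / ln lam) with (carg z / ln lam) by (unfold Rdiv; ring).
        unfold Rdiv. rewrite Rabs_mult, (Rabs_pos_eq (/ ln lam)).
        2:{ apply Rlt_le, Rinv_0_lt_compat; auto. }
        apply Rmult_lt_compat_r; [now apply Rinv_0_lt_compat|lra]. }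
  clearbody s0.
  assert (AsyR : forall eta, 0 < eta -> exists X, 1 <= X /\ forall x, X < x ->
     exists e, Cmod e <= eta /\ Phi x = cexp (s0 + RtoC (exp (rho * ln x)) * cF + e)%C).
  { intros eta He. destruct (Asy eta He) as [X [X1 HX]]. exists X. split; auto. intros x Hx.
    assert (Cx : clog x = RtoC (ln x)) by (apply clog_pos_real; lra).
    destruct (HX x) as [e [He1 He2]].
    - apply (f_equal snd) in Cx. simpl in Cx. rewrite Cx, Rabs_R0. lra.
    - rewrite Cmod_R, Rabs_pos_eq; lra.
    - exists e. split; auto. rewrite He2. unfold cpow.
      now rewrite Cx, <- RtoC_mult, cexp_real. }
  (* For [x^rho = v] the real number [Phi x] has phase [Im s0 + v Im cF + Im e], whose sine must
     vanish for all large [v]. *)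
  assert (cIm : snd cF = 0).
  { destruct (AsyR (1 / 4)) as [X [X1 HX]]; [lra|].
    apply (sin_zero_slope (snd s0) (snd cF) (exp (rho * ln X))). intros v Hv.
    assert (v0 : 0 < v) by (pose proof (exp_pos (rho * ln X)); lra).
    destruct (HX (exp (ln v / rho))) as [e [He1 He2]].
    { rewrite <- (exp_ln X) at 1 by lra. apply exp_increasing.
      apply Rmult_lt_reg_l with rho; auto.
      replace (rho * (ln v / rho)) with (ln v) by (field; lra).
      rewrite <- (ln_exp (rho * ln X)). apply ln_increasing; auto. apply exp_pos. }
    exists (snd e). split; [eapply Rle_trans; [apply Rabs_snd_le|auto]|].
    pose proof (Preal (exp (ln v / rho))) as Hr. rewrite He2 in Hr.
    rewrite ln_exp in Hr. replace (rho * (ln v / rho)) with (ln v) in Hr by (field; lra).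
    rewrite exp_ln in Hr by auto. unfold cexp in Hr; simpl in Hr.
    match type of Hr with exp ?u * sin ?w = 0 => pose proof (exp_pos u); assert (Hs : sin w = 0) by nra end.
    rewrite <- Hs. f_equal. ring. }
  set (c := fst cF).
  assert (EcF : cF = RtoC c) by (destruct cF; unfold c, RtoC; simpl in *; congruence).
  (* For [c <= 0] the asymptotics bound [Phi] by [exp (Re s0 + 1)] far out on the positive axis. But
     [Phi del] is positive, hence escapes, and its orbit consists of the values
     [Phi (lam^n del)]. *)
  assert (c0 : 0 < c).
  { apply Rnot_le_lt. intros Hc.
    destruct (Pnear (/ 2)) as [del [Dl Hdel]]; [lra|].
    assert (Mx : Cmod del = del) by (rewrite Cmod_R; apply Rabs_pos_eq; lra).
    specialize (Hdel del ltac:(lra)). rewrite Mx in Hdel.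
    pose proof (Rabs_fst_le (Phi del - del)) as Fd. apply Rabs_le_between in Fd. simpl in Fd.
    assert (Hpos : 0 < fst (Phi del)) by (simpl in *; lra).
    assert (Hf : fatou_inf f (Phi del)).
    { apply Hsec. split.
      - intros E. rewrite E in Hpos. simpl in Hpos. lra.
      - replace (Phi del) with (RtoC (fst (Phi del))).
        + pose proof (clog_pos_real _ Hpos) as Cx. apply (f_equal snd) in Cx. simpl in Cx.
          rewrite Cx, Rabs_R0. auto.
        + pose proof (Preal del). destruct (Phi del); unfold RtoC; simpl in *; congruence. }
    apply (fatou_inf_escapes f rad) in Hf; auto.
    destruct (escapes_unbounded f rad _ fesc Hf (exp (fst s0 + 1))) as [N HN].
    destruct (AsyR 1) as [X [X1 HX]]; [lra|].
    destruct (Pow_x_infinity lam) with (b := X / del + 1) as [N' HN'].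
    { rewrite Rabs_pos_eq; lra. }
    specialize (HN (N + N')%nat ltac:(lia)). specialize (HN' (N + N')%nat ltac:(lia)).
    set (n := (N + N')%nat) in *.
    rewrite Rabs_pos_eq in HN' by (apply pow_le; lra).
    assert (It : forall n, iter f n (Phi del) = Phi (lam ^ n * del)%R).
    { induction n0 as [|k IH]; [simpl; now rewrite Rmult_1_l|].
      simpl iter. rewrite IH. unfold f. rewrite <- Pfun. f_equal.
      rewrite <- RtoC_mult. f_equal. simpl. ring. }
    rewrite It in HN.
    assert (Hx : X < lam ^ n * del).
    { apply Rlt_le_trans with ((X / del + 1) * del).
      - replace ((X / del + 1) * del) with (X + del) by (field; lra). lra.
      - apply Rmult_le_compat_r; lra. }
    destruct (HX _ Hx) as [e [He1 He2]].
    rewrite He2, Cmod_cexp, EcF in HN. apply exp_lt_inv in HN. simpl in HN.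
    pose proof (Rabs_fst_le e) as Fe. apply Rabs_le_between in Fe.
    pose proof (exp_pos (rho * ln (lam ^ n * del))) as Ep.
    assert (exp (rho * ln (lam ^ n * del)) * c <= 0) by nra.
    lra. }
  assert (Kasym : exists b s0, 0 < b < PI / 2 /\ forall eta, 0 < eta -> exists X, forall t,
    0 < fst t -> 0 <= snd t -> snd t <= sin b * Cmod t -> X <= Cmod t ->
    exists e, Cmod e <= eta /\ Phi (upower kap c t) = cexp (s0 + t + e)%C).
  (* [kap b <= beta / 2] keeps [upower] in the sector of the asymptotics, and [kap b <= 1 < PI]
     makes [clog] invert [cexp] there. *)
  { set (b := Rmin (PI / 4) (Rmin (beta / 2) 1 / kap)).
    assert (Hmin : 0 < Rmin (beta / 2) 1) by (apply Rmin_pos; lra).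
    assert (b0 : 0 < b) by (apply Rmin_pos; [lra|now apply Rdiv_lt_0_compat]).
    assert (b1 : b <= PI / 4) by apply Rmin_l.
    assert (b2 : kap * b <= Rmin (beta / 2) 1).
    { replace (Rmin (beta / 2) 1) with (kap * (Rmin (beta / 2) 1 / kap)) by (field; lra).
      apply Rmult_le_compat_l; [lra|apply Rmin_r]. }
    pose proof (Rmin_l (beta / 2) 1) as m1. pose proof (Rmin_r (beta / 2) 1) as m2.
    exists b, s0. split; [lra|]. intros eta He. destruct (Asy eta He) as [X [X1 HX]].
    exists (exp (ln c + ln X / kap) + 1). intros t t1 t2 t3 t4.
    pose proof (uplog_near_axis b t ltac:(lra) t1 t2 t3) as Hu.
    pose proof PI2_1 as HP.
    assert (Hsn : snd (RtoC kap * (uplog t - RtoC (ln c)))%C = kap * snd (uplog t)).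
    { destruct (uplog t); simpl; ring. }
    assert (Hku : 0 <= kap * snd (uplog t) <= Rmin (beta / 2) 1).
    { split; [apply Rmult_le_pos; lra|]. eapply Rle_trans; [|apply b2]. apply Rmult_le_compat_l; lra. }
    assert (Cz : clog (upower kap c t) = (RtoC kap * (uplog t - RtoC (ln c)))%C).
    { apply clog_cexp. rewrite Hsn. lra. }
    destruct (HX (upower kap c t)) as [e [He1 He2]].
    - change (Rabs (snd (clog (upower kap c t))) <= beta / 2).
      rewrite Cz, Hsn, Rabs_pos_eq; lra.
    - rewrite Cmod_upower. rewrite <- (exp_ln X) at 1 by lra. apply exp_increasing.
      assert (Hl : ln c + ln X / kap < ln (Cmod t)).
      { rewrite <- (ln_exp (ln c + ln X / kap)). apply ln_increasing; [apply exp_pos|lra]. }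
      replace (ln X) with (kap * (ln X / kap)) by (field; lra).
      apply Rmult_lt_compat_l; lra.
    - exists e. split; auto. rewrite He2. f_equal. f_equal. f_equal.
      unfold cpow. rewrite Cz.
      replace (RtoC rho * (RtoC kap * (uplog t - RtoC (ln c))))%C with (uplog t + RtoC (- ln c))%C.
      + rewrite cexp_plus, cexp_uplog, cexp_real.
        * rewrite exp_Ropp, exp_ln, EcF, RtoC_inv by lra. field.
          intros E. apply RtoC_inj in E. lra.
        * intros ->. simpl in t1. lra.
      + transitivity (RtoC (rho * kap) * (uplog t - RtoC (ln c)))%C.
        * rewrite rk, RtoC_opp. ring.
        * rewrite RtoC_mult. ring. }
  assert (Ray : forall r1 r2 gam, 0 < r1 -> 0 < r2 -> 0 <= gam <= PI ->
    escapes f rad (Phi (RtoC r1 * cexp (0, gam))%C) -> escapes f rad (Phi (RtoC r2 * cexp (0, gam))%C)).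
  { intros r1 r2 gam H1 H2 H3. apply (ray_dichotomy f Phi d kap c rad); auto.
    - apply peval_relative_expanding; auto.
    - intros z. fold D. replace (kap * ln D) with (ln lam) by (unfold kap; field; lra).
      rewrite exp_ln by lra. apply Pfun.
    - apply Pnear. lra.
    - intros T. destruct (Papp T) as [PB PA]. split; auto.
      intros eps He. destruct (PA eps He) as [n Hn].
      exists (fun z => iter f n (z / lam ^ n)%C). split; auto.
      intros z. apply (has_jet2_comp (iter f n) (fun z => z / lam ^ n)%C).
      + apply has_jet2_mult; [apply has_jet2_id|apply has_jet2_const].
      + now apply has_jet2_iter. }
  destruct Hray as [gam [r1 [r2 [Hr1 [Hr2 [H1 H2]]]]]].
  apply (fatou_inf_escapes f rad) in H1; auto.
  assert (H2' : ~ escapes f rad (Phi (RtoC r2 * cexp (0, gam))%C)).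
  { intros H. apply H2. now apply (escapes_fatou f rad). }
  (* The ray depends on [gam] through [w] alone, so the principal argument of [w] may replace it. *)
  apply H2'. set (w := cexp (0, gam)) in *.
  assert (Hw : Cmod w = 1) by (unfold w; rewrite Cmod_cexp; apply exp_0).
  pose proof (carg_bound w) as Hg.
  destruct (Rle_dec 0 (carg w)) as [L|L].
  - rewrite <- (cexp_pos_angle w Hw) in H1 |- *. apply (Ray r1); auto. lra.
  (* For a negative angle the conjugate ray lies in the upper half-plane, and conjugation preserves
     escaping. *)
  - assert (Ew : cexp (0, - carg w) = Cconj w).
    { rewrite <- (cexp_pos_angle w Hw) at 2. unfold cexp, Cconj; simpl.
      rewrite cos_neg, sin_neg. f_equal; ring. }
    assert (Er : forall r : R, Phi (RtoC r * Cconj w)%C = Cconj (Phi (RtoC r * w)%C)).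
    { intros r. rewrite <- Pconj. f_equal. unfold Cconj, Cmult, RtoC; simpl. f_equal; ring. }
    apply (escapes_conj a d). rewrite <- Er, <- Ew. apply (Ray r1); auto; [lra|].
    rewrite Ew, Er. apply (escapes_conj a d). unfold Cconj at 1; simpl.
    rewrite Ropp_involutive. now destruct (Phi (RtoC r1 * w)%C).
Qed.
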